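(* Let $\Theta$ be a connected linear Nakayama algebra of rank $n$ with defect vector $v_\Theta=(\operatorname{def}P_1,\operatorname{def}P_2,\ldots,\operatorname{def}P_n)$. Then, for any vector $w=(\operatorname{def}P_1+m,\operatorname{def}P_2,\ldots,\operatorname{def}P_n)$ with $m\geq1$ an integer, there exists a cyclic Nakayama algebra $\Lambda$ such that $\boldsymbol\varepsilon(\Lambda)\cong\Theta$, $\operatorname{def}\Lambda=|w|$ and $\operatorname{dom.dim}\Lambda=1$, where $|w|$ is the sum of the entries of $w$.
   Context: A Nakayama algebra is $\mathbb{K}Q/I$ over a field $\mathbb{K}$ with $I$ admissible, $Q$ an oriented cycle (cyclic case) or a linearly oriented quiver of type $\mathbb{A}$ (connected linear case); rank is the number of vertices. Simples are labelled so that $S_{i+1}\cong\tau S_i$ ($\tau$ the Auslander--Reiten translate), $P_i=P(S_i)$ has composition factors $S_i,S_{i+1},\dots$ from top to socle (in the linear case $P_n=S_n$). Defect: for an indecomposable projective $P$, $\operatorname{def}P$ is the number of (nonzero) proper injective quotients of $P$; $\operatorname{def}\Lambda=\sum_P\operatorname{def}P$ over isomorphism classes of indecomposable projectives. For a cyclic Nakayama algebra $\Lambda$, let $\mathcal{S}(\Lambda)$ be a complete set of representatives of isomorphism classes of socles of indecomposable projective $\Lambda$-modules; $\boldsymbol\varepsilon(\Lambda):=\operatorname{End}_\Lambda\big(\bigoplus_{S\in\mathcal{S}(\Lambda)}P(\tau S)\big)$. Dominant dimension: for a module $M$ with minimal injective resolution $0\to M\to I_0\to I_1\to\cdots$, the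 maximal $t$ (or $\infty$) such that $I_j$ is projective for all $j<t$; for an algebra, the infimum over projective non-injective modules.
   Formalization: The case n = 1, m = 1 is excluded: there Θ = K, and ε(Λ) ≅ K with def Λ = 1 forces Λ to have rank 2 and projectives of lengths 3 and 2, whose dominant dimension is 2, so the claim fails. *)

(* Defs.v *)
From HB Require Import structures.
From mathcomp Require Import all_boot all_order all_algebra all_field.
From mathcomp Require Import finmap.
From mathcomp Require Import monalg.

Set Implicit Arguments.
Unset Strict Implicit.
Unset Printing Implicit Defensive.

Import GRing.Theory.
Local Open Scope ring_scope.

Record quiver := Quiver {
  vertex : finType;
  arrow : finType;
  source : arrow -> vertex;
  target : arrow -> vertex }.

Fixpoint is_walk (Q : quiver) (v : vertex Q) (s : seq (arrow Q)) : bool :=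
  if s is a :: s' then (source a == v) && is_walk (target a) s' else true.

(* A path is its starting vertex together with its consecutive arrows, so that
   the trivial path at [v] is [(v, [::])]. *)
Record qpath (Q : quiver) := QPath {
  walk : vertex Q * seq (arrow Q);
  walkP : is_walk walk.1 walk.2 }.
HB.instance Definition _ (Q : quiver) := [isSub for @walk Q].
HB.instance Definition _ (Q : quiver) := [Choice of qpath Q by <:].

Section Paths.
Variable Q : quiver.

Definition path_source (p : qpath Q) : vertex Q := (walk p).1.
Definition path_arrows (p : qpath Q) : seq (arrow Q) := (walk p).2.
Definition path_target (p : qpath Q) : vertex Q :=
  last (path_source p) (map (@target Q) (path_arrows p)).
Definition path_length (p : qpath Q) : nat := size (path_arrows p).

Definition trivial_path (v : vertex Q) : qpath Q :=
  @QPath Q (v, [::]) (erefl true).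

(* Concatenation "first [p], then [q]"; [None] if [p] and [q] do not compose. *)
Definition path_cat (p q : qpath Q) : option (qpath Q) :=
  if path_target p == path_source q
  then insub (path_source p, path_arrows p ++ path_arrows q) else None.

Lemma is_walk_cat (v : vertex Q) (s t : seq (arrow Q)) :
  is_walk v (s ++ t) = is_walk v s && is_walk (last v (map (@target Q) s)) t.
Proof. by elim: s v => [|a s IHs] v //=; rewrite IHs andbA. Qed.

Lemma path_catE (p q : qpath Q) : path_target p = path_source q ->
  exists2 r, path_cat p q = Some r
           & walk r = (path_source p, path_arrows p ++ path_arrows q).
Proof.
move=> e; rewrite /path_cat e eqxx; case: insubP => [r _ er|]; first by exists r.
have /= := valP p; have /= := valP q; rewrite /= is_walk_cat => wq ->.
by move: e; rewrite /path_target => ->; rewrite /path_source /path_arrows wq.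
Qed.

End Paths.

Section PathAlgebra.
Variables (K : fieldType) (Q : quiver).

Definition path_mul (x y : {malg K[qpath Q]}) : {malg K[qpath Q]} :=
  \sum_(p <- msupp x) \sum_(q <- msupp y)
     if path_cat p q is Some r then << x@_p * y@_q *g r >> else 0.

Definition path_one : {malg K[qpath Q]} :=
  \sum_(v : vertex Q) << trivial_path v >>.

(* The [m]-th power of the arrow ideal. *)
Definition arrow_ideal (m : nat) (x : {malg K[qpath Q]}) : Prop :=
  forall p, p \in msupp x -> (m <= path_length p)%N.

Definition two_sided_ideal (I : {malg K[qpath Q]} -> Prop) : Prop :=
  [/\ I 0, (forall x y, I x -> I y -> I (x + y)),
      (forall x y, I y -> I (path_mul x y))
    & (forall x y, I x -> I (path_mul x y))].

Definition admissible (I : {malg K[qpath Q]} -> Prop) : Prop :=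
  [/\ two_sided_ideal I,
      (exists2 m, (2 <= m)%N & forall x, arrow_ideal m x -> I x)
    & (forall x, I x -> arrow_ideal 2 x)].

(* [A] is isomorphic to [KQ/I], as a [K]-algebra: [pi] is the composite
   [KQ -> KQ/I ~ A]. *)
Definition is_path_quotient (I : {malg K[qpath Q]} -> Prop) (A : falgType K) :
    Prop :=
  exists pi : {linear {malg K[qpath Q]} -> A},
    [/\ (forall a, exists x, pi x = a),
        pi path_one = 1,
        (forall x y, pi (path_mul x y) = pi x * pi y)
      & (forall x, pi x = 0 <-> I x)].

Definition is_bound_quiver_algebra (A : falgType K) : Prop :=
  exists2 I, admissible I & is_path_quotient I A.

End PathAlgebra.

Definition cyclic_quiver (n : nat) : quiver :=
  @Quiver 'I_n 'I_n id (@ordS n).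

Lemma linear_target_subproof (n : nat) (i : 'I_n.-1) : (i.+1 < n)%N.
Proof. by case: n i => [|n] [i ltin]. Qed.

(* [0 -> 1 -> ... -> n.-1] *)
Definition linear_quiver (n : nat) : quiver :=
  @Quiver 'I_n 'I_n.-1 (widen_ord (leq_pred n))
    (fun i => Ordinal (linear_target_subproof i)).

Definition cyclic_nakayama (K : fieldType) (A : falgType K) : Prop :=
  exists2 n, (0 < n)%N & is_bound_quiver_algebra (cyclic_quiver n) A.

Definition linear_nakayama (K : fieldType) (n : nat) (A : falgType K) : Prop :=
  (0 < n)%N /\ is_bound_quiver_algebra (linear_quiver n) A.

(* Right modules: paths being composed from left to right, the projective at a
   vertex [v] is then spanned by the paths starting at [v]. *)
Record rmod (K : fieldType) (A : falgType K) := RMod {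
  rmod_sort :> vectType K;
  ract : rmod_sort -> A -> rmod_sort;
  ract_linearl : forall a, linear (fun x => ract x a);
  ract_linearr : forall x, linear (ract x);
  ract1 : forall x, ract x 1 = x;
  ractM : forall x a b, ract x (a * b) = ract (ract x a) b }.

Record lmod (K : fieldType) (A : falgType K) := LMod {
  lmod_sort :> vectType K;
  lact : A -> lmod_sort -> lmod_sort;
  lact_linearl : forall x, linear (fun a => lact a x);
  lact_linearr : forall a, linear (lact a);
  lact1 : forall x, lact 1 x = x;
  lactM : forall x a b, lact (a * b) x = lact a (lact b x) }.

Section Modules.
Variables (K : fieldType) (A : falgType K).
Implicit Types M N P S T X Y : rmod A.

Definition is_hom M N (f : 'Hom(M, N)) : Prop :=
  forall x a, f (ract x a) = ract (f x) a.

Definition iso M N : Prop :=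
  exists f : 'Hom(M, N), [/\ is_hom f, lker f = 0%VS & limg f = fullv].

Definition submod M (U : {vspace M}) : Prop :=
  forall x a, x \in U -> ract x a \in U.

Definition nonzero M : Prop := (fullv : {vspace M}) <> 0%VS.

Definition simple M : Prop :=
  nonzero M /\
  forall U : {vspace M}, submod U -> U = 0%VS \/ U = fullv.

Definition indecomposable M : Prop :=
  nonzero M /\
  forall U V : {vspace M}, submod U -> submod V ->
    (U + V)%VS = fullv -> (U :&: V)%VS = 0%VS -> U = 0%VS \/ V = 0%VS.

Definition projective P : Prop :=
  forall X Y (g : 'Hom(X, Y)) (f : 'Hom(P, Y)),
    is_hom g -> limg g = fullv -> is_hom f ->
    exists2 h : 'Hom(P, X), is_hom h & forall x, g (h x) = f x.

Definition injective_mod M : Prop :=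
  forall X Y (g : 'Hom(X, Y)) (f : 'Hom(X, M)),
    is_hom g -> lker g = 0%VS -> is_hom f ->
    exists2 h : 'Hom(Y, M), is_hom h & forall x, h (g x) = f x.

Definition indec_projective P : Prop := indecomposable P /\ projective P.

Definition superfluous M (U : {vspace M}) : Prop :=
  forall V : {vspace M}, submod V -> (U + V)%VS = fullv -> V = fullv.

Definition essential M (U : {vspace M}) : Prop :=
  forall V : {vspace M}, submod V -> (U :&: V)%VS = 0%VS -> V = 0%VS.

(* [f : P -> M] is, after restriction of its codomain, a projective cover of the
   submodule [U] of [M]. *)
Definition proj_cover_onto P M (f : 'Hom(P, M)) (U : {vspace M}) : Prop :=
  [/\ projective P, is_hom f, limg f = U & superfluous (lker f)].

Definition is_proj_cover M P : Prop :=
  exists f : 'Hom(P, M), proj_cover_onto f fullv.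

Definition complete_reps (C : rmod A -> Prop) (r : nat) (X : 'I_r -> rmod A) :
    Prop :=
  [/\ (forall i, C (X i)), (forall i j, iso (X i) (X j) -> i = j)
    & (forall M, C M -> exists i, iso M (X i))].

Definition simple_submod M (U : {vspace M}) : Prop :=
  [/\ submod U, U <> 0%VS
    & forall V : {vspace M}, submod V -> (V <= U)%VS -> V = 0%VS \/ V = U].

Definition socle M (U : {vspace M}) : Prop :=
  (forall V, simple_submod V -> (V <= U)%VS) /\
  (exists s : seq {vspace M},
     (forall V, V \in s -> simple_submod V) /\ U = (\sum_(V <- s) V)%VS).

Definition is_socle_of P S : Prop :=
  exists f : 'Hom(S, P), [/\ is_hom f, lker f = 0%VS & socle (limg f)].

Definition is_direct_sum r (X : 'I_r -> rmod A) M : Prop :=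
  exists (inj : forall i, 'Hom(X i, M)) (prj : forall i, 'Hom(M, X i)),
  [/\ (forall i, is_hom (inj i)), (forall i, is_hom (prj i)),
      (forall i x, prj i (inj i x) = x),
      (forall i j x, i <> j -> prj j (inj i x) = 0)
    & (forall x, x = \sum_i inj i (prj i x))].

Lemma regular_linearl (a : A) : linear (fun x : A => x * a).
Proof. by move=> k x y; rewrite mulrDl scalerAl. Qed.

Lemma regular_linearr (x : A) : linear (fun a : A => x * a).
Proof. by move=> k a b; rewrite mulrDr scalerAr. Qed.

Definition regular : rmod A :=
  @RMod K A A (fun x a => x * a) regular_linearl regular_linearr
    (@mulr1 A) (@mulrA A).

Definition is_min_presentation M P1 P0 (p1 : 'Hom(P1, P0)) (p0 : 'Hom(P0, M)) :
    Prop :=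
  proj_cover_onto p0 fullv /\ proj_cover_onto p1 (lker p0).

(* [X] is the transpose of [M]: the cokernel of
   [Hom_A(p1, A) : Hom_A(P0, A) -> Hom_A(P1, A)], where [a] in [A] acts on [f]
   in [Hom_A(P, A)] by [(a f) x = a * f x].  The cokernel map is the restriction
   of [q] to the subspace of [A]-linear maps. *)
Definition is_transpose M (X : lmod A) : Prop :=
  exists (P1 P0 : rmod A) (p1 : 'Hom(P1, P0)) (p0 : 'Hom(P0, M)),
  is_min_presentation p1 p0 /\
  exists q : 'Hom('Hom(P1, regular), X),
  [/\ (forall (a : A) (f : 'Hom(P1, regular)), is_hom f ->
         q (amull a \o f)%VF = lact a (q f)),
      (forall x, exists2 f : 'Hom(P1, regular), is_hom f & q f = x)
    & (forall f : 'Hom(P1, regular), is_hom f ->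
         (q f = 0 <->
          exists2 g : 'Hom(P0, regular), is_hom g & f = (g \o p1)%VF))].

(* [T] is isomorphic to the right module [Hom_K(X, K)], on which [A] acts by
   [(phi a) x = phi (a x)]. *)
Definition is_dual (X : lmod A) T : Prop :=
  exists b : 'Hom(T, 'Hom(X, K^o)),
  [/\ lker b = 0%VS, limg b = fullv
    & forall t a x, b (ract t a) x = b t (lact a x)].

(* [T] is isomorphic to [D Tr M]. *)
Definition is_tau M T : Prop :=
  exists2 X : lmod A, is_transpose M X & is_dual X T.

Definition injective_quotient M (U : {vspace M}) : Prop :=
  exists (X : rmod A) (q : 'Hom(M, X)),
  [/\ is_hom q, limg q = fullv, lker q = U & injective_mod X].

(* [M] has exactly [d] nonzero proper quotients [M / U] that are injective. *)
Definition has_defect M (d : nat) : Prop :=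
  exists s : seq {vspace M},
  [/\ uniq s, size s = d
    & forall U, U \in s <->
        [/\ U <> 0%VS, U <> fullv & injective_quotient U]].

Definition has_alg_defect (d : nat) : Prop :=
  exists (r : nat) (P : 'I_r -> rmod A) (dP : 'I_r -> nat),
  [/\ complete_reps indec_projective P, (forall i, has_defect (P i) (dP i))
    & d = (\sum_i dP i)%N].

Definition is_min_inj_resolution M (I : nat -> rmod A)
    (d0 : 'Hom(M, I 0%N)) (d : forall j, 'Hom(I j, I j.+1)) : Prop :=
  [/\ (forall j, injective_mod (I j)),
      is_hom d0 /\ (forall j, is_hom (d j)),
      lker d0 = 0%VS,
      lker (d 0%N) = limg d0 /\ (forall j, lker (d j.+1) = limg (d j))
    & essential (limg d0) /\ (forall j, essential (limg (d j)))].

(* [dom.dim M >= t]; the minimal injective resolution of [M] exists and is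
   unique up to isomorphism. *)
Definition domdim_ge M (t : nat) : Prop :=
  forall I d0 d, @is_min_inj_resolution M I d0 d ->
    forall j, (j < t)%N -> projective (I j).

(* [dom.dim A = t]: [t] is the infimum of [dom.dim P] over the projective
   non-injective modules [P]. *)
Definition has_domdim (t : nat) : Prop :=
  (forall P, projective P -> ~ injective_mod P -> domdim_ge P t) /\
  (exists P, [/\ projective P, ~ injective_mod P & ~ domdim_ge P t.+1]).

(* [S i] and [P i] are the simple [S_(i+1)] and the projective [P_(i+1)] of the
   usual labelling from [1] to [n]. *)
Definition linear_labelling n (S P : 'I_n -> rmod A) : Prop :=
  [/\ complete_reps simple S,
      (forall i j : 'I_n, j = i.+1 :> nat -> is_tau (S i) (S j))
    & (forall i, is_proj_cover (S i) (P i))].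

(* [E] is isomorphic to [End_A(M)], with product the composition of maps. *)
Definition is_End M (E : falgType K) : Prop :=
  exists phi : 'Hom(E, 'Hom(M, M)),
  [/\ lker phi = 0%VS, (forall f, f \in limg phi <-> is_hom f),
      phi 1 = \1%VF & forall x y, phi (x * y) = (phi x \o phi y)%VF].

Definition is_epsilon (E : falgType K) : Prop :=
  exists (r : nat) (S T P : 'I_r -> rmod A) (M : rmod A),
  [/\ complete_reps
        (fun X => exists2 P, indec_projective P & is_socle_of P X) S,
      (forall i, is_tau (S i) (T i)),
      (forall i, is_proj_cover (T i) (P i)),
      is_direct_sum P M
    & is_End M E].

End Modules.

(* Main.v *)
From HB Require Import structures.
Require Import Defs.
From mathcomp Require Import all_boot all_order all_algebra all_field.
From mathcomp Require Import finmap.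
From mathcomp Require Import monalg.
From mathcomp Require Import zify.

(* Both algebras are handled through their Kupisch series [c]: a Nakayama algebra
   with [N] cyclically ordered vertices has a basis of paths [x v l], [l < c v],
   and a linear one is the case where the last projective is simple.  The module
   with top [v] and length [l] is injective iff [c (v - 1) <= l], so
   [def P_v] is the truncated difference [c v - c (v - 1)], and around the cycle
   these add up to the number of [v] with [c v = c (v + 1) + 1].

   Put [d i = i + c i] for [Theta].  The cyclic algebra has [n] minimal relations
   [a_j -> b_j], the [b_j] being the vertices of the syzygy filtered algebra, and
   [epsilon(Lambda) = Theta] says that exactly [d i] of the [a_j] lie before
   [b_i]: only the interleaving of the [a_j] and the [b_i] is prescribed.  The
   tightest interleaving has [n + def Theta] vertices, and [m] more are inserted
   just before the last [b_i].  A vertex [v] of this kind is not one of the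
   [b_i], so the cokernel of [P_v -> I(P_v)], whose socle is [S_(v - 1)], has a
   non-projective injective hull, and the dominant dimension is 1. *)

(** The defect of the cyclic algebra does not depend on the interleaving: over one period [J] climbs
    from 1 to [n] by steps of at most 1, and the other steps, [N - n] in number, are exactly the
    places with [c v = c (v + 1) + 1]. So [N] is forced to be [n + def Theta + m], and the only
    freedom is where the surplus vertices go. Just before the last [b_i] the value of [J] is already
    [n], because the last two [d i] coincide when [n > 1]; inserting vertices there disturbs no
    prescribed value and creates a stationary step that does not lead to a relation end.

    Admissibility asks for projectives of length at least 2. This could fail only at the seam
    between two periods or at the last relation, whence the conditions [0 < b 0] and the gap of 2
    before the last [b_i].

    When [n = m = 1] the only candidate has Kupisch series (3, 2): its one stationary step leads to
    the relation end, and its dominant dimension is 2. This case has to be excluded. *)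

Set Implicit Arguments.
Unset Strict Implicit.
Unset Printing Implicit Defensive.

Import GRing.Theory.

(** * The Kupisch series of the cyclic algebra *)

(* A nonnegative representative of [v - 1] modulo [N]. *)
Definition vpred N v := v + N.-1.

Section Interleaving.
Variable d : nat -> nat.

Definition repeats k := \sum_(i < k) (d i == d i.+1).

Record interleaving (k : nat) (b J : nat -> nat) : Prop := Interleaving {
  int_lt : forall i, i < k -> b i < b i.+1;
  int_J0 : J 0 = 1;
  int_JS : forall v, J v <= J v.+1 <= (J v).+1;
  int_Jb : forall i, i <= k -> J (b i) = d i }.

(* Each value of [J] is taken just often enough to accommodate the [b i] with
   that value, once if there are none. *)
Lemma interleaving_ex k : 0 < d 0 -> (forall i, i < k -> d i <= d i.+1) ->
  exists b J, interleaving k b J /\ b k + 1 = d k + repeats k.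
Proof.
move=> d0; elim: k => [|k IHk] mon.
  exists (fun _ => (d 0).-1), (fun v => v.+1); split; last first.
    by rewrite /repeats big_ord0 /=; lia.
  by split=> // [v|[|//] _] /=; [rewrite leqnn ltnW|lia].
have [i ik|b [J [[bl J0 JS Jb] bk]]] := IHk; first by apply: mon; lia.
have dk := mon k (ltnSn k).
(* After [b k], [J] rises by one per vertex until it reaches [d k.+1]; when there is no rise a
   distance of 1 is still needed, and that vertex is what [repeats] counts. *)
pose b' i := if i <= k then b i else b k + maxn 1 (d k.+1 - d k).
pose J' v := if v <= b k then J v else minn (d k.+1) (d k + (v - b k)).
have bm i : i <= k -> b i <= b k.
  elim: k bl {IHk JS Jb bk dk mon b' J'} => [|k IH] bl; first by rewrite leqn0 => /eqP ->.
  rewrite leq_eqVlt => /orP[/eqP -> //|ik]; apply: leq_trans (ltnW (bl k _)) => //.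
  by apply: IH => // j jk; apply: bl; lia.
exists b', J'; split; last first.
  rewrite /b' ltnn /repeats big_ord_recr /=; move: bk; rewrite /repeats.
  by case: eqP => e /=; lia.
split=> [i|||i].
- rewrite ltnS /b' => ik; rewrite ik; case: (ltnP i k) => ik'; first by rewrite bl.
  have -> : i = k by lia.
  lia.
- by rewrite /J'.
- move=> v; rewrite /J'; case: (ltngtP v (b k)) => vb.
  + exact: JS.
  + by lia.
  + by rewrite vb (Jb k (leqnn k)); lia.
rewrite leq_eqVlt /b' /J' => /orP[/eqP ->|]; last first.
  by rewrite ltnS => ik; rewrite ik bm // Jb.
by rewrite ltnn; case: ifP; lia.
Qed.

End Interleaving.

(* The data of the relations of the cyclic algebra: [b i] is the end of the
   [i]-th relation and [J v] the index of the relation that cuts off [P_v]. *)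
Lemma interleaving_final n m d : 0 < n -> 0 < m -> ~ (n = 1 /\ m = 1) ->
  (forall i, i < n -> i < d i <= n) -> (forall i, i.+1 < n -> i.+1 < d i) ->
  (forall i, i.+1 < n -> d i <= d i.+1) ->
  exists b J, [/\ interleaving d n.-1 b J,
    b n.-1 = (n.-1 + repeats d n.-1 + m)%N,
    0 < b 0, forall i, i.+2 = n -> b i + 2 <= b i.+1
  & exists v, [/\ v < b n.-1, J v.+1 = J v & forall i, i < n -> b i <> v.+1]].
Proof.
case: n => [//|[|n]] _ m0 nm dn d2 dm.
  have d0 : d 0 = 1 by have := dn 0 isT; lia.
  (* With a single relation [J] stays at 1, and the vertex after 0 is the relation end only if
     [m = 1]. *)
  exists (fun _ => m), (fun _ => 1); split=> //.
  - by split=> // -[].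
  - by rewrite /repeats big_ord0; lia.
  - by exists 0; split=> // i _; lia.
(* The last projective of the linear algebra is simple and the one before it has length 2, so the
   last two values of [d] agree. *)
have dn0 : d n = n.+2 by have := dn n (ltnW (ltnSn _)); have := d2 n (ltnSn _); lia.
have dn1 : d n.+1 = n.+2 by have := dn n.+1 (ltnSn _); lia.
have [||b [J [[bl J0 JS Jb] bk]]] := @interleaving_ex d n.
- by have := dn 0 isT; lia.
- by move=> i ik; apply: dm; lia.
have bm i : i <= n -> b i <= b n.
  move=> iN; have h t : i + t <= n -> b i <= b (i + t).
    elim: t => [|t IH] tn; first by rewrite addn0.
    by rewrite addnS; apply: leq_trans (IH _) (ltnW (bl _ _)); lia.
  by have := h (n - i); rewrite subnKC // => ->.
(* The 1 accounts for the repeated value [d n = d n.+1], and [m] for the inserted vertices. *)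
pose b' i := if i <= n then b i else b n + 1 + m.
pose J' v := if v <= b n then J v else n.+2.
exists b', J'; split.
- split=> [i|||i].
  + rewrite ltnS /b' => iN; rewrite iN; case: (ltnP i n) => h; first by rewrite bl.
    have -> : i = n by lia.
    lia.
  + by rewrite /J'.
  + move=> v; rewrite /J'; case: (ltngtP v (b n)) => vb; [exact: JS|lia|].
    by rewrite vb Jb // dn0; lia.
  + rewrite leq_eqVlt /b' /J' => /orP[/eqP ->|]; last by rewrite ltnS => h; rewrite h bm // Jb.
    rewrite /= ltnn dn1; case: ifP => //; lia.
- rewrite /= /b' ltnn /repeats big_ord_recr /= -/(repeats d n) dn0 dn1 eqxx /=; lia.
- rewrite /b' /= lt0n; apply/eqP => b0; have := Jb 0 isT; rewrite b0 J0.
  by have := d2 0 isT; lia.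
- move=> i [->]; rewrite /b' leqnn ltnn; lia.
(* As [m] is positive, [b n + 1] lies strictly between the last two relation ends. *)
exists (b n); split.
- by rewrite /= /b' ltnn; lia.
- by rewrite /J' ltnn leqnn Jb // dn0.
move=> i; rewrite ltnS /b'; case: (leqP i n) => [h _|]; last by lia.
by have := bm i h; lia.
Qed.

Lemma discrete_ivt (J : nat -> nat) N j : J 0 <= j -> j <= J N ->
  (forall v, J v.+1 <= (J v).+1) -> exists2 v, v <= N & J v = j.
Proof.
move=> j0 jN JS; have ex : exists v, j <= J v by exists N.
case: (ex_minnP ex) => v jv vmin; exists v; first exact: vmin.
case: v jv vmin => [|v] jv vmin; first by apply/eqP; rewrite eqn_leq j0.
apply/eqP; rewrite eqn_leq jv andbT; apply: leq_trans (JS v) _.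
by rewrite ltnNge; apply/negP => /vmin; rewrite ltnn.
Qed.

Lemma sum_shift N (f : nat -> nat) : (forall v, f (v + N) = f v) ->
  \sum_(v < N) f v.+1 = \sum_(v < N) f v.
Proof.
case: N => [|N] fN; first by rewrite !big_ord0.
rewrite big_ord_recr [RHS]big_ord_recl /= addnC; congr (_ + _).
by rewrite -(fN 0).
Qed.

(* The increments of [c] around the cycle cancel its decrements, and the latter
   are at most 1. *)
Lemma sum_positive_parts N c : 0 < N -> (forall v, c (v + N) = c v) ->
  (forall v, c v <= (c v.+1).+1) ->
  \sum_(v < N) (c v - c (vpred N v)) = \sum_(v < N) (c v == (c v.+1).+1).
Proof.
move=> N0 cN cS; have predS v : c (vpred N v).+1 = c v.
  by rewrite /vpred -addnS prednK // cN.
have h1 : \sum_(v < N) c (vpred N v) = \sum_(v < N) c v.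
  rewrite -(sum_shift (f := fun v => c (vpred N v))) => [|v].
    by apply: eq_bigr => v _; rewrite /vpred addSn predS.
  by rewrite /vpred addnAC cN.
have h2 : \sum_(v < N) (c (vpred N v) == (c v).+1) = \sum_(v < N) (c v == (c v.+1).+1).
  rewrite -(sum_shift (f := fun v => c (vpred N v) == (c v).+1 : nat)) => [|v].
    by apply: eq_bigr => v _; rewrite /vpred addSn predS.
  by rewrite /vpred addnAC !cN.
have : \sum_(v < N) (c v + (c (vpred N v) == (c v).+1)) =
    \sum_(v < N) (c (vpred N v) + (c v - c (vpred N v))).
  apply: eq_bigr => v _; have := cS (vpred N v); rewrite predS.
  by case: eqP => e /=; lia.
by rewrite !big_split /= h1 h2 => /addnI.
Qed.

Lemma sum_stationary (J : nat -> nat) N : (forall v, J v <= J v.+1 <= (J v).+1) ->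
  \sum_(v < N) (J v == J v.+1) + J N = N + J 0.
Proof.
move=> JS; elim: N => [|N IH]; first by rewrite big_ord0.
rewrite big_ord_recr /=; move: IH; set s := \sum_(v < N) _ => IH.
by have := JS N; case: eqP => e /=; lia.
Qed.

(** * Lengths, drops and socles of the projectives, read off from an interleaving *)

Section KupischSeries.
Variables (n : nat) (c b J : nat -> nat).
Let d i := (i + c i)%N.
Hypotheses (n0 : 0 < n) (dn : forall i, i < n -> i < d i <= n).
Hypotheses (d2 : forall i, i.+1 < n -> i.+1 < d i) (b0 : 0 < b 0).
Hypotheses (int : interleaving d n.-1 b J).
Hypothesis bgap : forall i, i.+2 = n -> b i + 2 <= b i.+1.
Let N := (b n.-1).+1.

Lemma rel_end_lt i j : i < j -> j < n -> b i < b j.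
Proof.
move=> ij jn; have h t : i + t < n -> b i <= b (i + t).
  elim: t => [|t IH] tn; first by rewrite addn0.
  by rewrite addnS; apply: leq_trans (IH _) (ltnW (int_lt int _)); lia.
have := h (j.-1 - i); have -> : i + (j.-1 - i) = j.-1 by lia.
have := int_lt int (i := j.-1); rewrite prednK; last lia.
lia.
Qed.

Lemma rel_end_ltN i : i < n -> b i < N.
Proof.
move=> iN; rewrite ltnS; case: (ltngtP i n.-1) => [h|h|-> //]; last by lia.
by apply: ltnW; apply: rel_end_lt => //; lia.
Qed.

Lemma cut_mono v w : v <= w -> J v <= J w.
Proof.
move=> /subnKC <-; elim: (w - v) => [|t IH]; first by rewrite addn0.
by rewrite addnS (leq_trans IH) //; case/andP: (int_JS int (v + t)).
Qed.

Lemma cut_end i : i < n -> J (b i) = d i.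
Proof. by move=> iN; apply: (int_Jb int); lia. Qed.

Lemma cut_last : J N.-1 = n.
Proof.
rewrite /N /= cut_end ?prednK //; have := dn (i := n.-1); rewrite prednK //.
by move=> /(_ (leqnn _)); lia.
Qed.

Lemma cut_range v : v < N -> 0 < J v <= n.
Proof.
move=> vN; have h1 := cut_mono (leq0n v); have h2 : J v <= J N.-1 by apply: cut_mono.
by move: h1 h2; rewrite cut_last (int_J0 int) => -> ->.
Qed.

(* [b] extended to [n], where the relations repeat with period [N]. *)
Definition rel_end j := if j < n then b j else b 0 + N.
Definition proj_end v := rel_end (J v).
Definition kupisch v := proj_end (v %% N) - v %% N.

Lemma rel_end_mono j k : j < k -> k <= n -> rel_end j < rel_end k.
Proof.
move=> jk kn; rewrite /rel_end (leq_trans jk) //.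
case: (ltnP k n) => kn'; first exact: rel_end_lt.
by have := rel_end_ltN (leq_trans jk kn); lia.
Qed.

Lemma rel_end_le j k : j <= k -> k <= n -> rel_end j <= rel_end k.
Proof. by rewrite leq_eqVlt => /orP[/eqP -> //|jk kn]; apply/ltnW/rel_end_mono. Qed.

(** If the relation [J v] ended by [v + 1], monotonicity of [J] would give [d (J v) <= J v + 1],
    which by [d2] leaves only the last relation. There [bgap] puts the preceding end before [v],
    where [J] has already reached [n]. The case [J v = n] is settled by [0 < b 0]. *)
Lemma proj_end_gt v : v < N -> v + 2 <= proj_end v.
Proof.
move=> vN; rewrite /proj_end /rel_end; case: ifP => jn; last by lia.
have jv := cut_range vN; rewrite leqNgt; apply/negP => bj.
have h : d (J v) <= (J v).+1.
  rewrite -(cut_end jn); apply: leq_trans (cut_mono (w := v.+1) _) _; first lia.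
  by case/andP: (int_JS int v).
have := dn jn; have h2 := @d2 (J v); have jE : (J v).+1 = n by lia.
have := @bgap (J v).-1; rewrite prednK; last lia.
have := cut_end (i := (J v).-1); have := dn (i := (J v).-1).
have := @d2 (J v).-1; have := @cut_mono (b (J v).-1) v.
lia.
Qed.

Lemma kupischE v : v < N -> v + kupisch v = proj_end v.
Proof. by move=> vN; rewrite /kupisch modn_small //; have := proj_end_gt vN; lia. Qed.

Lemma kupisch_gt1 v : 1 < kupisch v.
Proof. by have := proj_end_gt (ltn_pmod v (ltn0Sn (b n.-1))); rewrite /kupisch -/N; lia. Qed.

Lemma kupisch_periodic v : kupisch (v + N) = kupisch v.
Proof. by rewrite /kupisch modnDr. Qed.

Lemma kupisch_last : kupisch N.-1 = (b 0).+1.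
Proof.
have h : N.-1 < N by [].
have := kupischE h; rewrite /proj_end cut_last /rel_end ltnn /N /=; lia.
Qed.

Lemma kupisch_first : kupisch 0 = rel_end 1.
Proof. by have := @kupischE 0 isT; rewrite add0n /proj_end (int_J0 int). Qed.

Lemma rel_end0_lt1 : b 0 < rel_end 1.
Proof. by have := @rel_end_mono 0 1 isT n0; rewrite {1}/rel_end n0. Qed.

Lemma kupisch_mod v : kupisch (v %% N) = kupisch v.
Proof. by rewrite /kupisch modn_mod. Qed.

Lemma proj_end_le v : v.+1 < N -> proj_end v <= proj_end v.+1.
Proof.
move=> vN; apply: rel_end_le; first by case/andP: (int_JS int v).
by case/andP: (cut_range vN).
Qed.

Lemma kupisch_step v : kupisch v <= (kupisch v.+1).+1.
Proof.
have N0 : 0 < N by []; have vN := ltn_pmod v N0.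
rewrite -(kupisch_mod v) -(kupisch_mod v.+1).
have -> : v.+1 %% N = (v %% N).+1 %% N by rewrite -(addn1 v) -modnDml addn1.
move: (v %% N) vN => {}v vN; case: (ltngtP v.+1 N) => h; last 2 first.
- by lia.
- rewrite h modnn kupisch_first (_ : v = N.-1) ?kupisch_last; last by rewrite -h.
  by rewrite ltnW // ltnS rel_end0_lt1.
rewrite modn_small //; have := kupischE vN; have := kupischE h.
by have := proj_end_le h; lia.
Qed.

(** Both sides say that [P_v] and [P_(v + 1)] are cut off at the same vertex, so that the second is
    the radical of the first. *)
Lemma kupisch_drop v : v.+1 < N -> (kupisch v == (kupisch v.+1).+1) = (J v == J v.+1).
Proof.
move=> vN; have := kupischE vN; have := kupischE (ltnW vN); rewrite /proj_end.
have /andP[J1 J2] := int_JS int v; have /andP[_ jn] := cut_range vN.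
case: (eqVneq (J v) (J v.+1)) => [->|ne] e1 e2; first by lia.
have := @rel_end_mono (J v) (J v.+1); lia.
Qed.

(** Of the [N - 1] steps inside a period, the [n - 1] at which [J] rises are not drops, and neither
    is the step across the seam. *)
Lemma sum_kupisch_drops : \sum_(v < N) (kupisch v == (kupisch v.+1).+1) + n = N.
Proof.
rewrite {2}/N big_ord_recr /=.
have -> : (kupisch (b n.-1) == (kupisch N).+1) = false.
  have /= -> := kupisch_last; rewrite -[N]add0n kupisch_periodic kupisch_first.
  by have := rel_end0_lt1; lia.
rewrite addn0 (eq_bigr (fun v : 'I__ => (J v == J v.+1) : nat)) => [|v _]; last first.
  by rewrite kupisch_drop // ltnS.
have := sum_stationary (b n.-1) (int_JS int); rewrite (int_J0 int).
by have := cut_last; rewrite /N /= => ->; rewrite addn1.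
Qed.

(** The vertex [v + kupisch v] comes right after the socle of [P_v]. Together with [socle_surj] this
    identifies the socles of projectives with the simples at the predecessors of the [b i]. *)
Lemma proj_end_socle v : exists2 i, i < n & v + kupisch v = b i %[mod N].
Proof.
have vN : v %% N < N by rewrite ltn_pmod.
rewrite -modnDml -(kupisch_mod v) kupischE // /proj_end /rel_end.
case: ifP => h; first by exists (J (v %% N)).
by exists 0 => //; rewrite modnDr.
Qed.

Lemma socle_surj i : i < n -> exists2 v, v < N & v + kupisch v = b i %[mod N].
Proof.
(* [J] takes the values 1 to [n], so the relation of index 0 is met as the one of index [n], a
   period later. *)
move=> iN; pose j := if i == 0 then n else i.
have JS v : J v.+1 <= (J v).+1 by case/andP: (int_JS int v).
have [||v vN Jv] := @discrete_ivt J N.-1 j _ _ JS.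
- by rewrite (int_J0 int) /j; case: eqP; lia.
- by rewrite cut_last /j; case: eqP; lia.
exists v => //; rewrite kupischE // /proj_end /rel_end Jv /j.
by case: eqP => [->|_]; rewrite ?ltnn ?iN // modnDr.
Qed.

Lemma rel_end_congr i j : i < n -> j < n -> b i = b j %[mod N] -> i = j.
Proof.
move=> iN jN; rewrite !modn_small ?rel_end_ltN // => e.
case: (ltngtP i j) => // h; first by have := rel_end_lt h jN; rewrite e ltnn.
by have := rel_end_lt h iN; rewrite e ltnn.
Qed.

Lemma kupisch_rel_end i : i < n -> b i + kupisch (b i) = rel_end (d i).
Proof. by move=> iN; rewrite kupischE ?rel_end_ltN // /proj_end cut_end. Qed.

End KupischSeries.

Local Open Scope ring_scope.

(** * Modules over a finite-dimensional algebra *)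

Section ModuleGenerals.
Variables (K : fieldType) (A : falgType K).
Implicit Types M N X Y : rmod A.

Lemma linear_lfun (V W : vectType K) (f : V -> W) :
  linear f -> exists g : 'Hom(V, W), g =1 f.
Proof.
move=> lin; pose L := GRing.isLinear.Build K V W *:%R f lin.
pose ff : {linear V -> W} := HB.pack f L.
by exists (linfun ff) => x; rewrite lfunE.
Qed.

Lemma ractDl M (x y : M) a : ract (x + y) a = ract x a + ract y a.
Proof. by have [g e] := linear_lfun (@ract_linearl _ _ M a); rewrite -!e linearD. Qed.

Lemma ractZl M k (x : M) a : ract (k *: x) a = k *: ract x a.
Proof. by have [g e] := linear_lfun (@ract_linearl _ _ M a); rewrite -!e linearZ. Qed.

Lemma ract0l M a : ract (0 : M) a = 0.
Proof. by rewrite -(scale0r 0) ractZl !scale0r. Qed.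

Lemma ract_suml M I (r : seq I) (Q : pred I) (F : I -> M) a :
  ract (\sum_(i <- r | Q i) F i) a = \sum_(i <- r | Q i) ract (F i) a.
Proof. exact: (big_morph (fun x => ract x a) (fun x y => ractDl x y a) (ract0l M a)). Qed.

Lemma ractDr M (x : M) a b : ract x (a + b) = ract x a + ract x b.
Proof. by have [g e] := linear_lfun (ract_linearr x); rewrite -!e linearD. Qed.

Lemma ractZr M k (x : M) a : ract x (k *: a) = k *: ract x a.
Proof. by have [g e] := linear_lfun (ract_linearr x); rewrite -!e linearZ. Qed.

Lemma ract0r M (x : M) : ract x 0 = 0.
Proof. by rewrite -(scale0r 0) ractZr !scale0r. Qed.

Lemma ract_sumr M I (r : seq I) (Q : pred I) (x : M) F :
  ract x (\sum_(i <- r | Q i) F i) = \sum_(i <- r | Q i) ract x (F i).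
Proof. exact: (big_morph (ract x) (ractDr x) (ract0r x)). Qed.

Lemma is_hom_comp M N X (g : 'Hom(N, X)) (f : 'Hom(M, N)) :
  is_hom g -> is_hom f -> is_hom (g \o f)%VF.
Proof. by move=> hg hf x a; rewrite !comp_lfunE hf hg. Qed.

Lemma is_hom_id M : is_hom (\1%VF : 'Hom(M, M)).
Proof. by move=> x a; rewrite !id_lfunE. Qed.

Lemma is_hom_inv M N (f : 'Hom(M, N)) :
  is_hom f -> lker f = 0%VS -> limg f = fullv -> is_hom (f^-1)%VF.
Proof.
move=> hf /eqP kf im x a; apply: (lker0P kf).
by rewrite hf !limg_lfunVK // im memvf.
Qed.

Lemma limg_fullP (V W : vectType K) (f : 'Hom(V, W)) :
  (forall y, exists x, f x = y) <-> limg f = fullv.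
Proof.
split=> [h|e y].
  apply/vspaceP=> y; rewrite memvf; have [x <-] := h y.
  by rewrite memv_img ?memvf.
by have /memv_imgP[x _ ->] : y \in limg f; [rewrite e memvf | exists x].
Qed.

Lemma lker_inj (V W : vectType K) (f : 'Hom(V, W)) :
  (forall x, f x = 0 -> x = 0) -> lker f = 0%VS.
Proof.
move=> h; apply/eqP; rewrite -subv0; apply/subvP=> x; rewrite memv_ker memv0.
by move/eqP/h/eqP.
Qed.

Lemma submod_ker M N (f : 'Hom(M, N)) : is_hom f -> submod (lker f).
Proof.
by move=> hf x a; rewrite !memv_ker hf => /eqP ->; rewrite ract0l.
Qed.

Lemma submod_img M N (f : 'Hom(M, N)) (U : {vspace M}) :
  is_hom f -> submod U -> submod (f @: U)%VS.
Proof.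
move=> hf sU _ a /memv_imgP[x xU ->]; rewrite -hf; apply: memv_img; exact: sU.
Qed.

Lemma submod_full M : submod (fullv : {vspace M}).
Proof. by move=> x a _; rewrite memvf. Qed.

Section Submodule.
Variables (M : rmod A) (U : {vspace M}) (sU : submod U).

Let act (x : subvs_of U) a := vsproj U (ract (vsval x) a).
Let actE x a : vsval (act x a) = ract (vsval x) a.
Proof. by rewrite /act vsprojK // sU // subvsP. Qed.

Fact sub_linearl a : linear (fun x => act x a).
Proof.
by move=> k x y; apply: subvs_inj; rewrite actE /= ractDl ractZl !actE.
Qed.
Fact sub_linearr x : linear (act x).
Proof.
by move=> k a b; apply: subvs_inj; rewrite actE /= ractDr ractZr !actE.
Qed.
Fact sub_ract1 x : act x 1 = x.
Proof. by apply: subvs_inj; rewrite actE ract1. Qed.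
Fact sub_ractM x a b : act x (a * b) = act (act x a) b.
Proof. by apply: subvs_inj; rewrite !actE ractM. Qed.

Definition sub_rmod : rmod A := RMod sub_linearl sub_linearr sub_ract1 sub_ractM.

Lemma sub_ractE (x : sub_rmod) a : vsval (ract x a) = ract (vsval x) a.
Proof. exact: actE. Qed.
End Submodule.

Section Quotient.
Variables (M : rmod A) (U : {vspace M}) (sU : submod U).

Let pr (x : M) := x - projv U x.
Let prP x : pr x \in (U^C)%VS. Proof. exact: memv_projC. Qed.
Let pr_id x : x \in (U^C)%VS -> pr x = x.
Proof. by rewrite -lker_proj memv_ker /pr => /eqP ->; rewrite subr0. Qed.
Let pr0 x : x \in U -> pr x = 0.
Proof. by move=> xU; rewrite /pr projv_id // subrr. Qed.
Let pr_lin : linear pr.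
Proof. by move=> k x y; rewrite /pr linearP scalerBr addrACA opprD. Qed.
HB.instance Definition _ := GRing.isLinear.Build K M M *:%R pr pr_lin.

Let quo (x : M) : subvs_of (U^C)%VS := vsproj (U^C)%VS (pr x).
Let quoE x : vsval (quo x) = pr x. Proof. by rewrite /quo vsprojK. Qed.
Let quo_lin : linear quo.
Proof. by move=> k x y; rewrite /quo linearP /= linearP. Qed.
HB.instance Definition _ := GRing.isLinear.Build K M _ *:%R quo quo_lin.
Let quoK x : quo (vsval x) = x.
Proof. by apply: subvs_inj; rewrite quoE pr_id // subvsP. Qed.
Let quo0 x : x \in U -> quo x = 0.
Proof. by move=> xU; rewrite /quo pr0 // linear0. Qed.

Let act (x : subvs_of (U^C)%VS) a := quo (ract (vsval x) a).
Let actE x a : act (quo x) a = quo (ract x a).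
Proof.
apply/eqP; rewrite -subr_eq0 /act -linearB /= quo0 // quoE.
rewrite -scaleN1r -ractZl -ractDl scaleN1r; apply: sU.
by rewrite /pr addrAC subrr add0r memvN memv_proj.
Qed.

Fact quo_linearl a : linear (fun x => act x a).
Proof. by move=> k x y; rewrite /act linearP /= ractDl ractZl linearP. Qed.
Fact quo_linearr x : linear (act x).
Proof. by move=> k a b; rewrite /act ractDr ractZr linearP. Qed.
Fact quo_ract1 x : act x 1 = x.
Proof. by rewrite /act ract1 quoK. Qed.
Fact quo_ractM x a b : act x (a * b) = act (act x a) b.
Proof. by rewrite -[x]quoK !actE ractM. Qed.

(** The quotient is realised on the complement of [U], the action being followed by the projection
    along [U]. *)
Definition quo_rmod : rmod A := RMod quo_linearl quo_linearr quo_ract1 quo_ractM.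

Definition quo_map : 'Hom(M, quo_rmod) := linfun quo.

Lemma quo_map_hom : is_hom quo_map.
Proof. by move=> x a; rewrite !lfunE /= -actE. Qed.

Lemma limg_quo_map : limg quo_map = fullv.
Proof. by apply/limg_fullP=> y; exists (vsval y); rewrite lfunE /= quoK. Qed.

Lemma lker_quo_map : lker quo_map = U.
Proof.
apply/vspaceP=> x; rewrite memv_ker lfunE /=; apply/eqP/idP => [h|/quo0//].
have : pr x = 0 by rewrite -quoE h.
by move/eqP; rewrite subr_eq0 => /eqP ->; rewrite memv_proj.
Qed.
End Quotient.

Section Power.
Variables (I : finType) (M : rmod A).

Let act (x : {ffun I -> M}) a := [ffun i => ract (x i) a].
Fact pow_linearl a : linear (fun x => act x a).
Proof. by move=> k x y; apply/ffunP=> i; rewrite !ffunE ractDl ractZl. Qed.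
Fact pow_linearr x : linear (act x).
Proof. by move=> k a b; apply/ffunP=> i; rewrite !ffunE ractDr ractZr. Qed.
Fact pow_ract1 x : act x 1 = x.
Proof. by apply/ffunP=> i; rewrite !ffunE ract1. Qed.
Fact pow_ractM x a b : act x (a * b) = act (act x a) b.
Proof. by apply/ffunP=> i; rewrite !ffunE ractM. Qed.

Definition pow_rmod : rmod A := RMod pow_linearl pow_linearr pow_ract1 pow_ractM.

Lemma pow_prj i : exists2 f : 'Hom(pow_rmod, M), is_hom f & forall x, f x = x i.
Proof.
have [|f e] := @linear_lfun pow_rmod M (fun x => x i); first by move=> k x y; rewrite !ffunE.
by exists f => // x a; rewrite !e /= ffunE.
Qed.

Lemma pow_tuple N (g : I -> 'Hom(N, M)) : (forall i, is_hom (g i)) ->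
  exists2 f : 'Hom(N, pow_rmod), is_hom f & forall x i, f x i = g i x.
Proof.
move=> hg; have [|f e] := @linear_lfun N pow_rmod (fun x => [ffun i => g i x]).
  by move=> k x y; apply/ffunP=> i; rewrite !ffunE linearP.
exists f => [x a|x i]; rewrite !e ?ffunE //.
by apply/ffunP=> i; rewrite !ffunE hg.
Qed.
End Power.

(* A finite resolution of the identity exhibits [M] as a summand of a finite
   direct sum of the [X i]. *)
Definition summand (I : finType) (X : I -> rmod A) M : Prop :=
  exists (inj : forall i, 'Hom(X i, M)) (prj : forall i, 'Hom(M, X i)),
  [/\ (forall i, is_hom (inj i)), (forall i, is_hom (prj i))
    & forall x, x = \sum_i inj i (prj i x)].

Lemma is_hom_sum (I : finType) M N (f : I -> 'Hom(M, N)) :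
  (forall i, is_hom (f i)) -> is_hom (\sum_i f i).
Proof.
move=> hf x a; rewrite !sum_lfunE ract_suml.
by apply: eq_bigr => i _; rewrite hf.
Qed.

Lemma summand_projective (I : finType) (X : I -> rmod A) M : summand X M ->
  (forall i, projective (X i)) -> projective M.
Proof.
case=> inj [prj [hi hp e]] pX Y Z g f hg sg hf.
have [h hP] : exists h : forall i, 'Hom(X i, Y), forall i,
    is_hom (h i) /\ forall x, g (h i x) = f (inj i x).
  apply: (@fin_all_exists I (fun i => 'Hom(X i, Y)) (fun i h =>
    is_hom h /\ forall x, g (h x) = f (inj i x))) => i.
  have [h hh eh] := pX i Y Z g _ hg sg (is_hom_comp hf (hi i)).
  by exists h; split=> // x; rewrite eh comp_lfunE.
exists (\sum_i (h i \o prj i))%VF => [|x].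
  by apply: is_hom_sum => i; apply: is_hom_comp => //; case: (hP i).
rewrite sum_lfunE linear_sum [in RHS](e x) linear_sum.
by apply: eq_bigr => i _; rewrite comp_lfunE /=; case: (hP i) => _ ->.
Qed.

Lemma summand_injective (I : finType) (X : I -> rmod A) M : summand X M ->
  (forall i, injective_mod (X i)) -> injective_mod M.
Proof.
case=> inj [prj [hi hp e]] pX Y Z g f hg sg hf.
have [h hP] : exists h : forall i, 'Hom(Z, X i), forall i,
    is_hom (h i) /\ forall x, h i (g x) = prj i (f x).
  apply: (@fin_all_exists I (fun i => 'Hom(Z, X i)) (fun i h =>
    is_hom h /\ forall x, h (g x) = prj i (f x))) => i.
  have [h hh eh] := pX i Y Z g _ hg sg (is_hom_comp (hp i) hf).
  by exists h; split=> // x; rewrite eh comp_lfunE.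
exists (\sum_i (inj i \o h i))%VF => [|x].
  by apply: is_hom_sum => i; apply: is_hom_comp => //; case: (hP i).
rewrite sum_lfunE [in RHS](e (f x)).
by apply: eq_bigr => i _; rewrite comp_lfunE /=; case: (hP i) => _ ->.
Qed.

Lemma summand_pow (I : finType) M : summand (fun _ : I => M) (pow_rmod I M).
Proof.
have [inj injP] : exists inj : I -> 'Hom(M, pow_rmod I M), forall i,
    is_hom (inj i) /\ forall x j, inj i x j = if i == j then x else 0.
  apply: (@fin_all_exists I (fun i => 'Hom(M, pow_rmod I M)) (fun i h =>
    is_hom h /\ forall x j, h x j = if i == j then x else 0)) => i.
  have [|f hf fE] := @pow_tuple I M M (fun j => if i == j then \1%VF else 0).
    by move=> j x a; case: ifP; rewrite ?id_lfunE // !zero_lfunE ract0l.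
  exists f; split=> // x j; rewrite fE; case: ifP; by rewrite ?id_lfunE ?zero_lfunE.
have [prj prjP] : exists prj : I -> 'Hom(pow_rmod I M, M), forall i,
    is_hom (prj i) /\ forall x, prj i x = x i.
  apply: (@fin_all_exists I (fun i => 'Hom(pow_rmod I M, M)) (fun i h =>
    is_hom h /\ forall x, h x = x i)) => i.
  by have [f ? ?] := pow_prj M i; exists f.
exists inj, prj; split=> [i|i|x]; [by case: (injP i)|by case: (prjP i)|].
apply/ffunP=> j; rewrite sum_ffunE (bigD1 j) //= big1 => [|i /negPf ne].
  by rewrite addr0 (injP j).2 eqxx (prjP j).2.
by rewrite (injP i).2 ne.
Qed.

Lemma summand1 M N (i : 'Hom(N, M)) (p : 'Hom(M, N)) :
  is_hom i -> is_hom p -> (forall x, i (p x) = x) -> summand (fun _ : 'I_1 => N) M.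
Proof.
move=> hi hp e; exists (fun _ => i), (fun _ => p); split=> // x.
by rewrite big_ord_recl big_ord0 addr0 e.
Qed.

Lemma projective_retract M N (i : 'Hom(N, M)) (p : 'Hom(M, N)) :
  is_hom i -> is_hom p -> (forall x, i (p x) = x) -> projective N -> projective M.
Proof. by move=> hi hp e pN; apply: summand_projective (summand1 hi hp e) _. Qed.

Lemma projective_section X M (g : 'Hom(X, M)) :
  projective M -> is_hom g -> limg g = fullv ->
  exists2 s : 'Hom(M, X), is_hom s & forall x, g (s x) = x.
Proof.
move=> pM hg sg; have [s hs e] := pM X M g \1%VF hg sg (@is_hom_id M).
by exists s => // x; rewrite e id_lfunE.
Qed.

Lemma injective_retraction M Y (g : 'Hom(M, Y)) :
  injective_mod M -> is_hom g -> lker g = 0%VS ->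
  exists2 r : 'Hom(Y, M), is_hom r & forall x, r (g x) = x.
Proof.
move=> pM hg sg; have [s hs e] := pM M Y g \1%VF hg sg (@is_hom_id M).
by exists s => // x; rewrite e id_lfunE.
Qed.

Lemma regular_hom M (z : M) : exists2 f : 'Hom(regular A, M),
  is_hom f & forall a, f a = ract z a.
Proof.
have [f e] := @linear_lfun (regular A) M _ (ract_linearr z).
by exists f => // x a; rewrite !e ractM.
Qed.

(* A projective module is a summand of a free one; the coordinates of the
   section are the required homomorphisms. *)
Lemma projective_torsionless M : projective M ->
  exists (d : nat) (s : 'I_d -> 'Hom(M, regular A)),
    (forall i, is_hom (s i)) /\ forall x, (forall i, s i x = 0) -> x = 0.
Proof.
move=> pM; pose d := \dim (fullv : {vspace M}).
pose b := vbasis (fullv : {vspace M}); pose F := pow_rmod 'I_d (regular A).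
have [pr prP] : exists pr : 'I_d -> 'Hom(F, regular A), forall i,
    is_hom (pr i) /\ forall x, pr i x = x i.
  apply: (@fin_all_exists 'I_d (fun _ => 'Hom(F, regular A)) (fun i h =>
    is_hom h /\ forall x, h x = x i)) => i.
  by have [f ? ?] := pow_prj (regular A) i; exists f.
have [q qP] : exists q : 'I_d -> 'Hom(regular A, M), forall i,
    is_hom (q i) /\ forall a, q i a = ract b`_i a.
  apply: (@fin_all_exists 'I_d (fun _ => 'Hom(regular A, M)) (fun i h =>
    is_hom h /\ forall a, h a = ract b`_i a)) => i.
  by have [f] := regular_hom b`_i; exists f.
pose g := (\sum_i (q i \o pr i))%VF.
have hg : is_hom g.
  by apply: is_hom_sum => i; apply: is_hom_comp; [case: (qP i)|case: (prP i)].
have [|s hs e] := projective_section pM hg.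
  apply/limg_fullP=> y; exists [ffun i => coord b i y *: (1 : A)].
  rewrite /g sum_lfunE [RHS](coord_vbasis (memvf y)); apply: eq_bigr => i _.
  by rewrite comp_lfunE (qP i).2 (prP i).2 ffunE ractZr ract1.
exists d, (fun i => pr i \o s)%VF; split=> [i|x h].
  by apply: is_hom_comp => //; case: (prP i).
rewrite -[x]e (_ : s x = 0) ?linear0 //; apply/ffunP=> i.
by rewrite -(prP i).2 -comp_lfunE h ffunE.
Qed.

Lemma right_ideal_submod (e : A) :
  submod (limg (amull e) : {vspace regular A}).
Proof.
move=> y a /memv_imgP[z _ ->]; rewrite /= !lfunE /= -mulrA.
by apply/memv_imgP; exists (z * a); rewrite ?memvf // lfunE.
Qed.

Definition right_ideal (e : A) : rmod A := sub_rmod (@right_ideal_submod e).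

Definition ideal_elt (e a : A) : right_ideal e := vsproj _ (e * a).

Lemma ideal_eltE e a : vsval (ideal_elt e a) = e * a.
Proof. by rewrite vsprojK //; apply/memv_imgP; exists a; rewrite ?memvf ?lfunE. Qed.

Lemma ideal_eltP e (y : right_ideal e) : exists a, y = ideal_elt e a.
Proof.
have /memv_imgP[a _ ea] := subvsP y; exists a; apply: subvs_inj.
by rewrite ideal_eltE ea lfunE.
Qed.

Lemma ract_ideal_elt e a b : ract (ideal_elt e a) b = ideal_elt e (a * b).
Proof. by apply: subvs_inj; rewrite sub_ractE !ideal_eltE /= mulrA. Qed.

Lemma ideal_lfun e : exists f : 'Hom(A, right_ideal e), f =1 ideal_elt e.
Proof.
apply: linear_lfun => k a b; apply: subvs_inj.
by rewrite linearP /= !ideal_eltE mulrDr scalerAr.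
Qed.

Lemma separating_functional (V : vectType K) (U : {vspace V}) : U <> fullv ->
  exists f : 'Hom(V, K^o), (forall y, y \in U -> f y = 0) /\ exists z, f z <> 0.
Proof.
move=> neU; have d0 : (0 < \dim (U^C)%VS)%N.
  rewrite lt0n dimv_eq0; apply/eqP=> e; apply: neU.
  by rewrite -(addv_complf U) e addv0.
pose b := vbasis (U^C)%VS; pose i := Ordinal d0.
have [|f e] := @linear_lfun V K^o (fun y => coord b i (y - projv U y)).
  by move=> k x y; rewrite linearP opprD addrACA -scalerBr linearP.
exists f; split=> [y yU|]; first by rewrite e projv_id // subrr linear0.
have bi : b`_i \in (U^C)%VS by apply: vbasis_mem; rewrite mem_nth ?size_tuple.
exists b`_i; rewrite e (_ : projv U _ = 0) ?subr0; last first.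
  by apply/eqP; rewrite -memv_ker lker_proj.
rewrite coord_free ?(basis_free (vbasisP _)) // eqxx; exact/eqP/oner_neq0.
Qed.
End ModuleGenerals.

(** * Nakayama algebras and their uniserial modules *)

(* [x v l] is the path of length [l] from the vertex [v] modulo [N], and [c v] is
   the length of [P_v]. *)
Record nakayama (K : fieldType) (A : falgType K) (N : nat) (c : nat -> nat)
    (x : nat -> nat -> A) : Prop := Nakayama {
  nak_rank : (0 < N)%N;
  nak_len_gt0 : forall v, (0 < c v)%N;
  nak_lenD : forall v, c (v + N)%N = c v;
  nak_lenS : forall v, (c v <= (c v.+1).+1)%N;
  nak_periodic : forall v l, x (v + N)%N l = x v l;
  nak_eq0 : forall v l, (x v l == 0) = (c v <= l)%N;
  nak_mul : forall v l w k,
    x v l * x w k = if v + l == w %[mod N] then x v (l + k)%N else 0;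
  nak_one : \sum_(v < N) x v 0%N = 1;
  nak_span : forall a, exists f : nat -> nat -> K,
    a = \sum_(v < N) \sum_(l < c v) f v l *: x v l }.

Lemma modn_congr (T : Type) (N : nat) (f : nat -> T) :
  (forall v, f (v + N)%N = f v) -> forall v w, v = w %[mod N] -> f v = f w.
Proof.
move=> fN; have h q r : f (q * N + r)%N = f r.
  by elim: q => [|q IH] //; rewrite mulSn -addnA addnC fN IH.
by move=> v w e; rewrite (divn_eq v N) (divn_eq w N) !h e.
Qed.

Section Nakayama.
Variables (K : fieldType) (A : falgType K) (N : nat) (c : nat -> nat).
Variables (x : nat -> nat -> A) (nak : nakayama N c x).
Implicit Types M X P : rmod A.

Lemma len_congr v w : v = w %[mod N] -> c v = c w.
Proof. exact: (modn_congr (nak_lenD nak)). Qed.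

Lemma gen_congr v w l : v = w %[mod N] -> x v l = x w l.
Proof. exact: (modn_congr (f := x^~ l) (nak_periodic nak ^~ l)). Qed.

(** The module [rad^j P_v] is a quotient of [P_(v + j)]. *)
Lemma len_leD v j : (c v <= c (v + j) + j)%N.
Proof.
elim: j => [|j IH]; first by rewrite !addn0.
by apply: leq_trans IH _; rewrite !addnS -addSn leq_add2r (nak_lenS nak).
Qed.

Lemma gen_eq0 v l : (c v <= l)%N -> x v l = 0.
Proof. by move=> h; apply/eqP; rewrite (nak_eq0 nak). Qed.

Lemma gen_mulD v l k : x v l * x (v + l)%N k = x v (l + k)%N.
Proof. by rewrite (nak_mul nak) eqxx. Qed.

Lemma homI M X (f : 'Hom(M, X)) :
  (forall y u t, f (ract y (x u t)) = ract (f y) (x u t)) -> is_hom f.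
Proof.
move=> h y a; have [g ->] := nak_span nak a.
rewrite !ract_sumr linear_sum; apply: eq_bigr => u _.
rewrite !ract_sumr linear_sum; apply: eq_bigr => t _.
by rewrite !ractZr linearZ /= h.
Qed.

Lemma submodI M (U : {vspace M}) :
  (forall y u t, y \in U -> ract y (x u t) \in U) -> submod U.
Proof.
move=> h y a yU; have [g ->] := nak_span nak a.
rewrite !ract_sumr; apply: memv_suml => u _.
rewrite !ract_sumr; apply: memv_suml => t _.
by rewrite !ractZr memvZ // h.
Qed.

Lemma peirce M (y : M) : y = \sum_(v < N) ract y (x v 0%N).
Proof. by rewrite -ract_sumr (nak_one nak) ract1. Qed.

(* [M] has top [S_v] and length [l], and [m k] generates [M rad^k A]. *)
Record uniserial M (v l : nat) (m : nat -> M) : Prop := Uniserial {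
  uni_eq0 : forall k, (m k == 0) = (l <= k)%N;
  uni_span : forall y, exists a : nat -> K, y = \sum_(k < l) a k *: m k;
  uni_act : forall k u t,
    ract (m k) (x u t) = if v + k == u %[mod N] then m (k + t)%N else 0 }.

Section Uniserial.
Variables (M : rmod A) (v l : nat) (m : nat -> M) (uM : uniserial v l m).

Lemma uni_out k : (l <= k)%N -> m k = 0.
Proof. by move=> h; apply/eqP; rewrite (uni_eq0 uM). Qed.

Lemma uni_actD k t : ract (m k) (x (v + k)%N t) = m (k + t)%N.
Proof. by rewrite (uni_act uM) eqxx. Qed.

(** The path is long enough to push every term beyond [k] past the socle, so it isolates the leading
    coefficient. *)
Lemma uni_lead (a : nat -> K) k t : (k < l)%N -> (l <= (k + t).+1)%N ->
  (forall j, (j < k)%N -> a j = 0) ->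
  ract (\sum_(j < l) a j *: m j) (x (v + k)%N t) = a k *: m (k + t)%N.
Proof.
move=> kl lt h; rewrite ract_suml (bigD1 (Ordinal kl)) //= big1 => [|j].
  by rewrite addr0 ractZl uni_actD.
rewrite -val_eqE /= => ne; rewrite ractZl (uni_act uM).
case: (ltngtP j k) ne => // jk _; first by rewrite h // scale0r.
by case: ifP; rewrite ?scaler0 // uni_out ?scaler0 //; lia.
Qed.

Lemma uni_indep (a : nat -> K) :
  \sum_(k < l) a k *: m k = 0 -> forall k, (k < l)%N -> a k = 0.
Proof.
move=> e k; have [n] := ubnP k; elim: n k => // n IH k kn kl.
have h : a k *: m (k + (l - k.+1))%N = 0.
  by rewrite -uni_lead ?e ?ract0l // => [|j jk]; [lia|apply: IH; lia].
move/eqP: h; rewrite scaler_eq0 (uni_eq0 uM) => /orP[/eqP //|]; lia.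
Qed.

Lemma uni_lfun (V : vectType K) (F : nat -> V) :
  exists h : 'Hom(M, V), forall k, (k < l)%N -> h (m k) = F k.
Proof.
pose X := [tuple of map m (iota 0 l)].
have YE (i : 'I_l) : X`_i = m i.
  by rewrite (nth_map 0%N) ?size_iota // nth_iota.
have fY : free X.
  apply/freeP=> a e i.
  have := @uni_indep (fun k => if insub k is Some i then a i else 0) _ i (ltn_ord i).
  rewrite valK; apply; rewrite -[RHS]e; apply: eq_bigr => j _.
  by rewrite valK YE.
have [|h e] := @linear_lfun K M V (fun y => \sum_(i < l) coord X i y *: F i).
  move=> k y z; rewrite scaler_sumr -big_split; apply: eq_bigr => i _ /=.
  by rewrite linearP scalerDl scalerA.
exists h => k kl; rewrite e (bigD1 (Ordinal kl)) //= big1 => [|i ne].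
  by rewrite -(YE (Ordinal kl)) coord_free // eqxx scale1r addr0.
by rewrite -(YE (Ordinal kl)) coord_free // eq_sym (negPf ne) scale0r.
Qed.

Lemma uni_map X (z : nat -> X) : (forall k, (l <= k)%N -> z k = 0) ->
  (forall k u t, (k < l)%N ->
     ract (z k) (x u t) = if v + k == u %[mod N] then z (k + t)%N else 0) ->
  exists2 h : 'Hom(M, X), is_hom h & forall k, h (m k) = z k.
Proof.
move=> z0 zA; have [h hz] := uni_lfun z.
have hE k : h (m k) = z k.
  by case: (ltnP k l) => kl; [exact: hz|rewrite uni_out // linear0 z0].
exists h => //; apply: homI => y u t; have [a ->] := uni_span uM y.
rewrite ract_suml !linear_sum ract_suml; apply: eq_bigr => k _ /=.
rewrite ractZl !linearZ /= ractZl (uni_act uM) hE zA //.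
by case: ifP; rewrite ?hE ?linear0.
Qed.

(** [z] may have components at several vertices: the generator goes to its component
    [ract z (x v 0)]. *)
Lemma uni_lift X (z : X) : ract z (x v l) = 0 ->
  exists2 h : 'Hom(M, X), is_hom h & forall k, h (m k) = ract z (x v k).
Proof.
move=> z0; apply: uni_map => [k kl|k u t _].
  by rewrite -(subnKC kl) -gen_mulD ractM z0 ract0l.
by rewrite -ractM (nak_mul nak); case: ifP; rewrite ?ract0r.
Qed.

Definition filt j : {vspace M} := <<[seq m k | k <- index_iota j l]>>%VS.

Lemma sum_filt (a : nat -> K) j :
  (\sum_(k < l) a k *: m k \in filt j) <-> (forall k, (k < j)%N -> (k < l)%N -> a k = 0).
Proof.
split=> [h k kj kl|h]; last first.
  apply: memv_suml => k _; case: (ltnP k j) => kj; first by rewrite h // scale0r mem0v.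
  by rewrite memvZ // memv_span // map_f // mem_index_iota kj /=.
have [g gP] := uni_lfun (fun i => (i == k)%:R : K^o).
have /subvP/(_ _ h) : (filt j <= lker g)%VS.
  apply/span_subvP=> y /mapP[i]; rewrite mem_index_iota => /andP[ji il] ->.
  by rewrite memv_ker gP // (gtn_eqF (leq_trans kj ji)).
rewrite memv_ker linear_sum (bigD1 (Ordinal kl)) //= big1 => [|i ne].
  by rewrite addr0 linearZ /= gP // eqxx => /eqP; rewrite /GRing.scale /= mulr1.
rewrite linearZ /= gP // (_ : (_ == k) = false) ?scaler0 //.
by apply: contraNF ne => /eqP ik; apply/eqP/val_inj.
Qed.

Lemma mem_filt i j : (m i \in filt j) = (j <= i)%N || (l <= i)%N.
Proof.
case: (leqP l i) => li; first by rewrite orbT uni_out // mem0v.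
have e : m i = \sum_(k < l) (k == i :> nat)%:R *: m k.
  rewrite (bigD1 (Ordinal li)) //= eqxx scale1r big1 ?addr0 // => k ne.
  rewrite (_ : (_ == i) = false) ?scale0r //.
  by apply: contraNF ne => /eqP ik; apply/eqP/val_inj.
rewrite orbF {1}e; apply/idP/idP => [h|ji].
  rewrite leqNgt; apply/negP => ij; move/(sum_filt (fun k => (k == i)%:R))/(_ i ij li)/eqP: h.
  by rewrite eqxx oner_eq0.
apply/(sum_filt (fun k => (k == i)%:R)) => k kj _.
by case: eqP => // ki; move: kj; rewrite ki ltnNge ji.
Qed.

Lemma submod_filt j : submod (filt j).
Proof.
apply: submodI => y u t; have [a ->] := uni_span uM y => /sum_filt h.
rewrite ract_suml; apply: memv_suml => k _; rewrite ractZl (uni_act uM).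
case: ifP => _; last by rewrite scaler0 mem0v.
case: (ltnP k j) => kj; first by rewrite h // scale0r mem0v.
by rewrite memvZ // mem_filt (leq_trans kj) ?leq_addr.
Qed.

(** Here [j] is the least index with [m j] in [U]. An element of [U] with leading term at some
    [k < j] would force [m k] into [U]. *)
Lemma submod_eq_filt (U : {vspace M}) : submod U ->
  exists2 j, (j <= l)%N & U = filt j.
Proof.
move=> sU; have ex : exists j, m j \in U by exists l; rewrite uni_out ?mem0v.
case: (ex_minnP ex) => j jU jmin.
have mU k : (j <= k)%N -> m k \in U.
  by move=> jk; rewrite -(subnKC jk) -uni_actD; apply: sU.
exists j; first by apply: jmin; rewrite uni_out ?mem0v.
apply/vspaceP=> y; apply/idP/idP => [yU|]; last first.
  move: y; apply/subvP/span_subvP=> _ /mapP[i + ->].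
  by rewrite mem_index_iota => /andP[ji _]; apply: mU.
have [a e] := uni_span uM y; rewrite e; apply/sum_filt => k.
have [n] := ubnP k; elim: n k => // n IH k kn kj kl; apply/eqP/negP => /negP ak.
have {}IH i : (i < k)%N -> a i = 0 by move=> ik; apply: IH; lia.
(* Descending induction from the socle: a path moves the leading term of [y] to position [i], and
   the terms beyond [i] are already known to lie in [U]. *)
suff /(_ (l - k)%N k) : forall d i, (l - i <= d)%N -> (k <= i)%N -> m i \in U.
  by move=> /(_ (leqnn _) (leqnn _))/jmin; lia.
elim=> [|d IHd] i di ki; first by rewrite uni_out ?mem0v //; lia.
have := sU _ (x (v + k)%N (i - k)%N) yU.
rewrite e ract_suml (bigD1 (Ordinal kl)) //= ractZl uni_actD subnKC //.
rewrite rpredDr => [h|]; first by rewrite -(scalerK ak (m i)) memvZ.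
apply: memv_suml => p ne; rewrite ractZl (uni_act uM); case: ifP => _; last first.
  by rewrite scaler0 mem0v.
case: (ltngtP p k) => pk; first by rewrite IH // scale0r mem0v.
  by rewrite memvZ // IHd //; lia.
by move/eqP: ne; case; apply: val_inj.
Qed.

(** Submodules form a chain, so kernels and images can be computed by testing basis vectors only. *)
Lemma submod_ext (U V : {vspace M}) : submod U -> submod V ->
  (forall i, (i < l)%N -> (m i \in U) = (m i \in V)) -> U = V.
Proof.
move=> /submod_eq_filt[i il ->] /submod_eq_filt[j jl ->] h.
case: (ltngtP i j) => [ij|ji|-> //].
  by have := h i (leq_trans ij jl); rewrite !mem_filt; lia.
by have := h j (leq_trans ji il); rewrite !mem_filt; lia.
Qed.

Lemma filt0 : filt 0%N = fullv.
Proof.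
apply: submod_ext; [exact: submod_filt|exact: submod_full|] => i _.
by rewrite mem_filt memvf.
Qed.

Lemma filt_out j : (l <= j)%N -> filt j = 0%VS.
Proof. by move=> lj; rewrite /filt /index_iota (eqP lj) /= span_nil. Qed.

Lemma filt_eq0 j : (filt j = 0%VS) <-> (l <= j)%N.
Proof.
split=> [e|]; last exact: filt_out.
case: (leqP l j) => // jl; have : m j \in filt j by rewrite mem_filt leqnn.
by rewrite e memv0 (uni_eq0 uM); lia.
Qed.

Lemma filt_full j : (0 < l)%N -> filt j = fullv -> j = 0%N.
Proof.
by move=> l0 e; have := mem_filt 0%N j; rewrite e memvf; lia.
Qed.

Lemma filt_inj i j : (i <= l)%N -> (j <= l)%N -> filt i = filt j -> i = j.
Proof.
move=> il jl e; have := mem_filt i i; have := mem_filt i j.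
have := mem_filt j i; have := mem_filt j j; rewrite e; lia.
Qed.

Lemma filt_line : (0 < l)%N -> filt l.-1 = <[m l.-1]>%VS.
Proof.
by rewrite /filt; case: l => // n _; rewrite /index_iota subSnn span_seq1.
Qed.

Lemma uni_quotient X (q : 'Hom(M, X)) j : (j <= l)%N ->
  is_hom q -> limg q = fullv -> lker q = filt j ->
  uniserial v j (fun k => q (m k)).
Proof.
move=> jl hq sq kq; split=> [k|y|k u t].
- rewrite -memv_ker kq mem_filt; lia.
- have [z <-] := (limg_fullP q).2 sq y; have [a ->] := uni_span uM z; exists a.
  rewrite linear_sum (big_ord_widen l (fun k => a k *: q (m k)) jl) [RHS]big_mkcond.
  apply: eq_bigr => k _; rewrite linearZ /=; case: ltnP => // jk.
  by rewrite (_ : q (m k) = 0) ?scaler0 //; apply/eqP; rewrite -memv_ker kq mem_filt jk.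
- by rewrite -hq (uni_act uM); case: ifP => _; rewrite ?linear0.
Qed.

Lemma uni_transport X (q : 'Hom(M, X)) :
  is_hom q -> limg q = fullv -> lker q = 0%VS ->
  uniserial v l (fun k => q (m k)).
Proof.
by move=> hq sq kq; apply: uni_quotient => //; rewrite kq filt_out.
Qed.

Lemma uni_len : (l <= c v)%N.
Proof.
case: (leqP l (c v)) => // lc; have := uni_actD 0%N (c v).
rewrite addn0 gen_eq0 // ract0r => /esym/eqP; rewrite (uni_eq0 uM); lia.
Qed.

Lemma uni_indecomposable : (0 < l)%N -> indecomposable M.
Proof.
move=> l0; split=> [e|U V /submod_eq_filt[i il ->] /submod_eq_filt[j jl ->] _ e].
  by have := memvf (m 0%N); rewrite e memv0 (uni_eq0 uM) leqNgt l0.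
have := memv_cap (m l.-1) (filt i) (filt j).
rewrite e memv0 (uni_eq0 uM) !mem_filt => h.
by case: (ltnP i l) => [il'|li]; [right|left]; apply: filt_out; lia.
Qed.

End Uniserial.

(** The source of the canonical maps used below: [s = 0] gives the projections onto a quotient with
    the same top, [l' = l + s] the embeddings, and the other cases the differentials of
    presentations and resolutions. *)
Lemma uni_shift M v l m M' v' l' m' s (uM : @uniserial M v l m)
    (uM' : @uniserial M' v' l' m') :
  v' + s = v %[mod N] -> (l' <= l + s)%N ->
  exists f : 'Hom(M, M'), [/\ is_hom f, forall k, f (m k) = m' (k + s)%N,
    lker f = filt l m (l' - s) & limg f = filt l' m' s].
Proof.
move=> e ls; have [|k u t _|f hf fE] := uni_map uM (z := fun k => m' (k + s)%N).
- by move=> k lk; apply: (uni_out uM'); lia.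
- rewrite (uni_act uM') addnAC (_ : (v' + (k + s) = v + k %[mod N])) //.
  by rewrite addnCA addnC -modnDml e modnDml.
exists f; split=> //.
  apply: (submod_ext uM); [exact: submod_ker|exact: (submod_filt uM)|] => i il.
  rewrite memv_ker fE (uni_eq0 uM') (mem_filt uM); lia.
have sI : submod (limg f) by apply: submod_img => //; apply: submod_full.
apply: (submod_ext uM') => [//||i il]; first exact: (submod_filt uM').
rewrite (mem_filt uM'); apply/idP/idP => [/memv_imgP[y _ ey]|].
  rewrite -(mem_filt uM') ey; have [a ->] := uni_span uM y.
  rewrite linear_sum; apply: memv_suml => k _; rewrite linearZ /= fE memvZ //.
  by rewrite (mem_filt uM') leq_addl.
case/orP => h; last by rewrite (uni_out uM') ?mem0v.
by rewrite -(subnK h) -fE memv_img ?memvf.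
Qed.

Lemma uni_iso M v l m M' v' m' : @uniserial M v l m ->
  @uniserial M' v' l m' -> v = v' %[mod N] -> iso M M'.
Proof.
move=> uM uM' e.
have [||f [hf _ kf imf]] := uni_shift (s := 0%N) uM uM'; rewrite ?addn0 //.
exists f; split=> //; first by rewrite kf subn0 (filt_out (l := l)).
by rewrite imf (filt0 uM').
Qed.

Lemma uni_top_uniq M v l m v' l' m' : (0 < l)%N -> @uniserial M v l m ->
  @uniserial M v' l' m' -> v = v' %[mod N].
Proof.
move=> l0 uM uM'; have [a e] := uni_span uM' (m 0%N).
have l0' : (0 < l')%N.
  case: (posnP l') => // z; move/eqP: e; rewrite z big_ord0 (uni_eq0 uM); lia.
have a0 : a 0%N <> 0.
  move=> a0; have mf k : m k \in filt l' m' 1%N.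
    rewrite -[k]add0n -(uni_actD uM); apply: (submod_filt uM').
    by rewrite e; apply/(sum_filt uM') => -[].
  have /(filt_full uM' l0') // : filt l' m' 1%N = fullv.
  apply/vspaceP=> y; rewrite memvf; have [b ->] := uni_span uM y.
  by apply: memv_suml => k _; apply: memvZ.
apply/eqP; apply/negP => /negP ne; apply: a0.
(* [m 0] is fixed by the idempotent at [v], so its expansion only involves those [m' k] that sit at
   [v]; the term [k = 0] does occur, since [m 0] generates. *)
have h : \sum_(k < l') (if v' + k == v %[mod N] then 0 else a k) *: m' k = 0.
  have := uni_actD uM 0%N 0%N; rewrite !addn0 e ract_suml => /eqP.
  rewrite -subr_eq0 -sumrB => /eqP e'; apply/eqP; rewrite -oppr_eq0 -sumrN; apply/eqP.
  rewrite -[RHS]e'; apply: eq_bigr => k _; rewrite ractZl (uni_act uM') addn0.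
  by case: ifP => _; rewrite ?subrr ?scale0r ?oppr0 // scaler0 sub0r.
have := uni_indep uM' (a := fun k => if v' + k == v %[mod N] then 0 else a k) h l0'.
by rewrite addn0 eq_sym (negPf ne).
Qed.

End Nakayama.

(** * Projective and injective uniserial modules, and defects *)

Section Modules.
Variables (K : fieldType) (A : falgType K) (N : nat) (c : nat -> nat).
Variables (x : nat -> nat -> A) (nak : nakayama N c x).
Implicit Types M X P : rmod A.
Local Notation uni := (uniserial N x).

Lemma vpredK v : (vpred N v).+1 = v %[mod N].
Proof. by rewrite -addnS prednK ?(nak_rank nak) // modnDr. Qed.

Lemma vpredP u v : u.+1 = v %[mod N] -> u = vpred N v %[mod N].
Proof.
move=> e; rewrite /vpred -modnDml -e modnDml addSn -addnS.
by rewrite prednK ?(nak_rank nak) // modnDr.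
Qed.

Definition proj_rmod v := right_ideal (x v 0%N).

Definition proj_gen v l : proj_rmod v := ideal_elt _ (x v l).

Lemma proj_uniserial v : uni v (c v) (proj_gen v).
Proof.
have vE l : vsval (proj_gen v l) = x v l.
  by rewrite ideal_eltE (nak_mul nak) addn0 eqxx.
split=> [k|y|k u t].
- by rewrite -(nak_eq0 nak) -vE; apply/eqP/eqP => [->|/(@subvs_inj _ _ _ (proj_gen v k) 0)].
- have [a ->] := ideal_eltP y; have [f ->] := nak_span nak a.
  have vN := ltn_pmod v (nak_rank nak).
  have cE : c (v %% N) = c v by apply: (len_congr nak); rewrite modn_mod.
  exists (f (v %% N)%N); apply: subvs_inj; rewrite linear_sum ideal_eltE.
  rewrite mulr_sumr (bigD1 (Ordinal vN)) //= [X in _ + X]big1 => [|u ne].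
    rewrite addr0 mulr_sumr cE; apply: eq_bigr => t _.
    by rewrite -scalerAr (nak_mul nak) addn0 modn_mod eqxx -vE.
  rewrite mulr_sumr big1 // => t _; rewrite -scalerAr (nak_mul nak) addn0.
  rewrite (modn_small (ltn_ord u)); case: ifP => [/eqP e|]; last by rewrite scaler0.
  by move/eqP: ne; case; apply: val_inj.
- rewrite /proj_gen ract_ideal_elt (nak_mul nak); case: ifP => // _.
  by apply: subvs_inj; rewrite ideal_eltE mulr0.
Qed.

Lemma uni_projective M v (m : nat -> M) : uni v (c v) m -> projective M.
Proof.
move=> uM X Y g f hg sg hf; have [z ez] := (limg_fullP g).2 sg (f (m 0%N)).
have [|h hh hE] := uni_lift nak uM (X := X) (z := z).
  by rewrite (gen_eq0 nak) // ract0r.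
exists h => // y; have [a ->] := uni_span uM y.
rewrite !linear_sum; apply: eq_bigr => k _; rewrite !linearZ /= hE hg ez -hf.
by have := uni_actD uM 0%N k; rewrite addn0 add0n => ->.
Qed.

Definition uni_rmod v l : rmod A :=
  quo_rmod (submod_filt nak (proj_uniserial v) (j := l)).

Definition uni_gen v l k : uni_rmod v l := quo_map _ (proj_gen v k).

Lemma uni_rmodP v l : (l <= c v)%N -> uni v l (uni_gen v l).
Proof.
move=> lc; apply: (uni_quotient (proj_uniserial v)) => //.
- exact: quo_map_hom.
- exact: limg_quo_map.
- exact: lker_quo_map.
Qed.

(** The projection [P_v -> M] splits. The image of the section is not inside the radical, hence is
    everything, and the projection is an isomorphism. *)
Lemma uni_projective_len M v l (m : nat -> M) :
  uni v l m -> (0 < l)%N -> projective M -> l = c v.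
Proof.
move=> uM l0 pM; have lc := uni_len nak uM; have uP := proj_uniserial v.
have [||f [hf fE kf imf]] := uni_shift nak (s := 0%N) uP uM; rewrite ?addn0 //.
have [s hs e] := projective_section pM hf (etrans imf (filt0 nak uM)).
have [j jc imS] := submod_eq_filt uP (submod_img hs (@submod_full _ _ M)).
have j0 : j = 0%N.
  case: (posnP j) => // j0; have : s (m 0%N) \in limg s by rewrite memv_img ?memvf.
  rewrite imS => h; have : m 0%N \in filt l m 1%N.
    rewrite -(e (m 0%N)); have [a ea] := uni_span uP (s (m 0%N)).
    rewrite ea linear_sum; apply: memv_suml => k _; rewrite linearZ /= fE addn0.
    case: (ltnP k j) => kj; last by rewrite memvZ // (mem_filt uM); lia.
    by move: h; rewrite ea => /(sum_filt uP) -> //; rewrite scale0r mem0v.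
  by rewrite (mem_filt uM) /= leqNgt l0.
apply/eqP; rewrite eqn_leq lc leqNgt; apply/negP => ll.
have : proj_gen v l \in limg s by rewrite imS j0 (mem_filt uP).
case/memv_imgP=> y _ ey; have := fE l; rewrite ey e addn0 (uni_out uM) // => y0.
by have := uni_eq0 uP l; rewrite ey y0 linear0 eqxx leqNgt ll.
Qed.

Lemma uni0_injective M v (m : nat -> M) : uni v 0%N m -> injective_mod M.
Proof.
move=> uM X Y g f _ _ _; have z (y : M) : y = 0.
  by have [a ->] := uni_span uM y; rewrite big_ord0.
by exists 0 => [y a|y]; rewrite !zero_lfunE ?ract0l // [RHS]z.
Qed.

(* The functional reading off the socle coordinate of [f] extends from [X] to
   [Y], and it determines the extension of [f]: injective hulls of simple
   modules are dual to projective left modules. *)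
Lemma uni_injective M v l (m : nat -> M) :
  uni v l m -> (0 < l)%N -> (c (vpred N v) <= l)%N -> injective_mod M.
Proof.
move=> uM l0 cl X Y g f hg /eqP kg hf.
have [L LP] := uni_lfun uM (fun k => (k == l.-1)%:R : K^o).
(* [F] extends the socle coordinate of [f] along a merely linear left inverse of [g]. Then [H]
   recovers coefficient [k] by first pushing position [k] to the socle. *)
pose F := (L \o f \o g^-1)%VF.
have FE z : F (g z) = L (f z) by rewrite !comp_lfunE lker0_lfunK.
pose H y := \sum_(k < l) F (ract y (x (v + k)%N (l.-1 - k))) *: m k.
have [|h hE] := @linear_lfun K Y M H.
  move=> a y z; rewrite /H scaler_sumr -big_split; apply: eq_bigr => k _ /=.
  by rewrite ractDl ractZl linearP scalerDl scalerA.
exists h => [|z]; last first.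
  rewrite hE /H; have [a e] := uni_span uM (f z); rewrite [RHS]e.
  apply: eq_bigr => k _; rewrite -hg FE hf e ract_suml linear_sum; congr (_ *: _).
  have kl := ltn_ord k.
  rewrite (bigD1 k) //= big1 => [|i ne].
    rewrite ractZl (uni_actD uM) linearZ /= LP; last lia.
    by rewrite subnKC; [rewrite eqxx /GRing.scale /= mulr1 addr0|lia].
  rewrite ractZl (uni_act uM) linearZ /=; case: ifP => _; last by rewrite linear0 scaler0.
  case: (leqP l (i + (l.-1 - k))) => li; first by rewrite (uni_out uM) // linear0 scaler0.
  rewrite LP // (_ : (_ == l.-1) = false) ?scaler0 //; apply/eqP => e'.
  by move/eqP: ne; case; apply: val_inj => /=; lia.
apply: (homI nak) => y u t; rewrite !hE /H ract_suml.
(* The bound on [c (vpred N v)] enters here: the path from [u] passes through [v - 1] with [l]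
   arrows still to go, so it vanishes. *)
have lowE k : (k < t)%N -> v + k = u + t %[mod N] -> x u (t + (l.-1 - k)) = 0.
  move=> kt e; apply: (gen_eq0 nak).
  have := len_leD nak u (t - k.+1); suff -> : c (u + (t - k.+1)) = c (vpred N v) by lia.
  apply: (len_congr nak); apply: vpredP; apply/eqP; rewrite -(eqn_modDr k) e.
  by apply/eqP; congr (_ %% _)%N; lia.
(* The two sides agree after a shift of the index by [t]: the first [t] terms on the left vanish by
   [lowE], the last [t] on the right lie beyond the socle. *)
pose G k := (if v + k == u + t %[mod N] then F (ract y (x u (t + (l.-1 - k)))) else 0) *: m k.
transitivity (\sum_(0 <= k < l) G k).
  rewrite big_mkord; apply: eq_bigr => k _; rewrite -ractM (nak_mul nak) eq_sym /G.
  by case: ifP => // _; rewrite ract0r linear0.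
transitivity (\sum_(0 <= k < l) (if v + k == u %[mod N]
    then F (ract y (x u (l.-1 - k))) *: m (k + t)%N else 0)); last first.
  rewrite big_mkord; apply: eq_bigr => k _; rewrite ractZl (uni_act uM).
  by case: eqP => [e|_]; rewrite ?scaler0 // (gen_congr nak _ e).
case: (leqP l t) => tl.
  rewrite big_nat big1 => [|k /andP[_ kl]]; last first.
    rewrite /G; case: eqP => [/lowE->|_]; rewrite ?ract0r ?linear0 ?scale0r //; lia.
  rewrite big1 // => k _; rewrite (uni_out uM) ?scaler0 ?if_same //; lia.
rewrite (big_cat_nat (n := t)) ?(ltnW tl) //= big_nat big1 ?add0r => [|k /andP[_ kt]]; last first.
  by rewrite /G; case: eqP => [/(lowE _ kt)->|_]; rewrite ?ract0r ?linear0 ?scale0r.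
rewrite [RHS](big_cat_nat (n := (l - t)%N)) ?leq_subr //= [X in _ + X]big_nat.
rewrite [X in _ + X]big1 ?addr0 => [|k /andP[kt _]]; last first.
  by rewrite (uni_out uM) ?scaler0 ?if_same //; lia.
rewrite -{1}[t]add0n big_addn big_nat [RHS]big_nat; apply: eq_bigr => k /andP[_ kl].
rewrite /G addnA eqn_modDr; case: ifP => _; last by rewrite scale0r.
by congr (F (ract y (x u _)) *: _); lia.
Qed.

(** If [l < c (v - 1)], then [M] is the radical of a uniserial module of length [l + 1]. A
    retraction would write [m 0] as an element of [M] times an arrow, putting the generator into the
    radical. *)
Lemma uni_injective_len M v l (m : nat -> M) :
  uni v l m -> (0 < l)%N -> injective_mod M -> (c (vpred N v) <= l)%N.
Proof.
move=> uM l0 iM; rewrite leqNgt; apply/negP => lc.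
have uE := uni_rmodP lc; set n := uni_gen _ _ in uE.
have [||f [hf fE kf _]] := uni_shift nak (s := 1%N) uM uE; rewrite ?addn1 ?vpredK //.
have [|r hr e] := injective_retraction iM hf.
  by rewrite kf subn1 filt_out.
have := e (m 0%N); rewrite fE -(uni_actD uE) hr addn0; have [a ->] := uni_span uM (r (n 0%N)).
rewrite ract_suml => e0; have : m 0%N \in filt l m 1%N.
  rewrite -e0; apply: memv_suml => k _; rewrite ractZl (uni_act uM).
  by case: ifP; rewrite ?scaler0 ?mem0v // memvZ // (mem_filt uM) addn1.
by rewrite (mem_filt uM) /= leqNgt l0.
Qed.

Lemma uni_defect M v (m : nat -> M) : uni v (c v) m -> has_defect M (c v - c (vpred N v)).
Proof.
move=> uM; have c0 := nak_len_gt0 nak.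
exists [seq filt (c v) m j | j <- index_iota (c (vpred N v)) (c v)]; split.
- rewrite map_inj_in_uniq ?iota_uniq // => i j.
  rewrite !mem_index_iota => /andP[_ ic] /andP[_ jc].
  by apply: (filt_inj uM); apply: ltnW.
- by rewrite size_map size_iota.
move=> U; split=> [/mapP[j]|[U0 Uf [X [q [hq sq kq iX]]]]].
  rewrite mem_index_iota => /andP[cj jc] ->; split.
  - by move/(filt_eq0 uM); rewrite leqNgt jc.
  - by move/(filt_full uM (c0 v)) => j0; have := c0 (vpred N v); lia.
  have sU := submod_filt nak uM (j := j).
  exists (quo_rmod sU), (quo_map sU); split; rewrite ?limg_quo_map ?lker_quo_map //.
    exact: quo_map_hom.
  have := uni_quotient uM (ltnW jc) (quo_map_hom sU) (limg_quo_map sU) (lker_quo_map sU).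
  by move/uni_injective; apply=> //; apply: leq_trans cj.
have [j jc e] : exists2 j, (j <= c v)%N & U = filt (c v) m j.
  by rewrite -kq; apply: (submod_eq_filt uM); apply: submod_ker.
have uX := uni_quotient uM jc hq sq (etrans kq e).
apply/mapP; exists j => //; rewrite mem_index_iota ltn_neqAle jc andbT.
have j0 : (0 < j)%N.
  by rewrite lt0n; apply/eqP => j0; apply: Uf; rewrite e j0 (filt0 nak uM).
rewrite (uni_injective_len uX j0 iX) /=; apply/eqP => jE; apply: U0.
by rewrite e jE filt_out.
Qed.

End Modules.

(** * Tops, simples, indecomposable projectives and socles *)

Section Classification.
Variables (K : fieldType) (A : falgType K) (N : nat) (c : nat -> nat).
Variables (x : nat -> nat -> A) (nak : nakayama N c x).
Implicit Types M X P S : rmod A.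
Local Notation uni := (uniserial N x).

Lemma gen_nilpotent : exists t, forall v, x v t = 0.
Proof.
exists (\max_(v < N) c v) => v; apply: (gen_eq0 nak).
have vN := ltn_pmod v (nak_rank nak).
rewrite (len_congr nak (w := (v %% N)%N)) ?modn_mod //.
exact: (leq_bigmax (Ordinal vN)).
Qed.

Definition act_lfun M a : 'End(M) := linfun (fun y : M => ract y a).

Lemma act_lfunE M a (y : M) : act_lfun M a y = ract y a.
Proof.
pose L := GRing.isLinear.Build K M M *:%R _ (@ract_linearl _ _ M a).
pose ff : {linear M -> M} := HB.pack (fun y : M => ract y a) L.
exact: (lfunE ff).
Qed.

(* Nakayama's lemma: otherwise [M = M rad A], and iterating gives [M = 0]. *)
Lemma top_functional M : nonzero M -> exists2 v, (v < N)%N &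
  exists f : 'Hom(M, K^o), [/\ exists z, f z <> 0,
    forall y u, (u < N)%N -> u != v -> f (ract y (x u 0%N)) = 0
    & forall y u, f (ract y (x u 1%N)) = 0].
Proof.
move=> nzM; pose R t := (\sum_(u < N) limg (act_lfun M (x u t)))%VS.
(* [W v] is the radical together with the components at the vertices other than [v]: a functional
   vanishing on it amounts to a map to the simple at [v]. *)
pose W (v : 'I_N) := (R 1%N + \sum_(u < N | u != v) limg (act_lfun M (x u 0%N)))%VS.
have memA a y : ract y a \in limg (act_lfun M a) by rewrite -act_lfunE memv_img ?memvf.
have memR t u y : ract y (x u t) \in R t.
  have uN := ltn_pmod u (nak_rank nak).
  rewrite (gen_congr nak (w := (u %% N)%N)) ?modn_mod //.
  by apply: (subvP (sumv_sup (Ordinal uN) isT (subvv _))); apply: memA.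
have RP t y : y \in R t -> exists z : 'I_N -> M, y = \sum_u ract (z u) (x u t).
  case/memv_sumP=> s sR ->.
  have [z zE] : exists z : 'I_N -> M, forall u, s u = ract (z u) (x u t).
    apply: (@fin_all_exists _ (fun _ => M) (fun u z => s u = ract z (x u t))) => u.
    by have /memv_imgP[z _ ->] := sR u isT; exists z; rewrite act_lfunE.
  by exists z; apply: eq_bigr => u _.
case: (boolP [exists v : 'I_N, W v != fullv]) => [/existsP[v /eqP Wv]|].
  exists v => //; have [f [f0 fz]] := separating_functional Wv.
  exists f; split=> [//|y u uN uv|y u]; apply: f0.
    apply: (subvP (addvSr _ _)).
    by apply: (subvP (sumv_sup (Ordinal uN) uv (subvv _))); apply: memA.
  by apply: (subvP (addvSl _ _)); apply: memR.
rewrite negb_exists => /forallP Wf; case: nzM.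
have R1 y : y \in R 1%N.
  rewrite (peirce nak y); apply: memv_suml => v _.
  have /memv_addP[r /RP[z ->] [s /memv_sumP[q qW ->] ->]] : y \in W v.
    by have := Wf v; rewrite negbK => /eqP ->; apply: memvf.
  rewrite ractDl memvD // ract_suml; apply: memv_suml => u.
    by rewrite -ractM (nak_mul nak); case: ifP => _ _; rewrite ?addn0 ?memR // ract0r mem0v.
  move=> uv; have /memv_imgP[w _ ->] := qW u uv.
  rewrite act_lfunE -ractM (nak_mul nak) addn0 !modn_small //.
  by rewrite val_eqE (negPf uv) ract0r mem0v.
have Rf t y : y \in R t.
  elim: t y => [|t IH] y; first by rewrite (peirce nak y); apply: memv_suml.
  have [z ->] := RP _ _ (IH y); apply: memv_suml => w _.
  have [q ->] := RP _ _ (R1 (z w)); rewrite ract_suml; apply: memv_suml => u _.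
  by rewrite -ractM (nak_mul nak); case: ifP => _; rewrite ?add1n ?memR // ract0r mem0v.
have [t t0] := gen_nilpotent; apply/vspaceP=> y; rewrite memvf memv0.
have [z ->] := RP _ _ (Rf t y); rewrite big1 ?eqxx // => u _.
by rewrite t0 ract0r.
Qed.

Lemma top_map M : nonzero M -> exists2 v, (v < N)%N &
  forall (S : rmod A) (s : nat -> S), uni v 1 s ->
    exists2 f : 'Hom(M, S), is_hom f & limg f = fullv.
Proof.
case/top_functional=> v vN [f [[z fz] f0 f1]]; exists v => // S s uS.
have [|g gE] := @linear_lfun K M S (fun y => f y *: s 0%N).
  by move=> k y w; rewrite linearP scalerDl scalerA.
have fv y : f (ract y (x v 0%N)) = f y.
  rewrite [in RHS](peirce nak y) linear_sum (bigD1 (Ordinal vN)) //= big1 ?addr0 // => u.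
  by move=> uv; apply: f0.
exists g.
  apply: (homI nak) => y u t; rewrite !gE ractZl (uni_act uS) addn0 add0n.
  case: t => [|t]; last first.
    rewrite (uni_out uS (k := t.+1)) // if_same scaler0 -[t.+1]addn1 -(gen_mulD nak).
    by rewrite ractM f1 scale0r.
  have uN := ltn_pmod u (nak_rank nak).
  rewrite (gen_congr nak (w := (u %% N)%N)) ?modn_mod // (modn_small vN).
  case: eqP => [<-|/eqP ne]; first by rewrite fv.
  by rewrite f0 ?scale0r ?scaler0 // eq_sym.
apply/limg_fullP=> y; have [a ->] := uni_span uS y.
exists ((a 0%N / f z) *: z); rewrite big_ord_recl big_ord0 addr0 gE linearZ /=.
by rewrite /GRing.scale /= divfK //; apply/eqP.
Qed.

Lemma uni_simple M v (m : nat -> M) : uni v 1 m -> simple M.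
Proof.
move=> uM; split=> [|U /(submod_eq_filt uM)[j j1 ->]].
  by case: (uni_indecomposable uM (ltnSn 0)).
case: j j1 => [|[|//]] _; first by right; rewrite (filt0 nak uM).
by left; rewrite filt_out.
Qed.

Lemma simple_uni X : simple X -> exists2 v, (v < N)%N & exists s : nat -> X, uni v 1 s.
Proof.
case=> nzX sX; have [v vN h] := top_map nzX; exists v => //.
have uS := uni_rmodP nak (nak_len_gt0 nak v).
have [f hf imf] := h _ _ uS.
have kf : lker f = 0%VS.
  case: (sX _ (submod_ker hf)) => // kf; have := uni_eq0 uS 0%N.
  have [z e] := (limg_fullP f).2 imf (uni_gen nak v 1 0%N).
  suff -> : uni_gen nak v 1 0%N = 0 by rewrite eqxx.
  by rewrite -e; apply/eqP; rewrite -memv_ker kf memvf.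
have hg := is_hom_inv hf kf imf.
have kV y : f ((f^-1)%VF y) = y by rewrite limg_lfunVK // imf memvf.
exists (fun k => (f^-1)%VF (uni_gen nak v 1 k)); apply: (uni_transport uS hg).
  by apply/limg_fullP=> y; exists (f y); apply: lker0_lfunK; apply/eqP.
by apply: lker_inj => y e; rewrite -(kV y) e linear0.
Qed.

(** The map from [P] to a simple quotient [S_v] lifts to [P -> P_v], which is onto because its image
    is not in the radical. It splits, and indecomposability kills the kernel. *)
Lemma indec_projective_uni P : indec_projective P ->
  exists2 v, (v < N)%N & exists p : nat -> P, uni v (c v) p.
Proof.
case=> [[nzP iP] pP]; have [v vN h] := top_map nzP; exists v => //.
have c0 := nak_len_gt0 nak v; have uS := uni_rmodP nak c0.
have uP0 := proj_uniserial nak v.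
have [f hf imf] := h _ _ uS.
have [||pi [hpi piE kpi impi]] := uni_shift nak (s := 0%N) uP0 uS; rewrite ?addn0 //.
have [g hg gE] := pP _ _ _ _ hpi (etrans impi (filt0 nak uS)) hf.
have [j jc img] := submod_eq_filt uP0 (submod_img hg (@submod_full _ _ P)).
have {}img : limg g = fullv.
  rewrite img; case: (posnP j) => [->|j0]; first exact: (filt0 nak uP0).
  have [y ey] := (limg_fullP f).2 imf (uni_gen nak v 1 0%N).
  have : uni_gen nak v 1 0%N == 0.
    rewrite -ey -gE -memv_ker kpi; have : g y \in limg g by rewrite memv_img ?memvf.
    rewrite img; move: (g y); apply/subvP/span_subvP=> _ /mapP[k + ->].
    by rewrite mem_index_iota (mem_filt uP0) => /andP[]; lia.
  by rewrite (uni_eq0 uS).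
have [s hs e] := projective_section (uni_projective nak uP0) hg img.
have kg : lker g = 0%VS.
  have := iP _ _ (submod_ker hg) (submod_img hs (@submod_full _ _ _)).
  case=> [||//|s0].
  - apply/vspaceP=> y; rewrite memvf; apply/memv_addP.
    exists (y - s (g y)); first by rewrite memv_ker linearB /= e subrr.
    by exists (s (g y)); [rewrite memv_img ?memvf|rewrite subrK].
  - apply/vspaceP=> y; rewrite memv0; apply/idP/eqP => [|->]; last exact: mem0v.
    case/memv_capP; rewrite memv_ker => /eqP gy /memv_imgP[z _ ez].
    by rewrite ez -(e z) -ez gy linear0.
  have : s (proj_gen x v 0%N) \in limg s by rewrite memv_img ?memvf.
  rewrite s0 memv0 => /eqP s00; have := uni_eq0 uP0 0%N.
  by rewrite -(e (proj_gen x v 0%N)) s00 linear0 eqxx leqNgt c0.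
exists (fun k => s (proj_gen x v k)); apply: (uni_transport uP0 hs).
  apply/limg_fullP=> y; exists (g y); apply/eqP; rewrite -subr_eq0.
  have /lker0P inj : lker g == 0%VS by apply/eqP.
  by apply/eqP/inj; rewrite linearB /= e subrr linear0.
by apply: lker_inj => y e0; rewrite -(e y) e0 linear0.
Qed.

(** Superfluity of the kernel makes the lift [P_v -> P] onto, so [P] is uniserial with top [v], and
    projectivity fixes its length. *)
Lemma proj_cover_uni S P v (s : nat -> S) : uni v 1 s -> is_proj_cover S P ->
  exists p : nat -> P, uni v (c v) p.
Proof.
move=> uS [f [pP hf imf suf]]; have c0 := nak_len_gt0 nak v.
have uP0 := proj_uniserial nak v.
have [||pi [hpi piE _ _]] := uni_shift nak (s := 0%N) uP0 uS; rewrite ?addn0 //.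
have [h hh hE] := uni_projective nak uP0 hf imf hpi.
have imh : limg h = fullv.
  apply: suf; first by apply: submod_img => //; apply: submod_full.
  apply/vspaceP=> y; rewrite memvf; have [a ea] := uni_span uS (f y).
  pose w := a 0%N *: proj_gen x v 0%N; apply/memv_addP.
  exists (y - h w); last first.
    by exists (h w); [rewrite memv_img ?memvf|rewrite subrK].
  rewrite memv_ker linearB /= hE ea big_ord_recl big_ord0 addr0 linearZ /= piE.
  by rewrite subrr.
have [j jc kh] := submod_eq_filt uP0 (submod_ker hh).
have uP := uni_quotient uP0 jc hh imh kh; exists (fun k => h (proj_gen x v k)).
case: (posnP j) => [j0|j0]; last by rewrite -(uni_projective_len nak uP j0 pP).
have z (y : P) : y = 0.
  by have := uni_span uP y; rewrite j0 => -[a ->]; rewrite big_ord0.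
have [y e] := (limg_fullP f).2 imf (s 0%N).
by have := uni_eq0 uS 0%N; rewrite -e (z y) linear0 eqxx.
Qed.

Lemma uni_proj_cover S P v (s : nat -> S) (p : nat -> P) :
  uni v 1 s -> uni v (c v) p -> is_proj_cover S P.
Proof.
move=> uS uP; have c0 := nak_len_gt0 nak v.
have [||f [hf fE kf imf]] := uni_shift nak (s := 0%N) uP uS; rewrite ?addn0 //.
exists f; split=> //; first exact: (uni_projective nak uP).
  by rewrite imf (filt0 nak uS).
rewrite kf => V /(submod_eq_filt uP)[j jc ->] e.
case: (posnP j) => [->|j0]; first exact: (filt0 nak uP).
have : filt (c v) p 1 = fullv.
  rewrite -e subn0; apply/esym/addv_idPl/span_subvP=> _ /mapP[k + ->].
  by rewrite mem_index_iota (mem_filt uP) => /andP[]; lia.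
by move/(filt_full uP c0).
Qed.

Lemma uni_simple_submod M v l (m : nat -> M) (V : {vspace M}) : (0 < l)%N ->
  uni v l m -> simple_submod V <-> V = <[m l.-1]>%VS.
Proof.
move=> l0 uM; rewrite -(filt_line m l0); split=> [[sV V0 minV]|->].
  have [j jl eV] := submod_eq_filt uM sV.
  have jl' : (j < l)%N.
    by rewrite ltn_neqAle jl andbT; apply/eqP => e; apply: V0; rewrite eV e filt_out.
  case: (minV _ (submod_filt nak uM (j := l.-1))) => [|/(filt_eq0 uM)|//]; last by lia.
  rewrite eV; apply/span_subvP=> _ /mapP[k + ->].
  by rewrite mem_index_iota (mem_filt uM) => /andP[]; lia.
split=> [|/(filt_eq0 uM)|W /(submod_eq_filt uM)[j jl ->] sub].
- exact: (submod_filt nak uM).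
- by lia.
case: (leqP l j) => lj; [left; exact: filt_out|right].
have : m j \in filt l m l.-1 by apply: (subvP sub); rewrite (mem_filt uM) leqnn.
rewrite (mem_filt uM) => h; congr (filt l m _); lia.
Qed.

Lemma uni_socle M v l (m : nat -> M) (U : {vspace M}) : (0 < l)%N ->
  uni v l m -> socle U <-> U = <[m l.-1]>%VS.
Proof.
move=> l0 uM; have sP V := uni_simple_submod V l0 uM; split=> [[h [s [sS e]]]|->].
  apply/eqP; rewrite eqEsubv (h _ ((sP _).2 erefl)) andbT e.
  rewrite big_seq; elim/big_ind: _ => [|U1 U2 h1 h2|V /sS/sP ->].
  - exact: sub0v.
  - by rewrite subv_add h1.
  - exact: subvv.
split=> [V /sP -> //|]; exists [:: <[m l.-1]>%VS]; split; last by rewrite big_seq1.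
by move=> V; rewrite inE => /eqP ->; apply/sP.
Qed.

Lemma socle_uni P X v (p : nat -> P) : uni v (c v) p -> is_socle_of P X ->
  exists s : nat -> X, uni (v + (c v).-1) 1 s.
Proof.
move=> uP [f [hf /eqP kf sf]]; have c0 := nak_len_gt0 nak v.
have {sf} imf := (uni_socle _ c0 uP).1 sf.
have : p (c v).-1 \in limg f by rewrite imf memv_line.
case/memv_imgP=> z _ ez; have inj := lker0P kf.
exists (fun k => if k == 0%N then z else 0); split=> [[|k]|y|[|k] u t] //=.
- have := uni_eq0 uP (c v).-1; rewrite ez => h.
  by apply/eqP => e; move: h; rewrite e linear0 eqxx; lia.
- by rewrite eqxx.
- have : f y \in limg f by rewrite memv_img ?memvf.
  rewrite imf => /vlineP[a ea]; exists (fun _ => a).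
  by rewrite big_ord_recl big_ord0 addr0 /=; apply: inj; rewrite linearZ /= -ez.
- apply: inj; rewrite hf -ez (uni_act uP) addn0 add0n; case: ifP; rewrite ?linear0 //.
  case: t => [|t] _; first by rewrite addn0.
  by rewrite (uni_out uP) ?linear0 //; lia.
by rewrite ract0l if_same.
Qed.

Lemma uni_is_socle P X v w (p : nat -> P) (s : nat -> X) : uni v (c v) p ->
  uni w 1 s -> w = v + (c v).-1 %[mod N] -> is_socle_of P X.
Proof.
move=> uP uX e; have c0 := nak_len_gt0 nak v.
have [||f [hf fE kf imf]] := uni_shift nak (s := (c v).-1) uX uP; rewrite ?e //.
  by rewrite add1n prednK.
exists f; split=> //; first by rewrite kf filt_out //; lia.
by rewrite imf (filt_line p c0); apply/(uni_socle _ c0 uP).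
Qed.

Lemma proj_rmod_indec v : indec_projective (proj_rmod x v).
Proof.
have uP := proj_uniserial nak v; split; last exact: (uni_projective nak uP).
exact: (uni_indecomposable uP (nak_len_gt0 nak v)).
Qed.

Lemma proj_rmod_complete :
  complete_reps (@indec_projective K A) (fun v : 'I_N => proj_rmod x v).
Proof.
split=> [v|v w [f [hf kf imf]]|P].
- exact: proj_rmod_indec.
- have uP := uni_transport (proj_uniserial nak v) hf imf kf.
  have := uni_top_uniq nak (nak_len_gt0 nak v) uP (proj_uniserial nak w).
  by rewrite !modn_small // => /val_inj.
case/indec_projective_uni=> v vN [p uP]; exists (Ordinal vN).
exact: (uni_iso nak uP (proj_uniserial nak v)).
Qed.

Lemma nakayama_defect : has_alg_defect A (\sum_(v < N) (c v - c (vpred N v))).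
Proof.
exists N, (fun v : 'I_N => proj_rmod x v), (fun v : 'I_N => c v - c (vpred N v))%N.
split=> //; first exact: proj_rmod_complete.
by move=> v; apply: (uni_defect nak (proj_uniserial nak v)).
Qed.

Lemma has_defect_uniq M d d' : has_defect M d -> has_defect M d' -> d = d'.
Proof.
case=> s [us <- sP] [s' [us' <- s'P]]; apply: perm_size.
by apply: uniq_perm => // U; apply/idP/idP => [/sP/s'P|/s'P/sP].
Qed.

(** Sending each given simple to the vertex at its top is a bijection, which turns a sum over an
    abstract labelling into one over the vertices. *)
Lemma sum_defect n (S P : 'I_n -> rmod A) (d : 'I_n -> nat) :
  complete_reps (@simple K A) S -> (forall i, is_proj_cover (S i) (P i)) ->
  (forall i, has_defect (P i) (d i)) ->
  (\sum_i d i = \sum_(v < N) (c v - c (vpred N v)))%N.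
Proof.
case=> sS injS surS covP defP.
have [sg sgP] : exists sg : 'I_n -> 'I_N, forall i,
    exists s : nat -> S i, uni (sg i) 1 s.
  apply: (@fin_all_exists _ (fun _ => 'I_N) (fun i v => exists s : nat -> S i, uni v 1 s)).
  by move=> i; have [v vN us] := simple_uni (sS i); exists (Ordinal vN).
have sg_inj : injective sg.
  move=> i j e; apply: injS; have [s us] := sgP i; have [s' us'] := sgP j.
  by apply: (uni_iso nak us us'); rewrite e.
have sg_sur v : exists i, sg i = v.
  have uS := uni_rmodP nak (nak_len_gt0 nak v).
  have [i [f [hf kf imf]]] := surS _ (uni_simple uS); exists i; have [s us] := sgP i.
  have := uni_top_uniq nak (ltnSn 0) (uni_transport uS hf imf kf) us.
  by rewrite !modn_small // => /val_inj.
have dE i : d i = (c (sg i) - c (vpred N (sg i)))%N.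
  have [s us] := sgP i; have [p uP] := proj_cover_uni us (covP i).
  exact: (has_defect_uniq (defP i) (uni_defect nak uP)).
have bij : bijective sg.
  have [tau tauK] : exists tau : 'I_N -> 'I_n, forall v, sg (tau v) = v.
    exact: (@fin_all_exists _ (fun _ => 'I_n) (fun v i => sg i = v)).
  by exists tau => // i; apply: sg_inj; rewrite tauK.
rewrite (reindex sg) /=; first by apply: eq_bigr.
exact: onW_bij.
Qed.

End Classification.

(** * Translates, sums of projectives, injective hulls and dominant dimension *)

Section Homological.
Variables (K : fieldType) (A : falgType K) (N : nat) (c : nat -> nat).
Variables (x : nat -> nat -> A) (nak : nakayama N c x).
Implicit Types M X P S T : rmod A.
Local Notation uni := (uniserial N x).

Lemma filt_superfluous M v l (m : nat -> M) j : uni v l m -> (0 < l)%N ->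
  (0 < j)%N -> superfluous (filt l m j).
Proof.
move=> uM l0 j0 V /(submod_eq_filt uM)[i il ->] e.
case: (posnP i) => [->|i0]; first exact: (filt0 nak uM).
have : filt l m 1 = fullv.
  apply/eqP; rewrite eqEsubv subvf -e subv_add /=; apply/andP; split;
    apply/span_subvP=> _ /mapP[k + ->];
    rewrite mem_index_iota (mem_filt uM) => /andP[]; lia.
by move/(filt_full uM l0).
Qed.

Lemma filt_essential M v l (m : nat -> M) j : uni v l m ->
  (j < l)%N || (l == 0%N) -> essential (filt l m j).
Proof.
move=> uM jl V /(submod_eq_filt uM)[i il ->] e; apply: filt_out.
rewrite leqNgt; apply/negP => il'; have := memv_cap (m l.-1) (filt l m j) (filt l m i).
rewrite e memv0 (uni_eq0 uM) !(mem_filt uM); lia.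
Qed.

Section Character.
Variables (T : rmod A) (w : nat) (t : nat -> T) (uT : uni w 1 t).

(** A module of length 1 is a line on which [A] acts by a character; the transpose computed below is
    the ground field with that character. *)
Lemma simple_character : exists (tau : 'Hom(T, K^o)) (chi : 'Hom(A, K^o)),
  [/\ forall y : T, y = tau y *: t 0%N, forall (y : T) a, ract y a = chi a *: y
    & forall u k, chi (x u k) = if (w == u %[mod N]) && (k == 0%N) then 1 else 0].
Proof.
have [tau tau1] := uni_lfun uT (fun _ => 1 : K^o).
have tauE y : y = tau y *: t 0%N.
  have [a ->] := uni_span uT y; rewrite big_ord_recl big_ord0 addr0 linearZ /= tau1 //.
  by rewrite /GRing.scale /= mulr1.
have [|chi chiE] := @linear_lfun K A K^o (fun a => tau (ract (t 0%N) a)).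
  by move=> k a b; rewrite ractDr ractZr linearP.
exists tau, chi; split=> // [y a|u k].
  by rewrite [in LHS](tauE y) ractZl (tauE (ract (t 0%N) a)) -chiE scalerA mulrC -scalerA -tauE.
rewrite chiE (uni_act uT) addn0 add0n; case: ifP => //= _; last by rewrite linear0.
by case: k => [|k]; [rewrite tau1|rewrite (uni_out uT) ?linear0].
Qed.
End Character.

(** Modulo left multiples of the arrow into [w], [A e_w] is spanned by [e_w]; this is the cokernel
    occurring in the transpose. *)
Lemma gen_factor v w a : w = v.+1 %[mod N] ->
  exists (b : K) (y : A), a * x w 0%N = b *: x w 0%N + y * x v 1%N.
Proof.
move=> e; have [f ->] := nak_span nak a.
pose Q a' := exists (b : K) (y : A), a' * x w 0%N = b *: x w 0%N + y * x v 1%N.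
have QD a1 a2 : Q a1 -> Q a2 -> Q (a1 + a2).
  case=> [b1 [y1 e1]] [b2 [y2 e2]]; exists (b1 + b2), (y1 + y2).
  by rewrite mulrDl e1 e2 scalerDl mulrDl addrACA.
have Q0 : Q 0 by exists 0, 0; rewrite !mul0r scale0r addr0.
apply: (big_ind Q) => // u _; apply: (big_ind Q) => // k _.
rewrite /Q -scalerAl (nak_mul nak) addn0; case: ifP => [/eqP uk|]; last first.
  by exists 0, 0; rewrite scaler0 scale0r mul0r addr0.
case: (nat_of_ord k) uk => [|k'] uk.
  exists (f u 0%N), 0; rewrite mul0r addr0 (gen_congr nak (w := w)) //.
  by rewrite -uk addn0.
exists 0, (f u k'.+1 *: x u k'); rewrite scale0r add0r -scalerAl (nak_mul nak).
by rewrite -(eqn_modDr 1) addn1 -addnS uk e addn1 eqxx addn1.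
Qed.

(** The presentation [P_w -> P_v] of [S_v] by the arrow [v -> w] is minimal because [rad P_v] is
    nonzero. Applying [Hom(-, A)] turns it into right multiplication by the arrow, from [A e_v] to
    [A e_w]; the cokernel is the simple left module at [w], dual to [S_w]. *)
Lemma uni_tau S T v w (s : nat -> S) (t : nat -> T) : uni v 1 s -> uni w 1 t ->
  w = v.+1 %[mod N] -> (1 < c v)%N -> is_tau S T.
Proof.
move=> uS uT e cv; have [tau [chi [tauE actE chiE]]] := simple_character uT.
have c0 := nak_len_gt0 nak.
have t0 : t 0%N != 0 by rewrite (uni_eq0 uT).
have chi1 : chi 1 = 1.
  have := actE (t 0%N) 1; rewrite ract1 => /eqP; rewrite -[X in X == _]scale1r -subr_eq0.
  by rewrite -scalerBl scaler_eq0 (negPf t0) orbF subr_eq0 => /eqP.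
have chiM a b : chi (a * b) = chi a * chi b.
  have := actE (t 0%N) (a * b); rewrite ractM !actE scalerA => /eqP.
  rewrite -subr_eq0 -scalerBl scaler_eq0 (negPf t0) orbF subr_eq0 => /eqP <-.
  exact: mulrC.
have actl y : linear (fun a : A => chi a * y : K^o).
  by move=> k a b; rewrite linearP mulrDl /GRing.scale /= mulrA.
have actr a : linear (fun y : K^o => chi a * y : K^o).
  by move=> k y z; rewrite mulrDr /GRing.scale /= mulrCA.
have act1 (y : K^o) : chi 1 * y = y by rewrite chi1 mul1r.
have actM (y : K^o) a b : chi (a * b) * y = chi a * (chi b * y).
  by rewrite chiM mulrA.
pose L := @LMod K A K^o (fun a y => chi a * y) actl actr act1 actM.
exists L; last first.
  have [|b bE] := @linear_lfun K T 'Hom(L, K^o) (fun y => tau y *: (\1%VF : 'End(K^o))).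
    by move=> k y z; rewrite linearP scalerDl scalerA.
  exists b; split=> [||y a z].
  - apply: lker_inj => y; rewrite bE => /lfunP/(_ (1 : K^o)).
    rewrite scale_lfunE id_lfunE zero_lfunE /GRing.scale /= mulr1 => y0.
    by rewrite (tauE y) y0 scale0r.
  - apply/limg_fullP=> g; exists (g (1 : K^o) *: t 0%N); rewrite bE; apply/lfunP=> z.
    have tau1 : tau (t 0%N) = 1.
      have /eqP := tauE (t 0%N); rewrite -[X in X == _]scale1r -subr_eq0 -scalerBl.
      by rewrite scaler_eq0 (negPf t0) orbF subr_eq0 => /eqP.
    rewrite linearZ /= tau1 scale_lfunE id_lfunE /GRing.scale /= mulr1 mulrC.
    by rewrite -[in RHS](mulr1 z) -[z * 1]/(z *: (1 : K^o)) linearZ.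
  - rewrite !bE actE linearZ /= !scale_lfunE !id_lfunE /GRing.scale /=.
    by rewrite -mulrA mulrCA.
have uP0 := proj_uniserial nak v; have uP1 := proj_uniserial nak w.
have cvw : (c v <= c w + 1)%N.
  by rewrite addn1 (len_congr nak e); apply: (nak_lenS nak).
have [||p0 [hp0 p0E kp0 imp0]] := uni_shift nak (s := 0%N) uP0 uS; rewrite ?addn0 //.
have [||p1 [hp1 p1E kp1 imp1]] := uni_shift nak (s := 1%N) uP1 uP0; first by rewrite addn1 e.
  exact: cvw.
exists (proj_rmod x w), (proj_rmod x v), p1, p0; split.
  split; split=> //; first exact: (uni_projective nak uP0).
  - by rewrite imp0 (filt0 nak uS).
  - by rewrite kp0; apply: (filt_superfluous uP0).
  - exact: (uni_projective nak uP1).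
  - by rewrite imp1 kp0.
  - by rewrite kp1; apply: (filt_superfluous uP1) => //; rewrite subn_gt0.
pose q0 := proj_gen x w 0%N.
(* Evaluation at the generator identifies [Hom(P_w, A)] with [A e_w], and [chi] is the projection of
   the latter onto its top. *)
have [|Q QE] := @linear_lfun K 'Hom(proj_rmod x w, regular A) L (fun f => chi (f q0)).
  by move=> k f g; rewrite add_lfunE scale_lfunE linearP.
have genE k : proj_gen x w k = ract q0 (x w k).
  by have := uni_actD uP1 0%N k; rewrite addn0 add0n.
have homeq (f g : 'Hom(proj_rmod x w, regular A)) : is_hom f -> is_hom g ->
    f q0 = g q0 -> f = g.
  move=> hf hg e0; apply/lfunP=> y; have [a ->] := uni_span uP1 y.
  by rewrite !linear_sum; apply: eq_bigr => k _; rewrite !linearZ /= genE hf hg e0.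
exists Q; split=> [a f _|y|f hf].
- by rewrite !QE comp_lfunE lfunE /= chiM.
- have [|f hf fE] := uni_lift nak uP1 (X := regular A) (z := x w 0%N).
    by rewrite (gen_eq0 nak (leqnn (c w))) ract0r.
  exists (y *: f) => [z a|]; first by rewrite !scale_lfunE hf ractZl.
  rewrite QE scale_lfunE fE /= (nak_mul nak) addn0 eqxx addn0 linearZ /= chiE !eqxx.
  by rewrite /GRing.scale /= mulr1.
split=> [|[g hg ->]]; rewrite QE; last first.
  rewrite comp_lfunE p1E add0n.
  have := uni_actD uP0 0%N 1%N; rewrite addn0 add0n => <-.
  by rewrite hg /= chiM chiE andbF mulr0.
have [b [y fE]] := gen_factor (f q0) e.
have fq0 : f q0 = f q0 * x w 0%N by rewrite {1}/q0 genE hf.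
rewrite fq0 fE linearD linearZ /= chiM !chiE !eqxx andbF mulr0 addr0 /GRing.scale /= mulr1.
move=> b0; have [|g hg gE] := uni_lift nak uP0 (X := regular A) (z := y).
  by rewrite (gen_eq0 nak) // ract0r.
exists g => //; apply: homeq => //; first exact: (is_hom_comp hg hp1).
by rewrite comp_lfunE p1E gE fq0 fE b0 scale0r add0r.
Qed.

Section IdealSum.
Variables (I : finType) (b : I -> nat).
Hypotheses (bN : forall i, (b i < N)%N) (b_inj : injective b).

(** Realising the sum of distinct [P_(b i)] as the right ideal of one idempotent makes its
    endomorphism ring a corner of [A]. *)
Definition idem : A := \sum_i x (b i) 0%N.

Lemma idem_mul i k : idem * x (b i) k = x (b i) k.
Proof.
rewrite /idem mulr_suml (bigD1 i) //= (nak_mul nak) addn0 eqxx add0n big1 ?addr0 //.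
move=> j ji; rewrite (nak_mul nak) addn0 !modn_small //; case: eqP => // /b_inj e.
by rewrite e eqxx in ji.
Qed.

Lemma mul_idem i : x (b i) 0%N * idem = x (b i) 0%N.
Proof.
rewrite /idem mulr_sumr (bigD1 i) //= (nak_mul nak) addn0 eqxx addn0 big1 ?addr0 //.
move=> j ji; rewrite (nak_mul nak) addn0 !modn_small //; case: eqP => // /b_inj e.
by rewrite e eqxx in ji.
Qed.

Lemma lmul_hom (e1 e2 z : A) : exists f : 'Hom(right_ideal e1, right_ideal e2),
  is_hom f /\ forall a, f (ideal_elt e1 a) = ideal_elt e2 (z * (e1 * a)).
Proof.
have [g gE] := ideal_lfun e2.
have [|f fE] := @linear_lfun K (right_ideal e1) (right_ideal e2)
    (fun y => g (z * vsval y)).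
  by move=> k y y'; rewrite linearP mulrDr -scalerAr linearP.
exists f; split=> [y a|a]; last by rewrite fE gE ideal_eltE.
by rewrite !fE !gE sub_ractE ract_ideal_elt /= mulrA.
Qed.

Lemma idem_direct_sum :
  exists (inj : forall i, 'Hom(proj_rmod x (b i), right_ideal idem))
    (prj : forall i, 'Hom(right_ideal idem, proj_rmod x (b i))),
  [/\ (forall i, is_hom (inj i)), (forall i, is_hom (prj i)),
      (forall i y, prj i (inj i y) = y),
      (forall i j y, i <> j -> prj j (inj i y) = 0)
    & (forall y, y = \sum_i inj i (prj i y))].
Proof.
have [inj injP] : exists inj : forall i, 'Hom(proj_rmod x (b i), right_ideal idem),
    forall i, is_hom (inj i) /\ forall a, inj i (ideal_elt _ a) =
      ideal_elt idem (1 * (x (b i) 0%N * a)).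
  apply: (@fin_all_exists _ (fun i => 'Hom(proj_rmod x (b i), right_ideal idem))
    (fun i f => is_hom f /\ forall a, f (ideal_elt _ a) =
      ideal_elt idem (1 * (x (b i) 0%N * a)))) => i; exact: lmul_hom.
have [prj prjP] : exists prj : forall i, 'Hom(right_ideal idem, proj_rmod x (b i)),
    forall i, is_hom (prj i) /\ forall a, prj i (ideal_elt _ a) =
      ideal_elt (x (b i) 0%N) (1 * (idem * a)).
  apply: (@fin_all_exists _ (fun i => 'Hom(right_ideal idem, proj_rmod x (b i)))
    (fun i f => is_hom f /\ forall a, f (ideal_elt _ a) =
      ideal_elt (x (b i) 0%N) (1 * (idem * a)))) => i; exact: lmul_hom.
have xx i j : x (b i) 0%N * x (b j) 0%N = if i == j then x (b i) 0%N else 0.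
  by rewrite (nak_mul nak) !addn0 !modn_small // (inj_eq b_inj).
exists inj, prj; split=> [i|i|i y|i j y ij|y].
- by case: (injP i).
- by case: (prjP i).
- have [a ->] := ideal_eltP y; rewrite (injP i).2 (prjP i).2 !mul1r.
  by apply: subvs_inj; rewrite !ideal_eltE !mulrA mul_idem xx eqxx.
- have [a ->] := ideal_eltP y; rewrite (injP i).2 (prjP j).2 !mul1r.
  apply: subvs_inj; rewrite !ideal_eltE !mulrA mul_idem xx; case: eqP => [/esym//|_].
  by rewrite mul0r linear0.
have [a ->] := ideal_eltP y; apply: subvs_inj; rewrite [RHS]linear_sum /= ideal_eltE.
transitivity (\sum_i x (b i) 0%N * a); first by rewrite -mulr_suml.
apply: eq_bigr => i _; rewrite (prjP i).2 (injP i).2 ideal_eltE !mul1r.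
by rewrite !mulrA idem_mul mul_idem.
Qed.

Lemma idem_injective : (forall i, injective_mod (proj_rmod x (b i))) ->
  injective_mod (right_ideal idem).
Proof.
have [inj [prj [hi hp _ _ e]]] := idem_direct_sum.
by apply: summand_injective; exists inj, prj.
Qed.

Lemma idem_projective : projective (right_ideal idem).
Proof.
have [inj [prj [hi hp _ _ e]]] := idem_direct_sum.
apply: (summand_projective (X := fun i => proj_rmod x (b i))); first by exists inj, prj.
by move=> i; apply: (uni_projective nak (proj_uniserial nak _)).
Qed.
End IdealSum.

(** Adding [N.-1] is a step back on the cycle, so the argument of [c] stands for [v - j - 1]: the
    inequality is the injectivity criterion for top [v - j] and length [l + j]. *)
Lemma hull_ex v l : exists j, (c (v + j.+1 * N.-1) <= l + j)%N.
Proof.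
exists (\max_(u < N) c u); set w := (v + _)%N; have wN := ltn_pmod w (nak_rank nak).
rewrite (len_congr nak (w := (w %% N)%N)) ?modn_mod //.
by apply: leq_trans (leq_addl _ _); apply: (leq_bigmax (Ordinal wN)).
Qed.

(* The injective hull of a uniserial module with top [v] and length [l] is
   uniserial with top [hull_top v l] and length [l + hull v l]. *)
Definition hull v l : nat := if l == 0%N then 0%N else ex_minn (hull_ex v l).
Definition hull_top v l : nat := (v + hull v l * N.-1)%N.

Lemma hull_topP v l : hull_top v l + hull v l = v %[mod N].
Proof.
rewrite /hull_top -addnA -mulnSr prednK ?(nak_rank nak) //.
by rewrite mulnC -modnDmr modnMr addn0.
Qed.

(** By minimality of [hull]: as long as the extended module is not injective, there is room for one
    more vertex on top. *)
Lemma hull_len v l : (l <= c v)%N -> (l + hull v l <= c (hull_top v l))%N.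
Proof.
rewrite /hull_top /hull; case: eqP => [-> _|_ lc]; first by rewrite !addn0.
case: ex_minnP => -[|j] _ jmin; first by rewrite !addn0.
by rewrite addnS ltnNge; apply/negP => /jmin; rewrite ltnn.
Qed.

Lemma hull_pred v l : (0 < l)%N -> (c (vpred N (hull_top v l)) <= l + hull v l)%N.
Proof.
rewrite /hull_top /hull /vpred => l0; rewrite gtn_eqF //.
by case: ex_minnP => j h _; rewrite -addnA -mulSnr.
Qed.

Lemma hull0 v : hull v 0%N = 0%N.
Proof. by []. Qed.

Lemma hull_gt0 v : (c v < c (vpred N v))%N -> (0 < hull v (c v))%N.
Proof.
rewrite /hull gtn_eqF ?(nak_len_gt0 nak) //; case: ex_minnP => -[|//].
by rewrite mul1n addn0 /vpred leqNgt => h _ h'; rewrite h' in h.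
Qed.

Lemma hull_injective v l M (m : nat -> M) :
  uni (hull_top v l) (l + hull v l) m -> injective_mod M.
Proof.
case: (posnP l) => [->|l0] uM; first exact: (uni0_injective uM).
by apply: (uni_injective nak uM); [rewrite addn_gt0 l0|apply: hull_pred].
Qed.

(** By [len_leD] the projective at the top of the hull is not longer than the hull, so the injective
    hull of [P_v] is projective. *)
Lemma hull_proj_len v : c (hull_top v (c v)) = (c v + hull v (c v))%N.
Proof.
apply/eqP; rewrite eqn_leq hull_len // andbT.
have := len_leD nak (hull_top v (c v)) (hull v (c v)).
by rewrite (len_congr nak (hull_topP _ _)).
Qed.

(* [P_u] is injective iff [c (u - 1) <= c u]. *)
Definition proj_inj : rmod A :=
  right_ideal (idem (fun u : {u : 'I_N | (c (vpred N u) <= c u)%N} => val (val u))).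

Lemma proj_inj_projective : projective proj_inj.
Proof.
apply: idem_projective => [u|u w /val_inj/val_inj //]; exact: ltn_ord (val u).
Qed.

Lemma proj_inj_injective : injective_mod proj_inj.
Proof.
apply: idem_injective => [u|u w /val_inj/val_inj //|u]; first exact: ltn_ord (val u).
apply: (uni_injective nak (proj_uniserial nak _)); last exact: (valP u).
exact: (nak_len_gt0 nak).
Qed.

(** The map sends 1 to the path to [v] from the top of the hull of [P_v], so on [P_v] it is the
    embedding into that hull. Over all [v] these maps separate the elements of [A]. *)
Lemma regular_to_proj_inj (v : 'I_N) : exists f : 'Hom(regular A, proj_inj),
  is_hom f /\ forall a, f a = 0 -> x v 0%N * a = 0.
Proof.
set u := hull_top v (c v); have uN := ltn_pmod u (nak_rank nak).
have eu : u %% N = u %[mod N] by rewrite modn_mod.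
have cu : (c (vpred N (Ordinal uN)) <= c (Ordinal uN))%N.
  rewrite /= (len_congr nak eu) (len_congr nak (w := vpred N u)).
    by rewrite hull_proj_len; apply: hull_pred; apply: (nak_len_gt0 nak).
  by rewrite /vpred modnDml.
pose i : {u : 'I_N | (c (vpred N u) <= c u)%N} := Sub (Ordinal uN) cu.
have [f hf fE] := @regular_hom _ A proj_inj (ideal_elt _ (x u (hull v (c v)))).
exists f; split=> // a; rewrite fE ract_ideal_elt => /(congr1 (fun y => vsval y)).
rewrite ideal_eltE linear0 mulrA (gen_congr nak _ (esym eu)).
have -> : (u %% N)%N = val (val i) by [].
rewrite idem_mul => [h|w|w w' /val_inj/val_inj //]; last exact: ltn_ord (val w).
have uP := proj_uniserial nak v; have uQ := proj_uniserial nak u.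
have [||g [hg gE kg _]] := uni_shift nak (s := hull v (c v)) uP uQ.
- exact: hull_topP.
- by rewrite hull_proj_len.
have /eqP/lker0P inj : lker g = 0%VS.
  by rewrite kg hull_proj_len addnK filt_out.
have h1 b : vsval (g (ideal_elt (x v 0%N) b)) = x u (hull v (c v)) * b.
  have := gE 0%N; rewrite add0n /proj_gen => g0.
  have -> : ideal_elt (x v 0%N) b = ract (ideal_elt (x v 0%N) (x v 0%N)) b.
    rewrite ract_ideal_elt; apply: subvs_inj.
    by rewrite !ideal_eltE mulrA (nak_mul nak) addn0 eqxx addn0.
  rewrite hg g0 ract_ideal_elt ideal_eltE mulrA (nak_mul nak) addn0 eqxx add0n //.
have : ideal_elt (x v 0%N) a = 0.
  apply: inj; rewrite linear0; apply: subvs_inj; rewrite h1 linear0.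
  by rewrite (gen_congr nak _ (esym eu)).
by move/(congr1 (fun y => vsval y)); rewrite ideal_eltE linear0.
Qed.

(** [I 0] is known only as an injective essential extension of [P]. Since [P] embeds in a power of
    [proj_inj], essentiality embeds [I 0] there too, injectivity splits this embedding, and [I 0] is
    projective. *)
Lemma projective_domdim_ge1 P : projective P -> domdim_ge P 1.
Proof.
move=> pP I d0 d [injI [hd0 _] kd0 _ [ess _]] [|//] _.
have [r [s [hs s0]]] := projective_torsionless pP.
have [f fP] : exists f : 'I_N -> 'Hom(regular A, proj_inj), forall v,
    is_hom (f v) /\ forall a, f v a = 0 -> x v 0%N * a = 0.
  apply: (@fin_all_exists 'I_N (fun _ => 'Hom(regular A, proj_inj)) (fun v f =>
    is_hom f /\ forall a, f a = 0 -> x v 0%N * a = 0)); exact: regular_to_proj_inj.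
pose J := ('I_r * 'I_N)%type.
have sJ := summand_pow J proj_inj.
have iQ := summand_injective sJ (fun _ => proj_inj_injective).
have pQ := summand_projective sJ (fun _ => proj_inj_projective).
have [g hg gE] : exists2 g : 'Hom(P, pow_rmod J proj_inj), is_hom g &
    forall y i, g y i = (f i.2 \o s i.1)%VF y.
  by apply: pow_tuple => i; apply: is_hom_comp => //; case: (fP i.2).
have g0 y : g y = 0 -> y = 0.
  move=> e; apply: s0 => i; rewrite -[s i y]mul1r -(nak_one nak) mulr_suml big1 // => v _.
  by apply: (fP v).2; rewrite -comp_lfunE -(gE y (i, v)) e ffunE.
have [h hh hE] := iQ _ _ _ _ hd0 kd0 hg.
have kh : lker h = 0%VS.
  apply: (ess _ (submod_ker hh)); apply/vspaceP=> y; rewrite memv0.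
  apply/idP/eqP => [|->]; last exact: mem0v.
  case/memv_capP=> /memv_imgP[z _ ->]; rewrite memv_ker hE => /eqP/g0 ->.
  by rewrite linear0.
have [q hq qE] := injective_retraction (injI 0%N) hh kh.
exact: (projective_retract hq hh qE).
Qed.

Lemma uni_lfun_eq (V : vectType K) M v l (m : nat -> M) (f g : 'Hom(M, V)) :
  uni v l m -> (forall k, (k < l)%N -> f (m k) = g (m k)) -> f = g.
Proof.
move=> uM e; apply/lfunP=> y; have [a ->] := uni_span uM y.
by rewrite !linear_sum; apply: eq_bigr => k _; rewrite !linearZ /= e.
Qed.

Section Resolution.
Variable v : nat.

(* The [k]-th cosyzygy of [P_v] is uniserial with top and length
   [cosyzygy k]. *)
Fixpoint cosyzygy k : nat * nat :=
  if k is k'.+1 then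
    let s := cosyzygy k' in (hull_top s.1 s.2, hull s.1 s.2)
  else (v, c v).

Let top k := hull_top (cosyzygy k).1 (cosyzygy k).2.
Let ext k := hull (cosyzygy k).1 (cosyzygy k).2.
Let len k := ((cosyzygy k).2 + ext k)%N.

Lemma cosyzygy_len k : ((cosyzygy k).2 <= c (cosyzygy k).1)%N.
Proof.
elim: k => //= k IH; apply: leq_trans (hull_len IH); exact: leq_addl.
Qed.

Definition res_mod k : rmod A := uni_rmod nak (top k) (len k).
Definition res_gen k : nat -> res_mod k := uni_gen nak (top k) (len k).

Lemma res_uni k : uni (top k) (len k) (@res_gen k).
Proof. by apply: uni_rmodP; apply: hull_len; apply: cosyzygy_len. Qed.

(** The property is boolean so that [xchoose] can select the whole sequence of differentials. *)
Lemma res_map_ex k : exists f : 'Hom(res_mod k, res_mod k.+1),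
  [forall i : 'I_(len k), f (res_gen k i) == res_gen k.+1 (i + ext k.+1)].
Proof.
have [f fE] := uni_lfun (res_uni k) (fun i => res_gen k.+1 (i + ext k.+1)).
by exists f; apply/forallP=> i; rewrite fE.
Qed.

Definition res_map k := xchoose (res_map_ex k).

Lemma res_mapP k : [/\ is_hom (res_map k),
  lker (res_map k) = filt (len k) (@res_gen k) (ext k)
  & limg (res_map k) = filt (len k.+1) (@res_gen k.+1) (ext k.+1)].
Proof.
have [||f [hf fE kf imf]] := uni_shift nak (s := ext k.+1) (res_uni k) (res_uni k.+1).
- exact: hull_topP.
- by rewrite /len /= leq_add2r leq_addl.
suff -> : res_map k = f by rewrite kf imf; split=> //; rewrite /len /= addnK.
apply: (uni_lfun_eq (res_uni k)) => i il; rewrite fE.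
by have /forallP/(_ (Ordinal il))/eqP := xchooseP (res_map_ex k).
Qed.

Lemma res_exists : exists d0 : 'Hom(proj_rmod x v, res_mod 0),
  is_min_inj_resolution d0 res_map.
Proof.
have uP := proj_uniserial nak v.
have [||f [hf fE kf imf]] := uni_shift nak (s := ext 0) uP (res_uni 0).
- exact: hull_topP.
- by [].
exists f; split.
- by move=> j; apply: hull_injective (res_uni j).
- by split=> // j; case: (res_mapP j).
- by rewrite kf /len /= addnK filt_out.
- split=> [|j]; first by rewrite imf; case: (res_mapP 0).
  by case: (res_mapP j.+1) => _ -> _; case: (res_mapP j).
split=> [|j].
  rewrite imf; apply: (filt_essential (res_uni 0)); rewrite /len /=.
  by have := nak_len_gt0 nak v; lia.
case: (res_mapP j) => _ _ ->; apply: (filt_essential (res_uni j.+1)).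
rewrite /len /ext /=; set h := hull _ (cosyzygy j).2.
(* Once the resolution has ended its terms have length 0, the second alternative in
   [filt_essential]. *)
by case: (posnP h) => [->|h0]; [rewrite hull0|rewrite -[X in (X < _)%N]add0n ltn_add2r h0].
Qed.

End Resolution.

(* The second term of the resolution of [P_v] is the injective hull of a module
   with socle [v - 1]; the hypotheses say that this hull is not projective. *)
Lemma nakayama_domdim1 v : (c v < c (vpred N v))%N ->
  (forall u, u + c u <> v %[mod N]) -> has_domdim A 1.
Proof.
move=> cv nsoc; split=> [P pP _|]; first exact: projective_domdim_ge1.
have uP := proj_uniserial nak v; exists (proj_rmod x v); split.
- exact: (uni_projective nak uP).
- by move/(uni_injective_len nak uP (nak_len_gt0 nak v)); rewrite leqNgt cv.
have [d0 dP] := res_exists v; move/(_ _ _ _ dP 1%N isT) => pR.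
have j0 := hull_gt0 cv; have := uni_projective_len nak (res_uni v 1) _ pR.
rewrite /= addn_gt0 j0 => /(_ isT) e.
(* If the second term were projective, it would be the full projective at its top, with socle right
   before [v]. *)
apply: (nsoc (hull_top (hull_top v (c v)) (hull v (c v)))).
by rewrite -e addnCA addnC -modnDml hull_topP modnDml hull_topP.
Qed.

End Homological.

(** * Linear Nakayama algebras *)

Section PathAlgebraGenerals.
Variables (K : fieldType) (Q : quiver).

Lemma path_mulU (p q : qpath Q) :
  path_mul (<< p >> : {malg K[qpath Q]}) << q >> =
  if path_cat p q is Some r then << r >> else 0.
Proof.
rewrite /path_mul !msuppU oner_eq0 !big_seq_fset1.
by case: path_cat => // r; rewrite !mcoeffUU mulr1.
Qed.

Lemma malg_linear (V : lmodType K) (f : {linear {malg K[qpath Q]} -> V}) z :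
  f z = \sum_(p <- msupp z) z@_p *: f << p >>.
Proof.
rewrite {1}(monalgE z) linear_sum; apply: eq_bigr => p _; rewrite -linearZ /=.
by congr (f _); apply/malgP=> k; rewrite mcoeffZ !mcoeffU mulrnAr mulr1.
Qed.

Lemma path_cat_None (p q : qpath Q) :
  path_target p != path_source q -> path_cat p q = None.
Proof. by rewrite /path_cat => /negPf ->. Qed.
End PathAlgebraGenerals.

Section LinearQuiver.
Variable n : nat.
Local Notation Q := (linear_quiver n.+1).

Lemma linear_is_walk (v : vertex Q) (s : seq (arrow Q)) :
  is_walk v s = (map val s == iota v (size s)).
Proof.
elim: s v => //= a s IHs v; rewrite IHs eqseq_cons -val_eqE /=.
by case: eqP => // ->.
Qed.

Lemma linear_target (p : qpath Q) :
  path_target p = (path_source p + path_length p)%N :> nat.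
Proof.
case: p => -[v s] w; rewrite /path_target /path_source /path_length /path_arrows /= in w *.
elim: s v w => [|a s IHs] v /=; first by rewrite addn0.
by case/andP=> /eqP <- /IHs ->; rewrite /= addnS.
Qed.

Lemma linear_path_bound (p : qpath Q) : (path_source p + path_length p < n.+1)%N.
Proof. by rewrite -linear_target ltn_ord. Qed.

Lemma linear_path_inj (p q : qpath Q) :
  path_source p = path_source q -> path_length p = path_length q -> p = q.
Proof.
case: p q => -[v s] /= ws [[w t] /= wt] vw sz; apply: val_inj => /=.
rewrite /path_source /path_length /path_arrows /= in vw sz.
move: ws wt; rewrite !linear_is_walk vw sz => /eqP e1 /eqP e2; congr pair => //.
by apply: (inj_map val_inj); rewrite e1 e2.
Qed.

Lemma linear_path_ex (v l : nat) : (v + l < n.+1)%N ->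
  exists2 p : qpath Q, path_source p = v :> nat & path_length p = l.
Proof.
move=> vl; have vn : (v < n.+1)%N by lia.
pose s : seq 'I_n := pmap insub (iota v l).
have es : map val s = iota v l.
  rewrite -[RHS](@filter_predT nat) pmap_filter //; last by move=> i; rewrite /= insubK.
  apply: eq_in_filter => i; rewrite mem_iota => iv /=; rewrite isSome_insub; lia.
have sz : size s = l by rewrite -(size_map val) es size_iota.
have w : is_walk (Ordinal vn : vertex Q) (s : seq (arrow Q)).
  by rewrite linear_is_walk /= sz; apply/eqP.
by exists (@QPath Q (Ordinal vn, s) w).
Qed.

Definition linear_path (v l : nat) : option (qpath Q) :=
  insub (inord v : vertex Q, pmap insub (iota v l) : seq (arrow Q)).

Lemma linear_pathP (v l : nat) : (v + l < n.+1)%N ->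
  exists p : qpath Q, [/\ linear_path v l = Some p, path_source p = v :> nat
    & path_length p = l].
Proof.
move=> vl; have [p pv pl] := linear_path_ex vl; exists p; split=> //.
rewrite /linear_path; have vn : (v < n.+1)%N by lia.
suff -> : (inord v : vertex Q, pmap insub (iota v l) : seq (arrow Q)) = val p.
  by rewrite valK.
case: p pv pl => -[u s] /= w; rewrite /path_source /path_length /path_arrows /=.
move=> uv sl; congr pair; first by apply: val_inj; rewrite /= inordK.
move: w; rewrite linear_is_walk uv sl => /eqP <-; rewrite map_pK //.
by move=> i; rewrite valK.
Qed.

Section Extract.
Variables (K : fieldType) (A : falgType K) (I : {malg K[qpath Q]} -> Prop).
Variables (admI : admissible I) (pi : {linear {malg K[qpath Q]} -> A}).
Hypotheses (pi_surj : forall a, exists z, pi z = a) (pi1 : pi (path_one K Q) = 1).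
Hypothesis piM : forall y z, pi (path_mul y z) = pi y * pi z.
Hypothesis piI : forall y, pi y = 0 <-> I y.

(** Vertices are read modulo [n.+1], and a path running past the last vertex is 0: in the cyclic
    format the missing arrow back to vertex 0 is the zero element. *)
Definition linear_gen (v l : nat) : A :=
  if (v %% n.+1 + l < n.+1)%N then
    if linear_path (v %% n.+1) l is Some p then pi << p >> else 0
  else 0.
Local Notation x := linear_gen.

Lemma linear_genE (p : qpath Q) (v l : nat) : path_source p = (v %% n.+1)%N :> nat ->
  path_length p = l -> x v l = pi << p >>.
Proof.
move=> pv pl; have := linear_path_bound p; rewrite pv pl => b.
have [q [e qv ql]] := linear_pathP b; rewrite /x b e; congr (pi << _ >>).
by apply: linear_path_inj; [apply: val_inj; rewrite /= pv qv|rewrite pl ql].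
Qed.

Lemma linear_gen0 (v l : nat) : (n.+1 <= v %% n.+1 + l)%N -> x v l = 0.
Proof. by move=> h; rewrite /x ifN // -leqNgt. Qed.

Lemma linear_gen_mul v l w k :
  x v l * x w k = if v + l == w %[mod n.+1] then x v (l + k)%N else 0.
Proof.
case: (leqP n.+1 (v %% n.+1 + l)) => [vl|vl].
  by rewrite !(linear_gen0 (v := v)) ?mul0r ?if_same //; lia.
case: (leqP n.+1 (w %% n.+1 + k)) => [wk|wk].
  rewrite (linear_gen0 wk) mulr0; case: eqP => // e; rewrite linear_gen0 //.
  by move: e; rewrite -modnDml (modn_small vl); lia.
have [p pv pl] := linear_path_ex vl; have [q qv ql] := linear_path_ex wk.
rewrite (linear_genE pv pl) (linear_genE qv ql) -piM path_mulU -modnDml (modn_small vl).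
case: eqP => [e|ne]; last first.
  rewrite path_cat_None ?linear0 //; apply/eqP => e; apply: ne.
  by rewrite -qv -e linear_target pv pl.
have [|r -> rw] := @path_catE Q p q; first by apply: val_inj; rewrite /= linear_target pv pl e qv.
rewrite (linear_genE (p := r)) // /path_source /path_length /path_arrows rw //=.
by rewrite size_cat -pl -ql.
Qed.

(** An admissible ideal only involves paths of length at least 2. *)
Lemma linear_gen_neq0 v l : (v + l < n.+1)%N -> (l < 2)%N -> x v l <> 0.
Proof.
move=> vl l2; have [p pv pl] := linear_path_ex vl.
rewrite (linear_genE (p := p)) //; last by rewrite pv modn_small //; lia.
move/piI; have [_ _ h] := admI; move/h/(_ p); rewrite msuppU oner_eq0 inE eqxx pl.
by move/(_ isT); lia.
Qed.

Lemma linear_len_ex v : exists l, x v l == 0.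
Proof. by exists n.+1; rewrite linear_gen0 ?leq_addl. Qed.

Definition linear_len v := ex_minn (linear_len_ex v).

Lemma linear_gen_eq0 v l : (x v l == 0) = (linear_len v <= l)%N.
Proof.
rewrite /linear_len; case: ex_minnP => m /eqP m0 mmin; apply/idP/idP => [/mmin //|ml].
by have := linear_gen_mul v m (v + m) (l - m); rewrite m0 mul0r eqxx subnKC // => <-.
Qed.

Lemma linear_gen_mod v l : x (v %% n.+1)%N l = x v l.
Proof. by rewrite /x modn_mod. Qed.

Lemma linear_gen_nakayama : nakayama n.+1 linear_len linear_gen.
Proof.
have xN v l : x (v + n.+1) l = x v l by rewrite -linear_gen_mod modnDr linear_gen_mod.
split=> //.
- move=> v; rewrite ltnNge -linear_gen_eq0 -linear_gen_mod; apply/eqP.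
  by apply: linear_gen_neq0 => //; rewrite addn0 ltn_pmod.
- move=> v; apply/eqP; rewrite eqn_leq -!linear_gen_eq0 xN.
  by rewrite -[X in _ && (X == 0)]xN !linear_gen_eq0 !leqnn.
(* The path in question is an arrow followed by a zero path from [v.+1]. *)
- move=> v; rewrite -linear_gen_eq0 -add1n.
  have := linear_gen_mul v 1 v.+1 (linear_len v.+1); rewrite addn1 eqxx => <-.
  have /eqP -> : x v.+1 (linear_len v.+1) == 0 by rewrite linear_gen_eq0.
  by rewrite mulr0.
- exact: linear_gen_eq0.
- exact: linear_gen_mul.
- rewrite -pi1 /path_one linear_sum; apply: eq_bigr => v _.
  by rewrite (linear_genE (p := @trivial_path Q v)) //= modn_small.
move=> a; have [z <-] := pi_surj a; rewrite malg_linear.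
pose P a' := exists f : nat -> nat -> K,
  a' = \sum_(v < n.+1) \sum_(l < linear_len v) f v l *: x v l.
apply: (big_ind P) => [|a1 a2 [f1 ->] [f2 ->]|p _].
- exists (fun _ _ => 0); rewrite big1 // => v _; rewrite big1 // => l _.
  by rewrite scale0r.
- exists (fun v l => f1 v l + f2 v l); rewrite -big_split; apply: eq_bigr => v _.
  by rewrite -big_split; apply: eq_bigr => l _; rewrite scalerDl.
set v := path_source p; set l := path_length p.
have -> : pi << p >> = x v l by rewrite (linear_genE (p := p)) // modn_small // ltn_ord.
case: (leqP (linear_len v) l) => lv.
  exists (fun _ _ => 0); have /eqP -> : x v l == 0 by rewrite linear_gen_eq0.
  rewrite scaler0 big1 // => u _; rewrite big1 // => t _; by rewrite scale0r.
exists (fun u t => if (u == v :> nat) && (t == l) then z@_p else 0).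
rewrite (bigD1 v) //= (bigD1 (Ordinal lv)) //= !eqxx !big1 ?addr0 // => [u uv|t tl].
  by rewrite big1 // => t _; rewrite val_eqE (negPf uv) scale0r.
by rewrite -val_eqE /= in tl; rewrite (negPf tl) scale0r.
Qed.

End Extract.
End LinearQuiver.

Lemma linear_nakayama_gen (K : fieldType) n (A : falgType K) :
  linear_nakayama n A -> exists c x,
  [/\ @nakayama K A n c x, forall v, (v < n)%N -> (v + c v <= n)%N
    & forall v, (v.+1 < n)%N -> (1 < c v)%N].
Proof.
case: n => [[]//|n] [_ [I admI [pi [surj pi1 piM piI]]]].
exists (linear_len pi), (linear_gen pi); split.
- exact: (linear_gen_nakayama admI).
- move=> v vn; rewrite -(subnKC (ltnW vn)) leq_add2l -(linear_gen_eq0 piM).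
  by rewrite linear_gen0 // modn_small // subnKC // ltnW.
move=> v vn; rewrite ltnNge -(linear_gen_eq0 piM); apply/eqP.
by apply: (linear_gen_neq0 admI) => //; rewrite addn1.
Qed.

(** * Cyclic Nakayama algebras *)

(* A small category on finitely many morphisms; [None] stands for a zero product. *)
Record fincat := Fincat {
  mor :> finType;
  mcomp : mor -> mor -> option mor;
  munit : pred mor;
  mcompA : forall p q r, obind (fun s => mcomp s r) (mcomp p q) = obind (mcomp p) (mcomp q r);
  munitl : forall q, exists2 e, munit e & forall e', munit e' ->
    mcomp e' q = if e' == e then Some q else None;
  munitr : forall q, exists2 e, munit e & forall e', munit e' ->
    mcomp q e' = if e' == e then Some q else None;
  munit_ex : exists e, munit e }.

Section ContractedAlgebra.
Variables (K : fieldType) (D : fincat).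

Definition calg : Type := {ffun D -> K^o}.
HB.instance Definition _ := Vector.copy calg {ffun D -> K^o}.
Implicit Types f g h : calg.

Definition calg_mul f g : calg :=
  [ffun b => \sum_p \sum_q if mcomp p q == Some b then f p * g q else 0].
Definition calg_one : calg := [ffun b => (munit b)%:R].

Lemma sum_option (o : option D) (F : D -> K) :
  \sum_s (if o == Some s then F s else 0) = if o is Some s then F s else 0.
Proof.
case: o => [s|]; last by rewrite big1.
rewrite (bigD1 s) //= eqxx big1 ?addr0 // => t /negPf ts.
by rewrite (inj_eq Some_inj) eq_sym ts.
Qed.

Lemma calg_mulA : associative calg_mul.
Proof.
move=> f g h; apply/ffunP=> b; rewrite !ffunE.
(* Both sides are brought to a sum over triples, conditioned on the iterated composite; undefined
   composites drop out by [sum_option]. *)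
transitivity (\sum_p \sum_q \sum_r
    if obind (mcomp p) (mcomp q r) == Some b then f p * g q * h r else 0).
  apply: eq_bigr => p _.
  transitivity (\sum_q \sum_r \sum_s
      if mcomp q r == Some s then
        if mcomp p s == Some b then f p * g q * h r else 0 else 0).
    rewrite (eq_bigr (fun s => \sum_q \sum_r if mcomp q r == Some s then
        if mcomp p s == Some b then f p * g q * h r else 0 else 0)).
      rewrite exchange_big; apply: eq_bigr => q _; exact: exchange_big.
    move=> s _; rewrite ffunE; case: ifP => _; last first.
      by rewrite big1 // => q _; rewrite big1 // => r _; rewrite if_same.
    rewrite mulr_sumr; apply: eq_bigr => q _; rewrite mulr_sumr; apply: eq_bigr => r _.
    by case: ifP; rewrite ?mulr0 ?mulrA.
  apply: eq_bigr => q _; apply: eq_bigr => r _; rewrite sum_option.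
  by case: (mcomp q r).
symmetry.
transitivity (\sum_r \sum_p \sum_q \sum_s
    if mcomp p q == Some s then
      if mcomp s r == Some b then f p * g q * h r else 0 else 0).
  rewrite exchange_big; apply: eq_bigr => r _.
  rewrite (eq_bigr (fun s => \sum_p \sum_q if mcomp p q == Some s then
      if mcomp s r == Some b then f p * g q * h r else 0 else 0)).
    rewrite exchange_big; apply: eq_bigr => q _; exact: exchange_big.
  move=> s _; rewrite ffunE; case: ifP => _; last first.
    by rewrite big1 // => q _; rewrite big1 // => t _; rewrite if_same.
  rewrite mulr_suml; apply: eq_bigr => q _; rewrite mulr_suml; apply: eq_bigr => t _.
  by case: ifP; rewrite ?mul0r.
rewrite exchange_big; apply: eq_bigr => p _; rewrite exchange_big; apply: eq_bigr => q _.
apply: eq_bigr => r _; rewrite sum_option -mcompA.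
by case: (mcomp p q).
Qed.

Lemma calg_mul1l : left_id calg_one calg_mul.
Proof.
move=> f; apply/ffunP=> b; rewrite ffunE exchange_big /=.
rewrite -[RHS](sum_option (Some b) f); apply: eq_bigr => q _.
have [e ue eP] := munitl q; rewrite (bigD1 e) //= ffunE ue mul1r eP // eqxx.
rewrite big1 ?addr0 => [|p pe]; first by rewrite eq_sym.
rewrite ffunE; case: (boolP (munit p)) => [up|_]; last by rewrite mul0r if_same.
by rewrite eP // (negPf pe).
Qed.

Lemma calg_mul1r : right_id calg_one calg_mul.
Proof.
move=> f; apply/ffunP=> b; rewrite ffunE.
rewrite -[RHS](sum_option (Some b) f); apply: eq_bigr => q _.
have [e ue eP] := munitr q; rewrite (bigD1 e) //= ffunE ue mulr1 eP // eqxx.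
rewrite big1 ?addr0 => [|p pe]; first by rewrite eq_sym.
rewrite ffunE; case: (boolP (munit p)) => [up|_]; last by rewrite mulr0 if_same.
by rewrite eP // (negPf pe).
Qed.

Lemma calg_mulDl : left_distributive calg_mul +%R.
Proof.
move=> f g h; apply/ffunP=> b; rewrite !ffunE -big_split; apply: eq_bigr => p _ /=.
rewrite -big_split; apply: eq_bigr => q _; rewrite ffunE mulrDl /=.
by case: ifP; rewrite ?addr0.
Qed.

Lemma calg_mulDr : right_distributive calg_mul +%R.
Proof.
move=> f g h; apply/ffunP=> b; rewrite !ffunE -big_split; apply: eq_bigr => p _ /=.
rewrite -big_split; apply: eq_bigr => q _; rewrite ffunE mulrDr /=.
by case: ifP; rewrite ?addr0.
Qed.

Lemma calg_one_neq0 : calg_one != 0.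
Proof.
have [e ue] := munit_ex D; apply/eqP => /ffunP/(_ e); rewrite !ffunE ue => /eqP.
by rewrite oner_eq0.
Qed.

HB.instance Definition _ := GRing.Zmodule_isNzRing.Build calg
  calg_mulA calg_mul1l calg_mul1r calg_mulDl calg_mulDr calg_one_neq0.

Lemma calg_scaleAl (k : K) f g : k *: (f * g) = (k *: f) * g.
Proof.
apply/ffunP=> b; rewrite !ffunE scaler_sumr; apply: eq_bigr => p _.
rewrite scaler_sumr; apply: eq_bigr => q _; rewrite ffunE.
by case: ifP; rewrite ?scaler0 // scalerAl.
Qed.
HB.instance Definition _ := GRing.Lmodule_isLalgebra.Build K calg calg_scaleAl.

Lemma calg_scaleAr (k : K) f g : k *: (f * g) = f * (k *: g).
Proof.
apply/ffunP=> b; rewrite !ffunE scaler_sumr; apply: eq_bigr => p _.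
rewrite scaler_sumr; apply: eq_bigr => q _; rewrite ffunE.
by case: ifP; rewrite ?scaler0 // scalerAr.
Qed.
HB.instance Definition _ := GRing.Lalgebra_isAlgebra.Build K calg calg_scaleAr.
HB.instance Definition _ := Algebra_isFalgebra.Build K calg.

Definition calg_delta (b : D) : calg := [ffun b' => (b' == b)%:R].

Lemma calg_deltaM p q : calg_delta p * calg_delta q =
  if mcomp p q is Some r then calg_delta r else 0.
Proof.
apply/ffunP=> b; rewrite ffunE (bigD1 p) //= (bigD1 q) //= !ffunE !eqxx mulr1.
rewrite !big1 ?addr0 => [|p' /negPf pp|q' /negPf qq].
- case: (mcomp p q) => [r|]; rewrite ffunE //.
  by rewrite (inj_eq Some_inj) eq_sym; case: eqP.
- by rewrite big1 // => q' _; rewrite !ffunE pp mul0r if_same.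
- by rewrite !ffunE qq mulr0 if_same.
Qed.

End ContractedAlgebra.

(** * The algebra with a given Kupisch series *)

Section KupischAlgebra.
Variables (N : nat) (c : nat -> nat).
Hypotheses (N0 : (0 < N)%N) (c0 : forall v, (0 < c v)%N).
Hypotheses (cN : forall v, c (v + N)%N = c v) (cS : forall v, (c v <= (c v.+1).+1)%N).

Let cmod v : c (v %% N)%N = c v.
Proof. by apply: (modn_congr cN); rewrite modn_mod. Qed.

Let cD v j : (c v <= c (v + j) + j)%N.
Proof.
elim: j => [|j IH]; first by rewrite !addn0.
by apply: leq_trans IH _; rewrite !addnS -addSn leq_add2r cS.
Qed.

Let L := (\max_(v < N) c v)%N.

(* [(v, l)] stands for the path of length [l] starting at [v]. *)
Definition kpath : Type := {p : 'I_N * 'I_L | (p.2 < c p.1)%N}.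
HB.instance Definition _ := Finite.on kpath.

Definition kstart (p : kpath) : nat := (val p).1.
Definition klen (p : kpath) : nat := (val p).2.

Lemma kpath_inj p q : kstart p = kstart q -> klen p = klen q -> p = q.
Proof.
case: p q => -[v l] h [[w k] h']; rewrite /kstart /klen /= => e1 e2.
by apply: val_inj; congr pair; apply: val_inj.
Qed.

Lemma kpath_bound p : (klen p < c (kstart p))%N.
Proof. exact: (valP p). Qed.

Lemma kstart_mod p : (kstart p %% N)%N = kstart p.
Proof. by rewrite modn_small // /kstart ltn_ord. Qed.

Definition mk_kpath (v l : nat) : option kpath :=
  [pick p : kpath | (kstart p == v %% N)%N && (klen p == l)].

Lemma mk_kpathP v l : (l < c v)%N ->
  exists p, [/\ mk_kpath v l = Some p, kstart p = (v %% N)%N & klen p = l].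
Proof.
move=> lc; rewrite /mk_kpath; case: pickP => [p /andP[/eqP e1 /eqP e2]|h].
  by exists p.
have vN := ltn_pmod v N0.
have lL : (l < L)%N.
  by apply: leq_trans lc _; rewrite -cmod; apply: (leq_bigmax (Ordinal vN)).
have lc' : ((Ordinal vN, Ordinal lL).2 < c (Ordinal vN, Ordinal lL).1)%N.
  by rewrite /= cmod.
by have := h (Sub (Ordinal vN, Ordinal lL) lc'); rewrite /kstart /klen /= !eqxx.
Qed.

Lemma mk_kpath_None v l : (c v <= l)%N -> mk_kpath v l = None.
Proof.
move=> cl; rewrite /mk_kpath; case: pickP => // p /andP[/eqP e1 /eqP e2].
by have := kpath_bound p; rewrite e1 e2 cmod ltnNge cl.
Qed.

Lemma mk_kpathK v l p : (kstart p = v %% N)%N -> klen p = l -> mk_kpath v l = Some p.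
Proof.
move=> e1 e2; have [|q [-> q1 q2]] := @mk_kpathP v l.
  by rewrite -e2 -cmod -e1 kpath_bound.
by congr Some; apply: kpath_inj; rewrite ?q1 ?q2 ?e1 ?e2.
Qed.

Definition kcomp (p q : kpath) : option kpath :=
  if kstart p + klen p == kstart q %[mod N] then mk_kpath (kstart p) (klen p + klen q)
  else None.

Definition ktriv (p : kpath) : bool := klen p == 0%N.

(** A path with a zero subpath is zero: this is [cD], and it makes the two bracketings vanish
    together. *)
Lemma kcompA p q r :
  obind (fun s => kcomp s r) (kcomp p q) = obind (kcomp p) (kcomp q r).
Proof.
rewrite {2 4}/kcomp.
case: (eqVneq ((kstart p + klen p) %% N) (kstart q %% N))%N => e; last first.
  case: ifP => //= _; case: (leqP (c (kstart q)) (klen q + klen r)) => h.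
    by rewrite mk_kpath_None.
  have [s [-> s1 s2]] := mk_kpathP h; rewrite /= /kcomp s1 modn_mod.
  by rewrite (negPf e).
have ce := modn_congr cN e; have cb := cD (kstart p) (klen p).
case: (leqP (c (kstart p)) (klen p + klen q)) => h.
  rewrite mk_kpath_None //=; case: ifP => //= _.
  case: (leqP (c (kstart q)) (klen q + klen r)) => h'; first by rewrite mk_kpath_None.
  have [s [-> s1 s2]] := mk_kpathP h'; rewrite /= /kcomp s1 modn_mod e eqxx s2.
  by rewrite mk_kpath_None //; lia.
have [s [-> s1 s2]] := mk_kpathP h; rewrite kstart_mod in s1.
rewrite /= {1}/kcomp s1 s2 addnA -modnDml e modnDml; case: ifP => //= _.
case: (leqP (c (kstart q)) (klen q + klen r)) => h'.
  by rewrite (mk_kpath_None h') mk_kpath_None //; lia.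
have [t [-> t1 t2]] := mk_kpathP h'; rewrite /= /kcomp t1 t2 modn_mod e eqxx.
by rewrite addnA.
Qed.

Lemma ktriv_comp v : exists2 e, ktriv e & kstart e = (v %% N)%N.
Proof.
have [e [_ e1 e2]] := @mk_kpathP v 0 (c0 v).
by exists e; rewrite // /ktriv e2.
Qed.

Lemma kcomp_unitl q : exists2 e, ktriv e & forall e', ktriv e' ->
  kcomp e' q = if e' == e then Some q else None.
Proof.
have [e te es] := ktriv_comp (kstart q); exists e => // e' te'.
rewrite /kcomp (eqP te') addn0 add0n; case: eqP => [eq|ne].
  have -> : e' = e.
    by apply: kpath_inj; rewrite ?(eqP te) ?(eqP te') // es -eq kstart_mod.
  by rewrite eqxx; apply: mk_kpathK; rewrite // es modn_mod kstart_mod.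
by case: eqP => // ee; case: ne; rewrite ee es modn_mod.
Qed.

Lemma kcomp_unitr q : exists2 e, ktriv e & forall e', ktriv e' ->
  kcomp q e' = if e' == e then Some q else None.
Proof.
have [e te es] := ktriv_comp (kstart q + klen q); exists e => // e' te'.
rewrite /kcomp (eqP te') addn0; case: eqP => [eq|ne].
  have -> : e' = e.
    by apply: kpath_inj; rewrite ?(eqP te) ?(eqP te') // es eq kstart_mod.
  by rewrite eqxx; apply: mk_kpathK; rewrite // kstart_mod.
by case: eqP => // ee; case: ne; rewrite ee es modn_mod.
Qed.

Lemma ktriv_ex : exists e, ktriv e.
Proof. by have [e te _] := ktriv_comp 0; exists e. Qed.

Definition kupisch_cat : fincat := Fincat kcompA kcomp_unitl kcomp_unitr ktriv_ex.

Variable K : fieldType.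
Definition kupisch_alg : falgType K := calg K kupisch_cat.

Definition kupisch_gen (v l : nat) : kupisch_alg :=
  if mk_kpath v l is Some p then calg_delta K (p : kupisch_cat) else 0.

Lemma kupisch_genE v l p : mk_kpath v l = Some p ->
  kupisch_gen v l = calg_delta K (p : kupisch_cat).
Proof. by rewrite /kupisch_gen => ->. Qed.

Lemma kupisch_gen0 v l : (c v <= l)%N -> kupisch_gen v l = 0.
Proof. by rewrite /kupisch_gen => /mk_kpath_None ->. Qed.

Lemma kupisch_nakayama : nakayama N c kupisch_gen.
Proof.
split=> //.
- by move=> v l; rewrite /kupisch_gen /mk_kpath modnDr.
- move=> v l; case: leqP => [/kupisch_gen0 ->|/mk_kpathP[p [e _ _]]]; first exact: eqxx.
  rewrite (kupisch_genE e); apply/eqP => /ffunP/(_ p); rewrite !ffunE eqxx => /eqP.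
  by rewrite oner_eq0.
- move=> v l w k; have cb := cD v l.
  case: (leqP (c v) l) => [vl|/mk_kpathP[p [ep p1 p2]]].
    by rewrite !(kupisch_gen0 (v := v)) ?mul0r ?if_same // (leq_trans vl) ?leq_addr.
  case: (leqP (c w) k) => [wk|/mk_kpathP[q [eq q1 q2]]].
    rewrite (kupisch_gen0 wk) mulr0; case: eqP => // e; rewrite kupisch_gen0 //.
    by have := modn_congr cN e; lia.
  rewrite (kupisch_genE ep) (kupisch_genE eq) calg_deltaM /= /kcomp p1 p2 q1 q2.
  rewrite modnDml modn_mod /kupisch_gen; case: eqP => // e.
  by rewrite /mk_kpath modn_mod.
- apply/ffunP=> b; rewrite [RHS]ffunE sum_ffunE /=.
  have sN : (kstart b < N)%N by rewrite ltn_ord.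
  rewrite (bigD1 (Ordinal sN)) //= big1 => [|v vb].
    have [p [e p1 p2]] := mk_kpathP (c0 (kstart b)).
    rewrite addr0 (kupisch_genE e) ffunE /ktriv; congr (_%:R); congr nat_of_bool.
    apply/eqP/eqP => [->//|b0]; apply: kpath_inj; rewrite ?p1 ?p2 //.
    by rewrite kstart_mod.
  have [p [e p1 p2]] := mk_kpathP (c0 v); rewrite (kupisch_genE e) ffunE.
  case: eqP => // bp; case/eqP: vb; apply: val_inj => /=.
  by rewrite bp p1 modn_small.
move=> a; exists (fun v l => if mk_kpath v l is Some p then a p else 0).
apply/ffunP=> b; rewrite sum_ffunE.
have sN : (kstart b < N)%N by rewrite ltn_ord.
rewrite (bigD1 (Ordinal sN)) //= [X in _ + X]big1 => [|v vb].
  rewrite addr0 sum_ffunE (bigD1 (Ordinal (kpath_bound b))) //= big1 => [|l lb].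
    have e : mk_kpath (kstart b) (klen b) = Some b by apply: mk_kpathK; rewrite ?kstart_mod.
    by rewrite addr0 !ffunE e /kupisch_gen e ffunE eqxx /GRing.scale /= mulr1.
  rewrite !ffunE; have [p [e p1 p2]] := mk_kpathP (ltn_ord l); rewrite (kupisch_genE e) ffunE.
  case: eqP => [bp|_]; last by rewrite scaler0.
  by case/eqP: lb; apply: val_inj; rewrite /= -p2 -bp.
rewrite sum_ffunE big1 // => l _; rewrite !ffunE.
have [p [e p1 p2]] := mk_kpathP (ltn_ord l); rewrite (kupisch_genE e) ffunE.
case: eqP => [bp|_]; last by rewrite scaler0.
by case/eqP: vb; apply: val_inj; rewrite /= bp p1 modn_small.
Qed.

End KupischAlgebra.

(** * Presentation by the cyclic quiver with an admissible ideal *)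

Section CyclicQuiver.
Variables (K : fieldType) (A : falgType K) (N : nat) (c : nat -> nat).
Variables (x : nat -> nat -> A) (nak : nakayama N c x).
Hypothesis c2 : forall v, (1 < c v)%N.
Local Notation Q := (cyclic_quiver N).

Lemma cyclic_is_walk (v : vertex Q) (s : seq (arrow Q)) :
  is_walk v s = (s == traject (@ordS N) v (size s)).
Proof.
elim: s v => //= a s IHs v; rewrite IHs eqseq_cons.
by case: eqP => // ->.
Qed.

Lemma cyclic_target (p : qpath Q) :
  path_target p = path_source p + path_length p %[mod N].
Proof.
case: p => -[v s] w; rewrite /path_target /path_source /path_length /path_arrows /= in w *.
elim: s v w => [|a s IHs] v /=; first by rewrite addn0.
by case/andP=> /eqP <- /IHs ->; rewrite modnDml addSnnS.
Qed.

Lemma cyclic_path_inj (p q : qpath Q) :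
  path_source p = path_source q -> path_length p = path_length q -> p = q.
Proof.
case: p q => -[v s] /= ws [[w t] /= wt] vw sz; apply: val_inj => /=.
rewrite /path_source /path_length /path_arrows /= in vw sz.
move: ws wt; rewrite !cyclic_is_walk vw sz => /eqP e1 /eqP e2; congr pair => //.
exact: etrans e1 (esym e2).
Qed.

Lemma cyclic_walkP (v : 'I_N) l :
  is_walk (v : vertex Q) (traject (@ordS N) v l : seq (arrow Q)).
Proof. by rewrite cyclic_is_walk size_traject. Qed.

Definition cyclic_path v l : qpath Q := @QPath Q (v, _) (cyclic_walkP v l).

Definition cyclic_gen (p : qpath Q) : A := x (path_source p) (path_length p).

Definition cyclic_map (z : {malg K[qpath Q]}) : A :=
  \sum_(p <- msupp z) z@_p *: cyclic_gen p.

Lemma cyclic_mapEw (d : {fset qpath Q}) z : (msupp z `<=` d)%fset ->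
  cyclic_map z = \sum_(p <- d) z@_p *: cyclic_gen p.
Proof.
move=> sub; apply: big_fset_incl => // p _ /mcoeff_outdom ->.
by rewrite scale0r.
Qed.

Lemma cyclic_map_linear : linear cyclic_map.
Proof.
move=> k y z; pose d := (msupp (k *: y + z) `|` msupp y `|` msupp z)%fset.
rewrite !(@cyclic_mapEw d); first last.
- by rewrite /d -fsetUA fsubsetUl.
- by rewrite /d fsetUAC fsubsetUr.
- by rewrite /d fsubsetUr.
rewrite scaler_sumr -big_split; apply: eq_bigr => p _ /=.
by rewrite mcoeffD mcoeffZ scalerDl scalerA.
Qed.
HB.instance Definition _ :=
  GRing.isLinear.Build K {malg K[qpath Q]} A *:%R cyclic_map cyclic_map_linear.

Lemma cyclic_mapU k p : cyclic_map << k *g p >> = k *: cyclic_gen p.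
Proof.
rewrite (@cyclic_mapEw [fset p]%fset) ?msuppU_le // big_seq_fset1 mcoeffUU //.
Qed.

Lemma cyclic_mapM y z : cyclic_map (path_mul y z) = cyclic_map y * cyclic_map z.
Proof.
rewrite /path_mul linear_sum /= [in RHS]/cyclic_map mulr_suml; apply: eq_bigr => p _.
rewrite linear_sum mulr_sumr; apply: eq_bigr => q _.
rewrite -scalerAl -scalerAr scalerA (nak_mul nak) -cyclic_target.
case: (eqVneq (path_target p) (path_source q)) => [e|ne].
  rewrite e eqxx; have [r -> rw] := path_catE e; rewrite /= cyclic_mapU; congr (_ *: _).
  by rewrite /cyclic_gen /path_source /path_length /path_arrows rw /= size_cat.
rewrite path_cat_None // linear0 !modn_small // (inj_eq val_inj) (negPf ne).
by rewrite scaler0.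
Qed.

(** As all [c v] are at least 2, trivial paths and arrows stay independent: for such a path [p] from
    [v], projecting to [P_v] and reading the coordinate of index [path_length p] returns the
    coefficient of [p]. *)
Lemma cyclic_map_ker z : cyclic_map z = 0 -> arrow_ideal 2 z.
Proof.
move=> z0 p pz; rewrite leqNgt; apply/negP => p2.
set v := path_source p; set l := path_length p in p2.
have uP := proj_uniserial nak v.
have [F FP] := uni_lfun uP (fun k => (k == l)%:R : K^o).
have F0 k : F (proj_gen x v k) = ((k < c v)%N && (k == l))%:R.
  case: (ltnP k (c v)) => kc; first by rewrite FP.
  by rewrite (uni_out uP) // linear0.
have [E EE] := ideal_lfun (x v 0%N).
have : F (E (cyclic_map z)) = z@_p.
  rewrite /cyclic_map !linear_sum (big_fsetD1 p) //= big_seq big1 => [|q].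
    rewrite addr0 !linearZ /= EE F0 eqxx andbT (leq_trans p2 (c2 v)).
    by rewrite /GRing.scale /= mulr1.
  rewrite in_fsetD1 => /andP[qp _]; rewrite !linearZ /= EE /cyclic_gen.
  case: (eqVneq (path_source q) v) => [qv|qv].
    rewrite qv F0; case: eqP => [ql|_]; last by rewrite andbF scaler0.
    by case/eqP: qp; apply: cyclic_path_inj.
  have -> : ideal_elt (x v 0%N) (x (path_source q) (path_length q)) = 0.
    apply: subvs_inj; rewrite ideal_eltE linear0 (nak_mul nak) addn0 !modn_small //.
    by rewrite eq_sym (inj_eq val_inj) (negPf qv).
  by rewrite linear0 scaler0.
rewrite z0 !linear0 => /esym/eqP; rewrite mcoeff_eq0 pz //.
Qed.

Lemma nakayama_cyclic : cyclic_nakayama A.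
Proof.
exists N; first exact: (nak_rank nak).
exists (fun z => cyclic_map z = 0); last first.
  exists (cyclic_map : {linear _ -> _}); split=> [a||y z|z] //.
  - have [f ->] := nak_span nak a.
    exists (\sum_(v < N) \sum_(l < c v) << f v l *g cyclic_path v l >>).
    rewrite linear_sum; apply: eq_bigr => v _; rewrite linear_sum; apply: eq_bigr => l _ /=.
    rewrite cyclic_mapU /cyclic_gen /path_length /path_arrows /= size_traject //.
  - rewrite /path_one linear_sum -(nak_one nak); apply: eq_bigr => v _ /=.
    by rewrite cyclic_mapU scale1r.
  - exact: cyclic_mapM.
split.
- split=> [|y z y0 z0|y z z0|y z y0].
  + exact: linear0.
  + by rewrite linearD /= y0 z0 addr0.
  + by rewrite cyclic_mapM z0 mulr0.
  + by rewrite cyclic_mapM y0 mul0r.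
- have [t t0] := gen_nilpotent nak; exists (maxn 2 t); first exact: leq_maxl.
  move=> z zt; rewrite /cyclic_map big_seq big1 // => p /zt.
  rewrite geq_max => /andP[_ tp]; rewrite /cyclic_gen -(subnKC tp).
  by rewrite -(gen_mulD nak) t0 mul0r scaler0.
- exact: cyclic_map_ker.
Qed.

End CyclicQuiver.

(** * The construction *)

Section Corner.
Variables (K : fieldType) (T A : falgType K).
Variables (e : A) (psi : 'Hom(T, A)).
Hypotheses (psiM : forall y z, psi (y * z) = psi y * psi z) (psi1 : psi 1 = e).
Hypothesis psi_inj : forall y, psi y = 0 -> y = 0.
Hypothesis psi_surj : forall a, exists y, psi y = e * a * e.

(** [End(e A)] is [e A e] acting by left multiplication, an endomorphism corresponding to its value
    at [e]; [psi] identifies [T] with that corner. *)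
Lemma corner_is_End : is_End (right_ideal e) T.
Proof.
have ee : e * e = e by rewrite -psi1 -psiM mulr1.
have el y : e * psi y = psi y by rewrite -psi1 -psiM mul1r.
have er y : psi y * e = psi y by rewrite -psi1 -psiM mulr1.
pose M := right_ideal e; have [E EE] := ideal_lfun e.
have [|V VE] := @linear_lfun K M A (fun y => vsval y); first by move=> k y z.
have [|phi phiE] := @linear_lfun K T 'Hom(M, M) (fun t => E \o (amull (psi t) \o V))%VF.
  move=> k y z; rewrite !linearP /= comp_lfunDl comp_lfunDr.
  by rewrite -comp_lfunZl -comp_lfunZr.
have valE t (y : M) : vsval (phi t y) = psi t * vsval y.
  by rewrite phiE !comp_lfunE EE VE ideal_eltE lfunE /= mulrA el.
have eltE (y : M) : e * vsval y = vsval y.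
  by have [a ->] := ideal_eltP y; rewrite ideal_eltE mulrA ee.
exists phi; split=> [|f||y z].
- apply: lker_inj => t t0; apply: psi_inj; rewrite -er.
  by have := valE t (ideal_elt e 1); rewrite t0 zero_lfunE linear0 ideal_eltE mulr1.
- split=> [/memv_imgP[t _ ->] y a|hf].
    by apply: subvs_inj; rewrite valE !sub_ractE valE /= mulrA.
  pose u : M := ideal_elt e 1; have [t te] := psi_surj (vsval (f u)).
  apply/memv_imgP; exists t; rewrite ?memvf //; apply/lfunP=> y; apply: subvs_inj.
  rewrite valE te eltE -mulrA eltE.
  have {1}-> : y = ract u (vsval y).
    by apply: subvs_inj; rewrite sub_ractE ideal_eltE /= mulr1 eltE.
  by rewrite hf sub_ractE.
- by apply/lfunP=> y; apply: subvs_inj; rewrite valE psi1 eltE id_lfunE.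
- by apply/lfunP=> w; apply: subvs_inj; rewrite comp_lfunE !valE psiM mulrA.
Qed.
End Corner.

(** * The cyclic algebra and its corner at the relation ends *)

Section Construction.
Variables (K : fieldType) (n : nat) (T : falgType K) (c b J : nat -> nat).
Variables (x : nat -> nat -> T) (nakT : nakayama n c x).
Hypothesis cb : forall v, (v < n)%N -> (v + c v <= n)%N.
Hypothesis c2 : forall v, (v.+1 < n)%N -> (1 < c v)%N.
Hypotheses (int : interleaving (fun i => i + c i)%N n.-1 b J) (b0 : (0 < b 0)%N).
Hypothesis bgap : forall i, i.+2 = n -> (b i + 2 <= b i.+1)%N.
Let N := (b n.-1).+1.
Let C := kupisch n b J.

Let n0 : (0 < n)%N := nak_rank nakT.
Let dn i : (i < n)%N -> (i < i + c i <= n)%N.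
Proof. by move=> iN; have := nak_len_gt0 nakT i; have := cb iN; lia. Qed.
Let d2 i : (i.+1 < n)%N -> (i.+1 < i + c i)%N.
Proof. by move=> /c2; lia. Qed.

Let C2 v : (1 < C v)%N. Proof. exact: (kupisch_gt1 n0 dn d2 b0 int bgap). Qed.
Let C0 v : (0 < C v)%N. Proof. exact: ltnW (C2 v). Qed.
Let CN v : C (v + N)%N = C v. Proof. exact: kupisch_periodic. Qed.
Let CS v : (C v <= (C v.+1).+1)%N. Proof. exact: (kupisch_step n0 dn d2 b0 int bgap). Qed.

Definition cyc_alg : falgType K := kupisch_alg (ltn0Sn (b n.-1)) C0 CN CS K.
Definition cyc_gen : nat -> nat -> cyc_alg := @kupisch_gen _ _ _ _ _ _ K.
Local Notation X := cyc_gen.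

Let nakX : nakayama N C cyc_gen. Proof. exact: kupisch_nakayama. Qed.

Lemma cyc_alg_cyclic : cyclic_nakayama cyc_alg.
Proof. exact: (nakayama_cyclic nakX). Qed.

Lemma cyc_alg_defect :
  has_alg_defect cyc_alg (\sum_(v < N) (C v == (C v.+1).+1))%N.
Proof.
rewrite -(sum_positive_parts (ltn0Sn _) CN CS); exact: (nakayama_defect nakX).
Qed.

Lemma cyc_alg_domdim v : (v < b n.-1)%N -> J v.+1 = J v ->
  (forall i, (i < n)%N -> b i <> v.+1) -> has_domdim cyc_alg 1.
Proof.
move=> vN Jv bv; apply: (nakayama_domdim1 nakX (v := v.+1)).
  have -> : vpred N v.+1 = (v + N)%N by rewrite /vpred /N /= addSnnS.
  rewrite CN; have := kupisch_drop n0 dn d2 b0 int bgap (v := v).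
  by rewrite Jv eqxx ltnS => /(_ vN)/eqP; rewrite -/C => ->.
move=> u; have [i iN ->] := proj_end_socle n0 dn d2 b0 int bgap u.
rewrite !modn_small ?(rel_end_ltN n0 b0 int) //; exact: bv.
Qed.

Definition rel_idem : cyc_alg := idem X (fun i : 'I_n => b i).

Let bN (i : 'I_n) : (b i < N)%N. Proof. exact: (rel_end_ltN n0 b0 int). Qed.
Let b_inj : injective (fun i : 'I_n => b i).
Proof.
move=> i j e; apply: val_inj.
exact: (rel_end_congr n0 b0 int (ltn_ord i) (ltn_ord j) (congr1 (modn^~ N) e)).
Qed.

(** The image intended for [x i l]: the path from [b i] to [b (i + l)]. *)
Let Y i l : cyc_alg := if (i + l < n)%N then X (b i) (b (i + l) - b i) else 0.

(** The prescription [J (b i) = d i] is used here: [P_(b i)] is cut off by the relation of index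
    [i + c i], so a path that vanishes in [T] goes to one reaching that relation's end. *)
Let gen0 i l : (i < n)%N -> (c i <= l)%N -> Y i l = 0.
Proof.
move=> iN cl; rewrite /Y; case: ifP => // il; apply: (gen_eq0 nakX).
have := kupisch_rel_end n0 dn d2 b0 int bgap iN; rewrite -/C => e.
have : (rel_end n b (i + c i) <= rel_end n b (i + l))%N.
  by apply: (rel_end_le n0 b0 int); lia.
by rewrite {2}/rel_end il; lia.
Qed.

Let YM i l j k : (i < n)%N -> (j < n)%N ->
  Y i l * Y j k = if (i + l == j)%N then Y i (l + k) else 0.
Proof.
move=> iN jN; rewrite /Y; case: ifP => il; last first.
  rewrite mul0r; case: eqP => // e; by move: il; rewrite e jN.
case: ifP => jk; last first.
  rewrite mulr0; case: eqP => // e; rewrite ifN //.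
  by rewrite addnA e jk.
have le_b : (b i <= b (i + l))%N.
  by case: (posnP l) => [->|l0]; [rewrite addn0|apply/ltnW/(rel_end_lt n0 b0 int); lia].
have le_b' : (b j <= b (j + k))%N.
  by case: (posnP k) => [->|k0]; [rewrite addn0|apply/ltnW/(rel_end_lt n0 b0 int); lia].
rewrite (nak_mul nakX) subnKC //; case: (eqVneq (i + l)%N j) => [e|ne].
  by rewrite e eqxx addnA e jk; congr X; move: le_b; rewrite e; lia.
by case: eqP => // /(rel_end_congr n0 b0 int il jN)/eqP; rewrite (negPf ne).
Qed.

Lemma corner_map : exists psi : 'Hom(T, cyc_alg),
  forall i l, (i < n)%N -> psi (x i l) = Y i l.
Proof.
have [F FP] : exists F : forall i : 'I_n, 'Hom(proj_rmod x i, cyc_alg),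
    forall (i : 'I_n) k, (k < c i)%N -> F i (proj_gen x i k) = Y i k.
  apply: (@fin_all_exists _ (fun i : 'I_n => 'Hom(proj_rmod x i, cyc_alg))
    (fun i h => forall k, (k < c i)%N -> h (proj_gen x i k) = Y i k)) => i.
  exact: (uni_lfun (proj_uniserial nakT i)).
have [E EE] : exists E : forall i : 'I_n, 'Hom(T, proj_rmod x i),
    forall i, E i =1 ideal_elt (x i 0%N).
  apply: (@fin_all_exists _ (fun i : 'I_n => 'Hom(T, proj_rmod x i))
    (fun i h => h =1 ideal_elt (x i 0%N))) => i; exact: ideal_lfun.
exists (\sum_i (F i \o E i))%VF => i l iN; pose i' := Ordinal iN.
have h (j : 'I_n) : (F j \o E j)%VF (x i l) = if j == i' then Y i l else 0.
  rewrite comp_lfunE EE; case: eqP => [->|ji].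
    case: (ltnP l (c i)) => lc; first exact: (FP i').
    rewrite gen0 // -/(proj_gen x i' l).
    by rewrite (uni_out (proj_uniserial nakT i')) // linear0.
  rewrite (_ : ideal_elt _ _ = 0) ?linear0 //; apply: subvs_inj.
  rewrite ideal_eltE linear0 (nak_mul nakT) addn0 !modn_small //.
  by case: eqP => // e; case: ji; apply: val_inj.
by rewrite sum_lfunE (eq_bigr _ (fun j _ => h j)) -big_mkcond big_pred1_eq.
Qed.

Lemma corner_iso : exists psi : 'Hom(T, cyc_alg),
  [/\ forall y z, psi (y * z) = psi y * psi z, psi 1 = rel_idem,
      forall y, psi y = 0 -> y = 0
    & forall a, exists y, psi y = rel_idem * a * rel_idem].
Proof.
have [psi psiE] := corner_map; exists psi; split.
- move=> y z; have [f ->] := nak_span nakT y; have [g ->] := nak_span nakT z.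
  rewrite mulr_suml !linear_sum [RHS]mulr_suml; apply: eq_bigr => i _ /=.
  rewrite mulr_suml !linear_sum [RHS]mulr_suml; apply: eq_bigr => l _ /=.
  rewrite mulr_sumr !linear_sum [RHS]mulr_sumr; apply: eq_bigr => j _ /=.
  rewrite mulr_sumr !linear_sum [RHS]mulr_sumr; apply: eq_bigr => k _ /=.
  rewrite -scalerAl -scalerAr !linearZ /= -scalerAl -scalerAr; congr (_ *: (_ *: _)).
  rewrite (nak_mul nakT) !psiE // YM //.
  have il : (i + l < n)%N by have := cb (ltn_ord i); have := ltn_ord l; lia.
  by rewrite !modn_small //; case: eqP => _; rewrite ?linear0 ?psiE.
- rewrite -(nak_one nakT) linear_sum; apply: eq_bigr => i _ /=.
  by rewrite psiE // /Y addn0 ltn_ord subnn.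
- move=> y; have [f ->] := nak_span nakT y; rewrite linear_sum => e.
  rewrite big1 // => i _; rewrite big1 // => l _.
  suff -> : f i l = 0 by rewrite scale0r.
  have uP := proj_uniserial nakX (b i).
  have il : (i + l < n)%N by have := cb (ltn_ord i); have := ltn_ord l; lia.
  have [F FP] := uni_lfun uP (fun t => (t == b (i + l) - b i)%N%:R : K^o).
  have [E EE] := ideal_lfun (X (b i) 0%N).
  (* Conversely, for [k < c i] the path from [b i] to [b (i + k)] stops inside [P_(b i)]. These
     paths have distinct lengths, so the functional [F] reads off the coefficient [f i l]. *)
  have bC k : (k < c i)%N -> (b (i + k) - b i < C (b i))%N.
    move=> kc; have ik : (i + k < n)%N by have := cb (ltn_ord i); lia.
    have := kupisch_rel_end n0 dn d2 b0 int bgap (ltn_ord i); rewrite -/C.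
    have : (rel_end n b (i + k) < rel_end n b (i + c i))%N.
      by apply: (rel_end_mono n0 b0 int); [lia|exact: cb].
    rewrite {1}/rel_end ik; have := C0 (b i); lia.
  have := congr1 (fun y => F (E y)) e; rewrite !linear0 !linear_sum (bigD1 i) //=.
  rewrite [X in _ + X]big1 => [|j ji]; last first.
    rewrite !linear_sum big1 // => k _; rewrite !linearZ /= psiE // EE /Y.
    case: ifP => jk; last first.
      by rewrite (_ : ideal_elt _ 0 = 0) ?linear0 ?scaler0 // -EE linear0.
    rewrite (_ : ideal_elt _ _ = 0) ?linear0 ?scaler0 //; apply: subvs_inj.
    rewrite ideal_eltE linear0 (nak_mul nakX) addn0; case: eqP => // ij.
    case/eqP: ji; apply: val_inj; apply/esym.
    exact: (rel_end_congr n0 b0 int (ltn_ord i) (ltn_ord j) ij).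
  rewrite addr0 !linear_sum (bigD1 l) //= [X in _ + X]big1 => [|k kl].
    rewrite addr0 !linearZ /= psiE // EE /Y il FP ?bC // eqxx /GRing.scale /=.
    by rewrite mulr1.
  have ik : (i + k < n)%N by have := cb (ltn_ord i); have := ltn_ord k; lia.
  rewrite !linearZ /= psiE // EE /Y ik FP ?bC // (_ : (_ == _) = false) ?scaler0 //.
  apply/eqP => eb; case/eqP: kl; apply: val_inj => /=.
  case: (ltngtP k l) => // h.
    have := rel_end_lt n0 b0 int (i := i + k) (j := i + l).
    have := rel_end_lt n0 b0 int (i := i) (j := i + l); lia.
  have := rel_end_lt n0 b0 int (i := i + l) (j := i + k).
  have := rel_end_lt n0 b0 int (i := i) (j := i + k); lia.
move=> a; have [f ->] := nak_span nakX a.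
pose Q a' := exists y, psi y = rel_idem * a' * rel_idem.
have QD a1 a2 : Q a1 -> Q a2 -> Q (a1 + a2).
  by case=> y1 e1 [y2 e2]; exists (y1 + y2); rewrite linearD /= e1 e2 mulrDr mulrDl.
have Q0 : Q 0 by exists 0; rewrite linear0 mulr0 mul0r.
rewrite -/(Q _); apply: (big_ind Q) => // u _; apply: (big_ind Q) => // t _.
suff [y ey] : Q (X u t).
  by exists (f u t *: y); rewrite linearZ /= ey -scalerAr -scalerAl.
move: (nat_of_ord t) => {}t; move: (nat_of_ord u) (ltn_ord u) => {}u uN.
have idl w : (forall i : 'I_n, b i <> w %[mod N]) -> forall s, rel_idem * X w s = 0.
  move=> bw s; rewrite /rel_idem /idem mulr_suml big1 // => i _.
  by rewrite (nak_mul nakX) addn0; case: eqP => // /bw.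
case: (boolP [exists i : 'I_n, b i == u]) => [/existsP[i /eqP <-]|]; last first.
  rewrite negb_exists => /forallP h; exists 0; rewrite linear0 idl ?mul0r // => i.
  by rewrite !modn_small // => /eqP; rewrite (negPf (h i)).
rewrite /Q; have -> : rel_idem * X (b i) t = X (b i) t by exact: (idem_mul nakX bN b_inj).
case: (leqP (C (b i)) t) => tC; first by exists 0; rewrite linear0 (gen_eq0 nakX) // mul0r.
case: (boolP [exists j : 'I_n, b j == b i + t %[mod N]]) => [/existsP[j /eqP bj]|]; last first.
  rewrite negb_exists => /forallP h; exists 0; rewrite linear0 /rel_idem /idem mulr_sumr.
  rewrite big1 // => j _; rewrite (nak_mul nakX) eq_sym (negPf (h j)) //.
have -> : X (b i) t * rel_idem = X (b i) t.
  have e : X (b i) t = X (b i) t * X (b j) 0%N by rewrite (nak_mul nakX) bj eqxx addn0.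
  by rewrite {1}e -mulrA (mul_idem nakX bN b_inj) -e.
(* A nonzero path from [b i] stops before [b 0 + N], so it cannot end at a translate [b j + N]: no
   path of the corner winds around the cycle. *)
have itN : (b i + t < b 0 + N)%N.
  have := kupisch_rel_end n0 dn d2 b0 int bgap (ltn_ord i); rewrite -/C.
  have := rel_end_le n0 b0 int (cb (ltn_ord i)) (leqnn n); rewrite {2}/rel_end ltnn -/N; lia.
have b0j : (b 0 <= b j)%N.
  by case: (posnP j) => [->//|j0]; apply/ltnW/(rel_end_lt n0 b0 int).
have bjE : (b i + t)%N = b j.
  move: bj; rewrite (modn_small (bN j)); case: (ltnP (b i + t) N) => h.
    by rewrite modn_small.
  have bjN := bN j; have -> : (b i + t = b i + t - N + N)%N by lia.
  by rewrite modnDr modn_small; lia.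
have ij : (i <= j)%N.
  by rewrite leqNgt; apply/negP => ji; have := rel_end_lt n0 b0 int ji (ltn_ord i); lia.
exists (x i (j - i)); rewrite psiE // /Y subnKC // ltn_ord; congr X; lia.
Qed.

(** The socles of projectives are the simples at the [b i - 1], their translates the simples at the
    [b i], so the module in question is the sum of the [P_(b i)]. *)
Lemma cyc_alg_epsilon : is_epsilon cyc_alg T.
Proof.
have uS := uni_rmodP nakX (C0 _).
exists n, (fun i : 'I_n => uni_rmod nakX (vpred N (b i)) 1),
  (fun i : 'I_n => uni_rmod nakX (b i) 1), (fun i : 'I_n => proj_rmod X (b i)),
  (right_ideal rel_idem); split.
- have pE i : vpred N (b i) + 1 = b i %[mod N] by rewrite addn1 (vpredK nakX).
  split=> [i|i j [f [hf kf imf]]|M [P iP /(socle_uni nakX)]].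
  + have [v vN e] := socle_surj n0 dn d2 b0 int bgap (ltn_ord i); rewrite -/C in e.
    exists (proj_rmod X v); first exact: (proj_rmod_indec nakX).
    apply: (uni_is_socle nakX (proj_uniserial nakX v) (uS _)); apply/eqP.
    by rewrite -(eqn_modDr 1) pE -addnA addn1 prednK ?C0 // e.
  + have := uni_top_uniq nakX (ltnSn 0) (uni_transport (uS _) hf imf kf) (uS _).
    move/eqP; rewrite -(eqn_modDr 1) !pE => /eqP h; apply: val_inj.
    exact: (rel_end_congr n0 b0 int (ltn_ord i) (ltn_ord j) h).
  have [v vN [p uP]] := indec_projective_uni nakX iP => /(_ _ _ uP)[s us].
  have [i iN e] := proj_end_socle n0 dn d2 b0 int bgap v; rewrite -/C in e.
  exists (Ordinal iN); apply: (uni_iso nakX us (uS _)); apply/eqP => /=.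
  by rewrite -(eqn_modDr 1) pE -addnA addn1 prednK ?C0 // e.
- move=> i; apply: (uni_tau nakX (uS _) (uS _)); [by rewrite (vpredK nakX)|exact: C2].
- move=> i; exact: (uni_proj_cover nakX (uS _) (proj_uniserial nakX _)).
- exact: (idem_direct_sum nakX bN b_inj).
have [psi [psiM psi1 inj surj]] := corner_iso; exact: (corner_is_End psiM psi1).
Qed.

End Construction.

Local Close Scope ring_scope.

(** A drop of [c] is a repeated value of [i + c i]. There is none at the last vertex, whose
    projective is simple. *)
Lemma linear_sum_defect n (c : nat -> nat) : 0 < n -> (forall v, 0 < c v) ->
  (forall v, c (v + n) = c v) -> (forall v, c v <= (c v.+1).+1) ->
  (forall v, v < n -> v + c v <= n) ->
  \sum_(v < n) (c v - c (vpred n v)) = repeats (fun i => i + c i) n.-1.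
Proof.
move=> n0 c0 cN cS cb; rewrite (sum_positive_parts n0 cN cS).
case: n n0 cN cb => // n _ cN cb; rewrite big_ord_recr /=.
rewrite (_ : (c n == (c n.+1).+1) = false) ?addn0.
  by apply: eq_bigr => i _; congr nat_of_bool; apply/eqP/eqP; lia.
by have := cb n (ltnSn n); have := c0 n.+1; case: eqP => //; lia.
Qed.

Theorem lemma4p5p1 (K : fieldType) (n : nat) (Theta : falgType K)
    (S P : 'I_n -> rmod Theta) (v w : 'I_n -> nat) (m : nat) :
  linear_nakayama n Theta ->
  linear_labelling S P ->
  (forall i, has_defect (P i) (v i)) ->
  1 <= m ->
  (forall i : 'I_n, w i = v i + (if i == 0 :> nat then m else 0)) ->
  ~ (n = 1 /\ m = 1) ->
  exists Lambda : falgType K,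
    [/\ cyclic_nakayama Lambda,
        is_epsilon Lambda Theta,
        has_alg_defect Lambda (\sum_i w i)
      & has_domdim Lambda 1].
Proof.
move=> /linear_nakayama_gen[c [x [nak cb c2]]] [simS _ covP] defP m0 wE nm.
have n0 := nak_rank nak; have c0 := nak_len_gt0 nak.
have dn i : i < n -> i < i + c i <= n.
  by move=> iN; have := cb i iN; have := c0 i; lia.
have d2 i : i.+1 < n -> i.+1 < i + c i by move/c2; lia.
have dm i : i.+1 < n -> i + c i <= i.+1 + c i.+1.
  by move=> _; have := nak_lenS nak i; lia.
have [b [J [int bE b0 bgap [u [ub uJ bu]]]]] := interleaving_final n0 m0 nm dn d2 dm.
exists (cyc_alg nak cb c2 int b0 bgap); split.
- exact: cyc_alg_cyclic.
- exact: cyc_alg_epsilon.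
- have := cyc_alg_defect nak cb c2 int b0 bgap.
  suff -> : \sum_i w i = \sum_(v < (b n.-1).+1)
    (kupisch n b J v == (kupisch n b J v.+1).+1) by [].
  have := sum_kupisch_drops n0 dn d2 b0 int bgap.
  have := linear_sum_defect n0 c0 (nak_lenD nak) (nak_lenS nak) cb.
  rewrite -(sum_defect nak simS covP defP) (eq_bigr _ (fun i _ => wE i)) big_split /=.
  have -> : \sum_(i < n) (if i == 0 :> nat then m else 0) = m.
    by case: (n) n0 => // n' _; rewrite big_ord_recl big1 //= addn0.
  (* The number of drops is [N - n], and [bE] says that [N = n + def Theta + m]. *)
  move: bE; set s1 := \sum_(v < _) _; set s2 := \sum_i v i; lia.
exact: (cyc_alg_domdim nak cb c2 int b0 bgap ub uJ bu).
Qed.
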